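(* There exists a Banach space $X$ such that $GL(X)=\infty$ and $GL_{fin}(X)<\infty$.
   Context: Operators are bounded linear operators between Banach spaces. An operator $u:X\to Y$ is absolutely summing if there is a constant $\lambda>0$ such that for every finite family $x_1,\dots,x_n\in X$ one has $\sum_{i=1}^n\|u(x_i)\|\le \lambda\,\sup\{\sum_{i=1}^n|f(x_i)| : f\in X^*,\ \|f\|\le 1\}$; the smallest such $\lambda$ is the absolutely summing norm $\pi_1(u)$. Let $k_Y:Y\to Y^{**}$ be the canonical embedding. An operator $u:X\to Y$ is $L_1$-factorable if there exist a measure $\mu$ and operators $v:X\to L_1(\mu)$, $w:L_1(\mu)\to Y^{**}$ with $k_Y\circ u=w\circ v$. Put $\gamma_1(u)=\inf\{\|v\|\,\|w\| : k_Y\circ u=w\circ v\}$, the infimum being over all such factorizations, with $\gamma_1(u)=\infty$ if $u$ is not $L_1$-factorable. For a Banach space $X$ define the Gordon-Lewis constant $$GL(X)=\sup\{\gamma_1(u)/\pi_1(u)\ :\ u:X\to Y\},$$ where the supremum is over all Banach spaces $Y$ and all (nonzero) absolutely summing operators $u:X\to Y$, and its finite-dimensional version $$GL_{fin}(X)=\sup\{\gamma_1(u)/\pi_1(u)\ :\ u:X\to l_2,\ \dim u(X)<\infty\},$$ where the supremum is over all (nonzero) finite rank operators $u:X\to l_2$. For a finite rank operator that is nonzero, $0<\pi_1(u)<\infty$. *)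

(* Defs.v *)
From HB Require Import structures.
From mathcomp Require Import all_boot all_order all_algebra.
From mathcomp Require Import all_classical all_reals all_analysis.
From mathcomp Require Import measurable_realfun measurable_fun_approximation ess_sup_inf.

Set Implicit Arguments.
Unset Strict Implicit.
Unset Printing Implicit Defensive.
Import Order.TTheory GRing.Theory Num.Theory.
Import numFieldNormedType.Exports.

Local Open Scope classical_set_scope.
Local Open Scope ring_scope.

Section BoundedOp.
Context (R : realType) (X Y : normedModType R).

Definition bounded_op : {pred X -> Y} :=
  mem [set f | linear f /\ exists M : R, forall x, `|f x| <= M * `|x|].

Record boundedOp := BoundedOp {
  bop_fun :> X -> Y;
  _ : bop_fun \in bounded_op }.

HB.instance Definition _ := [isSub for bop_fun].
HB.instance Definition _ := [Choice of boundedOp by <:].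

Lemma bounded_opP (f : X -> Y) : f \in bounded_op <->
  linear f /\ exists M : R, forall x, `|f x| <= M * `|x|.
Proof. by rewrite inE. Qed.

Lemma bounded_op_submod : submod_closed bounded_op.
Proof.
split.
  apply/bounded_opP; split; first by move=> a x y /=; rewrite scaler0 addr0.
  by exists 0 => x; rewrite normr0 mul0r.
move=> a f g /bounded_opP[lf [M Mf]] /bounded_opP[lg [N Ng]].
apply/bounded_opP; split.
  move=> b x y.
  rewrite !fctE lf lg !scalerDr !scalerA.
  by rewrite [a * b]mulrC addrACA.
exists (`|a| * M + N) => x.
rewrite mulrDl (le_trans (ler_normD _ _))// lerD//.
by rewrite normrZ -mulrA ler_wpM2l.
Qed.

HB.instance Definition _ :=
  GRing.isSubmodClosed.Build R (X -> Y) bounded_op bounded_op_submod.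
HB.instance Definition _ := [SubChoice_isSubLmodule of boundedOp by <:].

(* The set is nonempty and bounded above: see op_norm_has_sup. *)
Definition op_norm (f : boundedOp) : R :=
  sup [set `|f x| | x in [set x | `|x| <= 1]].

Lemma bop_linear (f : boundedOp) : linear f.
Proof. by case: f => f /= /bounded_opP[]. Qed.

Lemma bop0 (f : boundedOp) : f 0 = 0.
Proof. by have := bop_linear f (-1) 0 0; rewrite scaler0 addr0 scaleN1r addNr. Qed.

Lemma bopZ (f : boundedOp) a x : f (a *: x) = a *: f x.
Proof. by have := bop_linear f a x 0; rewrite bop0 !addr0. Qed.

Lemma bop_bounded (f : boundedOp) : exists M : R, forall x, `|f x| <= M * `|x|.
Proof. by case: f => f /= /bounded_opP[]. Qed.

Lemma op_norm_has_sup (f : boundedOp) :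
  has_sup [set `|f x| | x in [set x | `|x| <= 1]].
Proof.
split; first by exists `|f 0|, 0 => //=; rewrite normr0.
have [M Mf] := bop_bounded f; exists `|M| => _ [x /= x1 <-].
rewrite (le_trans (Mf x))// (@le_trans _ _ (`|M| * `|x|))//.
  by rewrite ler_wpM2r// ler_norm.
by rewrite -[leRHS]mulr1 ler_wpM2l.
Qed.

Lemma op_norm_ge0 (f : boundedOp) : 0 <= op_norm f.
Proof.
apply: (@le_trans _ _ `|f 0|) => //.
apply: ub_le_sup; first exact: (op_norm_has_sup f).2.
by exists 0 => //=; rewrite normr0.
Qed.

Lemma ler_op_norm (f : boundedOp) x : `|f x| <= op_norm f * `|x|.
Proof.
have [->|x0] := eqVneq x 0; first by rewrite bop0 !normr0 mulr0.
rewrite -ler_pdivrMr ?normr_gt0//.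
rewrite -[X in `|f x| / X]normr_id -normfV mulrC -normrZ -bopZ.
apply: ub_le_sup; first exact: (op_norm_has_sup f).2.
by exists (`|x|^-1 *: x) => //=; rewrite normrZ normfV normr_id mulVf// normr_eq0.
Qed.

Lemma op_norm_le (f : boundedOp) M :
  0 <= M -> (forall x, `|f x| <= M * `|x|) -> op_norm f <= M.
Proof.
move=> M0 Mf; apply: ge_sup; first exact: (op_norm_has_sup f).1.
move=> _ [x /= x1 <-]; rewrite (le_trans (Mf x))//.
by rewrite -[leRHS]mulr1 ler_wpM2l.
Qed.

Lemma op_normD (f g : boundedOp) : op_norm (f + g) <= op_norm f + op_norm g.
Proof.
apply: op_norm_le; first by rewrite addr_ge0 ?op_norm_ge0.
by move=> x; rewrite (le_trans (ler_normD _ _))// mulrDl lerD ?ler_op_norm.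
Qed.

Let op_normZ_le a (f : boundedOp) : op_norm (a *: f) <= `|a| * op_norm f.
Proof.
apply: op_norm_le; first by rewrite mulr_ge0 ?op_norm_ge0.
by move=> x; rewrite [X in `|X|]/(a *: f x) normrZ -mulrA ler_wpM2l ?ler_op_norm.
Qed.

Lemma op_normZ a (f : boundedOp) : op_norm (a *: f) = `|a| * op_norm f.
Proof.
apply/eqP; rewrite eq_le op_normZ_le/=.
have [->|a0] := eqVneq a 0; first by rewrite normr0 mul0r op_norm_ge0.
rewrite -ler_pdivlMl ?normr_gt0// -normfV -{1}[f]scale1r -(mulVf a0) -scalerA.
exact: op_normZ_le.
Qed.

Lemma op_norm0_eq0 (f : boundedOp) : op_norm f = 0 -> f = 0.
Proof.
move=> f0; apply/val_inj/funext => x; apply/eqP.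
by rewrite -normr_le0 (le_trans (ler_op_norm f x))// f0 mul0r.
Qed.

HB.instance Definition _ :=
  Lmodule_isNormed.Build R boundedOp op_normD op_normZ op_norm0_eq0.

End BoundedOp.

Section Dual.
Context (R : realType) (X : normedModType R).


Definition dual := boundedOp X R^o.
HB.instance Definition _ := NormedModule.on dual.

End Dual.

Section Canonical.
Context (R : realType) (X : normedModType R).

Lemma bidual_embedding_subproof (x : X) :
  (fun f : dual X => f x : R^o) \in @bounded_op R (dual X) R^o.
Proof.
apply/bounded_opP; split=> //.
by exists `|x| => f; rewrite mulrC; exact: ler_op_norm.
Qed.

Definition bidual_embedding (x : X) : dual (dual X) := BoundedOp (bidual_embedding_subproof x).

End Canonical.

(* The library defines the elements of L^p(mu) as almost-everywhere classes of
   measurable functions, without algebraic structure; the vector space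
   operations are transported from LfunType through chosen representatives. *)
Section LspaceNormed.
Context d (T : measurableType d) (R : realType).
Context (mu : {measure set T -> \bar R}) (p : \bar R) (p1 : (1 <= p)%E).

Local Notation Lp := (LspaceType mu p1).
Local Notation Lf := (LfunType mu p1).

Lemma ae_eq_Lnorm (f g : T -> R) : measurable_fun setT f -> measurable_fun setT g ->
  f = g %[ae mu] -> ('N[mu]_p[EFin \o f] = 'N[mu]_p[EFin \o g])%E.
Proof.
move=> mf mg fg; have p0 : (0 < p)%E by exact: lt_le_trans p1.
move: p0; rewrite unlock /Lnorm; case: p p1 => [r|//|//] r1 r0.
- have m (h : T -> R) : measurable_fun setT h ->
      measurable_fun setT (fun x => `|(EFin \o h) x| `^ r)%E.
    move=> mh; apply: (measurableT_comp (measurable_poweR r)) => //.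
    by apply: measurableT_comp => //; exact/measurable_EFinP.
  congr (_ `^ _)%E; apply: ae_eq_integral => //; [exact: m|exact: m|].
  by apply: filterS fg => x /= /(_ Logic.I) -> _.
- case: ifP => // _; apply: eq_ess_sup.
  by apply: filterS fg => x /= /(_ Logic.I) ->.
Qed.

HB.instance Definition _ := gen_eqMixin Lp.
HB.instance Definition _ := gen_choiceMixin Lp.


Let mfunR (f : Lf) : measurable_fun setT (f : T -> measurableTypeR R).
Proof. exact: (@measurable_funPT _ _ _ _ (f : {mfun T >-> R})). Qed.

Let toM (f : Lf) : {mfun T >-> measurableTypeR R} :=
  HB.pack (f : T -> measurableTypeR R)
    (isMeasurableFun.Build _ _ T (measurableTypeR R) f (mfunR f)).

Let cls (f : Lf) : {mfun_ mu, T >-> measurableTypeR R} :=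
  \pi_({mfun_ mu, T >-> measurableTypeR R})%qT (toM f).

Let clsE (f : Lf) : (cls f : T -> R) = f %[ae mu].
Proof.
by have /eqmodP/asboolP : (repr (cls f) =
  toM f %[mod {mfun_ mu, T >-> measurableTypeR R}])%qT by rewrite reprK.
Qed.

Let mcls (f : {mfun_ mu, T >-> measurableTypeR R}) :
  measurable_fun setT (f : T -> R).
Proof. exact: (@measurable_funPT _ _ _ _ (repr f)). Qed.

Let cls_fin (f : Lf) : finite_norm mu p (cls f).
Proof.
rewrite /finite_norm (ae_eq_Lnorm (g := f))//; exact: Lfunction_finite.
Qed.

Definition Lspace_class (f : Lf) : Lp :=
  HB.pack (cls f) (isFinLebesgue.Build d T R mu p p1 (cls f) (cls_fin f)).

Let repr_subproof (f : Lp) : (f : T -> R) \in Lfun mu p.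
Proof.
by apply/andP; split; apply/mem_set; [exact: mcls|exact: Lebesgue_finite].
Qed.

Definition Lspace_repr (f : Lp) : Lf := Lfun_Sub p1 (repr_subproof f).

Lemma Lspace_reprK (f : Lf) : (Lspace_repr (Lspace_class f) : T -> R) = f %[ae mu].
Proof. exact: clsE. Qed.

Let Lspace_eqP (f g : Lp) : f = g :> {mfun_ mu, T >-> measurableTypeR R} -> f = g.
Proof.
case: f g => [f [[Pf]]] [g [[Pg]]] /= fg; rewrite fg in Pf *.
by rewrite (Prop_irrelevance Pf Pg).
Qed.

Lemma Lspace_class_eq (f g : Lf) : (f : T -> R) = g %[ae mu] ->
  Lspace_class f = Lspace_class g.
Proof. by move=> fg; apply: Lspace_eqP; apply/eqmodP/asboolP. Qed.

Lemma Lspace_classK (f : Lp) : Lspace_class (Lspace_repr f) = f.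
Proof.
apply: Lspace_eqP; rewrite -[RHS]reprK; apply/eqmodP/asboolP.
exact: ae_eq_refl.
Qed.

Let zeroL : Lp := Lspace_class 0.
Let oppL (f : Lp) := Lspace_class (- Lspace_repr f).
Let addL (f g : Lp) := Lspace_class (Lspace_repr f + Lspace_repr g).
Let scaleL (a : R) (f : Lp) := Lspace_class (a *: Lspace_repr f).

Let addL_class f g : addL (Lspace_class f) (Lspace_class g) = Lspace_class (f + g).
Proof.
apply: Lspace_class_eq.
have := Lspace_reprK g; have := Lspace_reprK f; apply: filterS2 => x fx gx _.
by rewrite -[RHS]/(f x + g x) -fx// -gx.
Qed.

Let scaleL_class a f : scaleL a (Lspace_class f) = Lspace_class (a *: f).
Proof.
apply: Lspace_class_eq.
have := Lspace_reprK f; apply: filterS => x fx _.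
by rewrite -[RHS]/(a *: f x) -fx.
Qed.

Let oppL_class f : oppL (Lspace_class f) = Lspace_class (- f).
Proof.
apply: Lspace_class_eq.
have := Lspace_reprK f; apply: filterS => x fx _.
by rewrite -[RHS]/(- f x) -fx.
Qed.

Let addLA : associative addL.
Proof.
move=> f g h; rewrite -(Lspace_classK f) -(Lspace_classK g) -(Lspace_classK h).
by rewrite !addL_class addrA.
Qed.

Let addLC : commutative addL.
Proof. by move=> f g; rewrite /addL addrC. Qed.

Let add0L : left_id zeroL addL.
Proof. by move=> f; rewrite -(Lspace_classK f) addL_class add0r. Qed.

Let addNL : left_inverse zeroL oppL addL.
Proof.
by move=> f; rewrite -(Lspace_classK f) oppL_class addL_class addNr.
Qed.

HB.instance Definition _ :=
  GRing.isZmodule.Build Lp addLA addLC add0L addNL.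

Let scaleLA a b (f : Lp) : scaleL a (scaleL b f) = scaleL (a * b) f.
Proof. by rewrite -(Lspace_classK f) !scaleL_class scalerA. Qed.

Let scale1L : left_id 1 scaleL.
Proof. by move=> f; rewrite /scaleL scale1r Lspace_classK. Qed.

Let scaleLDr : right_distributive scaleL +%R.
Proof.
move=> a f g; rewrite -(Lspace_classK f) -(Lspace_classK g).
by rewrite -[LHS]/(scaleL a (addL _ _)) -[RHS]/(addL _ _) addL_class
  !scaleL_class addL_class scalerDr.
Qed.

Let scaleLDl f : {morph scaleL^~ f : a b / a + b}.
Proof.
move=> a b; rewrite -(Lspace_classK f) -[RHS]/(addL _ _).
by rewrite !scaleL_class addL_class scalerDl.
Qed.

HB.instance Definition _ :=
  GRing.Zmodule_isLmodule.Build R Lp scaleLA scale1L scaleLDr scaleLDl.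

Lemma Lspace_class_linear : linear Lspace_class.
Proof.
by move=> a f g; rewrite -[RHS]/(addL (scaleL _ _) _) scaleL_class addL_class.
Qed.

Definition Lspace_norm (f : Lp) : R := fine ('N[mu]_p[EFin \o f])%E.

Lemma Lspace_norm_class (f : Lf) :
  Lspace_norm (Lspace_class f) = fine ('N[mu]_p[EFin \o f])%E.
Proof. by congr fine; apply: ae_eq_Lnorm => //; exact: clsE. Qed.

Let Lspace_normD f g : Lspace_norm (f + g) <= Lspace_norm f + Lspace_norm g.
Proof.
rewrite -[f + g]/(addL f g) Lspace_norm_class.
exact: (@ler_LnormD _ _ _ mu p p1).
Qed.

Let Lspace_normZ a f : Lspace_norm (a *: f) = `|a| * Lspace_norm f.
Proof.
rewrite -[a *: f]/(scaleL a f) Lspace_norm_class.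
apply/EFin_inj; rewrite EFinM (finite_norm_fine (a *: Lspace_repr f)).
by rewrite (finite_norm_fine (Lspace_repr f)) -LnormZ.
Qed.

Let Lspace_norm0_eq0 f : Lspace_norm f = 0 -> f = 0.
Proof.
move=> f0; rewrite -(Lspace_classK f) -[RHS]/(Lspace_class 0).
apply: Lspace_class_eq.
exact: fine_Lnormr_eq0.
Qed.

HB.instance Definition _ :=
  Lmodule_isNormed.Build R Lp Lspace_normD Lspace_normZ Lspace_norm0_eq0.

End LspaceNormed.

Section AbsolutelySumming.
Context (R : realType) (X Y : normedModType R).
Implicit Type u : boundedOp X Y.

(* The supremum is taken over a nonempty set bounded by \sum_i `|x i|. *)
Definition weak_l1_norm n (x : 'I_n -> X) : R :=
  sup [set \sum_(i < n) `|f (x i)| | f in [set f : dual X | `|f| <= 1]].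

Lemma weak_l1_norm_has_sup n (x : 'I_n -> X) :
  has_sup [set \sum_(i < n) `|f (x i)| | f in [set f : dual X | `|f| <= 1]].
Proof.
split; first by exists (\sum_(i < n) `|(0 : dual X) (x i)|), 0 => //=; rewrite normr0.
exists (\sum_(i < n) `|x i|) => _ [f /= f1 <-]; apply: ler_sum => i _.
by rewrite (le_trans (ler_op_norm f _))// ler_piMl.
Qed.

Definition summing_constant u (lambda : R) : Prop :=
  0 < lambda /\ forall n (x : 'I_n -> X),
    \sum_(i < n) `|u (x i)| <= lambda * weak_l1_norm x.

Definition absolutely_summing u : Prop :=
  exists lambda, summing_constant u lambda.

Definition pi1 u : \bar R :=
  ereal_inf [set lambda%:E | lambda in summing_constant u].

End AbsolutelySumming.

Section L1Factorable.
Context (R : realType) (X Y : normedModType R).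
Implicit Type u : boundedOp X Y.

Definition L1_factorization u d (T : measurableType d)
    (mu : {measure set T -> \bar R})
    (v : boundedOp X (LspaceType1 mu))
    (w : boundedOp (LspaceType1 mu) (dual (dual Y))) : Prop :=
  forall x, bidual_embedding (u x) = w (v x).

(* The infimum of the empty set is +oo, so gamma1 u = +oo when u is not
   L_1-factorable. *)
Definition gamma1 u : \bar R := ereal_inf
  [set c | exists (d : measure_display) (T : measurableType d)
             (mu : {measure set T -> \bar R})
             (v : boundedOp X (LspaceType1 mu))
             (w : boundedOp (LspaceType1 mu) (dual (dual Y))),
             L1_factorization u v w /\ c = (`|v| * `|w|)%:E].

End L1Factorable.

Section FiniteRank.
Context (R : realType) (X Y : normedModType R).

(* u(X) is spanned by finitely many of its vectors. *)
Definition finite_rank (u : boundedOp X Y) : Prop :=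
  exists n (e : 'I_n -> X),
    forall x, exists a : 'I_n -> R, u x = \sum_(i < n) a i *: u (e i).

End FiniteRank.

Definition l2 (R : realType) : normedModType R :=
  LspaceType2 (@counting nat R).

Definition GL (R : realType) (X : normedModType R) : \bar R := ereal_sup
  [set r | exists (Y : completeNormedModType R) (u : boundedOp X Y),
             [/\ u != 0, absolutely_summing u & r = (gamma1 u / pi1 u)%E]].

Definition GL_fin (R : realType) (X : normedModType R) : \bar R := ereal_sup
  [set r | exists u : boundedOp X (l2 R),
             [/\ u != 0, finite_rank u & r = (gamma1 u / pi1 u)%E]].

(* Main.v *)
(** Fix lambda >= 1, a large prime p and P = F_p^2.  On R^P take the norm
    N(x) = max (|x|_1, lambda max_(j <> 0) |x^(j)|), x^ being the Hartley transform.  By the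
    Gauss sum bound, the uniform probability measures s_f on the graphs of the polynomials f
    of degree exactly 2 satisfy N(s_f) <= 1, and two such graphs meet in at most 2 points.

    Let u_m run over a finite net of the operators (R^P, N) -> l_2 with pi_1 <= 2.  The level
    space consists of the pairs (x, (h_m)_m) where h_m in l_1(G) is a lifting of u_m x along a
    quotient map from l_1(G) onto l_2^P, with norm max (N(x), sup_m |h_m|_1).  Every absolutely
    summing operator from it into l_2 factors through l_1 with constant 17: on the tuples of
    kernels (x = 0) this follows from Hahn-Banach; what is left is an operator of x, absolutely
    summing for N because the u_m are, hence close to a multiple of some u_m, and u_m x is the
    image of h_m.  In the l_1-sum X of the levels the factorizations add up, so
    GL_fin(X) <= 17.

    Conversely restrict each level to x and view it in R^P with the norm |x|_oo + |x|_2 / lambda: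
    averaging over characters and over signs gives pi_1 <= 6 / lambda.  But s_f and the unit
    vectors have liftings into the level space of norms O(1) and O(lambda), and for
    |phi|_oo <= 1, |phi|_2 <= lambda one has
      sum_i phi_i g_i <= 2 / lambda * sum_i |g_i| + 4 / p * sum_f |sum_i s_f(i) g_i|;
    both sides being stable under passage to L_1(mu)-valued g, a factorization through L_1(mu)
    has |v| |w| >= 1 / 2000, whence GL(X) >= lambda / 12000 for every lambda. *)
Require Import Defs.
From HB Require Import structures.
From mathcomp Require Import all_boot all_order all_algebra.
From mathcomp Require Import all_classical all_reals all_analysis.
From mathcomp Require Import measurable_realfun ring lra.
Set Implicit Arguments.
Unset Strict Implicit.
Unset Printing Implicit Defensive.
Import Order.TTheory GRing.Theory Num.Theory.
Import numFieldNormedType.Exports HBSimple.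
Local Open Scope ring_scope.

(** * Linear algebra over a real field *)

(** Two requirements compete. The liftings [h_m] must make every summing operator into a Hilbert
    space factor through l_1 with a fixed constant, yet leave an operator into another space that
    factors only with a large one. The lower bound therefore needs liftings of the test vectors that
    are small for all [u_m] at once. They come from an unequal decomposition of an arbitrary summing
    operator for N: cost O(1) on each s_f, but only O(lambda) on unit vectors. That loss is harmless
    because unit vectors enter the test inequality with weight 2 / lambda. The choice of the net is
    not circular: it refers to N alone, and what the new coordinates add, the tuples of kernels, is
    left to Hahn-Banach. Square matrices over P suffice for all Hilbert targets, since the range of
    an operator of x has at most |P| orthonormal coordinates. Polynomials of degree 2 combine small
    exponential sums, few intersections of two graphs, and independent values at three points; the
    last is what a second moment conditioned on one point of the graph requires. *)

Section GramSchmidt.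
Context (R : rcfType) (V : lmodType R) (B : V -> V -> R).
Hypothesis Blin : forall y a x x', B (a *: x + x') y = a * B x y + B x' y.
Hypothesis Bsym : forall x y, B x y = B y x.
Hypothesis Bge0 : forall x, 0 <= B x x.
Hypothesis Bdef : forall x, B x x = 0 -> x = 0.

Lemma form0 y : B 0 y = 0.
Proof. by have := Blin y (-1) 0 0; rewrite scaler0 addr0 mulN1r addNr. Qed.

Lemma formZ a x y : B (a *: x) y = a * B x y.
Proof. by rewrite -[_ *: _]addr0 Blin form0 addr0. Qed.

Lemma formD x x' y : B (x + x') y = B x y + B x' y.
Proof. by rewrite -[x in LHS]scale1r Blin mul1r. Qed.

Lemma form_suml n (c : 'I_n -> R) (f : 'I_n -> V) y :
  B (\sum_i c i *: f i) y = \sum_i c i * B (f i) y.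
Proof.
elim/big_ind2: _ => [|x a x' b <- <-|i _]; [exact: form0|exact: formD|exact: formZ].
Qed.

(* Null vectors are allowed, so that Gram-Schmidt needs no independence. *)
Definition orthonormal0 n (f : 'I_n -> V) :=
  (forall i j, i != j -> B (f i) (f j) = 0) /\
  (forall i, f i = 0 \/ B (f i) (f i) = 1).

(** Only an inequality: a null [f i] contributes to the right-hand side alone. *)
Lemma form_expand n (f : 'I_n -> V) (c : 'I_n -> R) : orthonormal0 f ->
  B (\sum_i c i *: f i) (\sum_i c i *: f i) <= \sum_i c i ^+ 2.
Proof.
move=> [fo f1]; rewrite form_suml ler_sum// => i _.
rewrite Bsym form_suml (bigD1 i)//= big1 ?addr0; last first.
  by move=> j ji; rewrite fo ?mulr0.
case: (f1 i) => [->|->]; last by rewrite mulr1 expr2.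
by rewrite form0 !mulr0 sqr_ge0.
Qed.

Lemma form_expand_eq n (f : 'I_n -> V) (x : V) : orthonormal0 f ->
  x = \sum_i B x (f i) *: f i -> B x x = \sum_i B x (f i) ^+ 2.
Proof.
move=> [fo f1] xE; rewrite {1}xE form_suml; apply: eq_bigr => i _.
by rewrite [B (f i) x]Bsym expr2.
Qed.

(** The last clause says that the new vectors stay in the span of the old ones, phrased through all
    subspaces [Q]; this is how [trace_le] keeps its columns in the kernel. *)
Lemma gram_schmidt n (v : 'I_n -> V) : exists f : 'I_n -> V,
  [/\ orthonormal0 f, forall k, v k = \sum_l B (v k) (f l) *: f l &
      forall Q : V -> Prop, Q 0 -> (forall a x y, Q x -> Q y -> Q (a *: x + y)) ->
        (forall k, Q (v k)) -> forall l, Q (f l)].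
Proof.
elim: n v => [|n IHn] v.
  exists v; split; [by split=> [[]|[]]|by case|by move=> Q _ _ _ []].
have [f [fon vE fQ]] := IHn (fun i => v (widen_ord (leqnSn n) i)).
have [fo f1] := fon.
pose x := v ord_max; pose r := x - \sum_l B x (f l) *: f l.
have rf i : B r (f i) = 0.
  rewrite /r -scaleN1r addrC Blin form_suml (bigD1 i)//= big1 ?addr0; last first.
    by move=> j ji; rewrite fo ?mulr0.
  by case: (f1 i) => ->; rewrite ?(Bsym _ 0) ?form0; ring.
(* If the last vector already lies in the span of the others, [r] and hence [g] is null, as
   [orthonormal0] allows. *)
pose g := (Num.sqrt (B r r))^-1 *: r.
have gf i : B g (f i) = 0 by rewrite formZ rf mulr0.
have g1 : g = 0 \/ B g g = 1.
  have [r0|r0] := eqVneq (B r r) 0; first by left; rewrite /g (Bdef r0) scaler0.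
  right; rewrite formZ Bsym formZ mulrA -expr2 exprVn sqr_sqrtr// mulVf//.
have xg : x = B x g *: g + \sum_l B x (f l) *: f l.
  have [r0|r0] := eqVneq (B r r) 0.
    move: (Bdef r0) => /eqP; rewrite subr_eq0 => /eqP {1}->.
    by rewrite /g (Bdef r0) !scaler0 add0r.
  suff -> : B x g *: g = r by rewrite subrK.
  have -> : B x g = Num.sqrt (B r r).
    have -> : B x g = B r g.
      have -> : B x g = B (r + \sum_l B x (f l) *: f l) g by rewrite /r subrK.
      rewrite formD form_suml big1 ?addr0//.
      by move=> i _; rewrite [B (f i) _]Bsym gf mulr0.
    rewrite Bsym formZ -{2}(sqr_sqrtr (Bge0 r)) expr2 mulKf//.
    by rewrite sqrtr_eq0 -ltNge lt_def r0 Bge0.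
  by rewrite scalerA divff ?scale1r// sqrtr_eq0 -ltNge lt_def r0 Bge0.
pose h (i : 'I_n.+1) := if unlift ord_max i is Some j then f j else g.
have hw (i : 'I_n) : h (widen_ord (leqnSn n) i) = f i.
  rewrite /h; have -> : widen_ord (leqnSn n) i = lift ord_max i.
    by apply/val_inj; rewrite /= /bump leqNgt ltn_ord.
  by rewrite liftK.
have hm : h ord_max = g by rewrite /h unlift_none.
exists h; split; [split|..].
- move=> i j; rewrite /h.
  case: unliftP => [i'|] ->; case: unliftP => [j'|] ->.
  + by rewrite (inj_eq lift_inj); exact: fo.
  + by rewrite Bsym gf.
  + by rewrite gf.
  + by rewrite eqxx.
- by move=> i; rewrite /h; case: unlift.
- move=> k; rewrite big_ord_recr/= hm; under eq_bigr do rewrite hw.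
  case: (unliftP ord_max k) => [k'|] kE; last by rewrite kE addrC.
  have -> : k = widen_ord (leqnSn n) k'.
    by rewrite kE; apply/val_inj; rewrite /= /bump leqNgt ltn_ord.
  rewrite -(vE k') (_ : B _ g = 0) ?scale0r ?addr0//.
  rewrite (vE k') form_suml big1// => i _.
  by rewrite [B (f i) g]Bsym gf mulr0.
- move=> Q Q0 QD Qv l; rewrite /h.
  have Qf j : Q (f j) by apply: fQ.
  case: unlift => [//|]; rewrite /g -[_ *: _]addr0; apply: (QD) => //.
  have QS : Q (\sum_l B x (f l) *: f l).
    by elim/big_rec: _ => // i y _ Qy; exact: QD.
  by rewrite /r addrC -scaleN1r; apply: (QD) => //; exact: Qv.
Qed.

End GramSchmidt.

(** * Hahn-Banach in finite dimension for a sublinear functional *)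

Section HahnBanach.
Context (R : realType) (J : finType) (S : (J -> R) -> R).
Hypothesis SZ : forall (a : R) x, 0 <= a -> S (fun j => a * x j) = a * S x.
Hypothesis SD : forall x y, S (fun j => x j + y j) <= S x + S y.

Local Notation V := (J -> R).

(* G is the graph of a partial linear functional. *)
Definition dominated (G : V -> R -> Prop) :=
  [/\ G (fun=> 0) 0,
      forall a x r y s, G x r -> G y s -> G (fun j => a * x j + y j) (a * r + s) &
      forall x r, G x r -> r <= S x].

Let dominatedZ G a x r : dominated G -> G x r -> G (fun j => a * x j) (a * r).
Proof.
move=> [G0 GD _] Gx; have := GD a _ _ _ _ Gx G0; rewrite addr0.
by congr G; apply/funext => j; rewrite addr0.
Qed.

(** The value at [e] has to lie above every [r - S (x - e)] and below every [S (y + e) - s].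
    Sublinearity separates the two families, and the supremum of the first is taken. *)
Lemma dominated_extend1 G e : dominated G -> exists c : R, dominated
  (fun x r => exists t y s, [/\ G y s, x = (fun j => y j + t * e j) & r = s + t * c]).
Proof.
move=> dG; have [G0 GD GS] := dG.
pose A := [set a : R | exists x r, G x r /\ a = r - S (fun j => x j - e j)]%classic.
have lu x r y s : G x r -> G y s ->
    r - S (fun j => x j - e j) <= S (fun j => y j + e j) - s.
  move=> Gx Gy; rewrite lerBlDr addrAC lerBrDr.
  have -> : r + s = 1 * r + s by rewrite mul1r.
  apply: le_trans (GS _ _ (GD 1 _ _ _ _ Gx Gy)) _.
  apply: le_trans (SD _ _).
  rewrite (_ : (fun j => 1 * x j + y j) = (fun j => y j + e j + (x j - e j)))//.
  by apply/funext => j; ring.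
have A0 : (A !=set0)%classic by exists (0 - S (fun j => 0 - e j)), (fun=> 0), 0.
have Aub : has_ubound A.
  by exists (S (fun j => 0 + e j) - 0) => _ [x [r [Gx ->]]]; exact: (lu _ _ (fun=> 0)).
exists (sup A); split.
- exists 0, (fun=> 0), 0; rewrite mul0r addr0; split=> //.
  by apply/funext => j; rewrite mul0r addr0.
- move=> a x r y s [t [x1 [r1 [Gx1 -> ->]]]] [t' [y1 [s1 [Gy1 -> ->]]]].
  exists (a * t + t'), (fun j => a * x1 j + y1 j), (a * r1 + s1); split.
  + exact: GD.
  + by apply/funext => j; ring.
  + by ring.
- move=> x r [t [y [s [Gy -> ->]]]].
  (* After division by |t|, the case t > 0 is governed by the upper family and t < 0 by the lower
     one. *)
  have [t0|t0|->] := ltgtP t 0; last first.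
  + rewrite mul0r addr0; under eq_fun do rewrite mul0r addr0.
    exact: GS.
  + have Gty := dominatedZ t^-1 dG Gy.
    have : sup A <= S (fun j => t^-1 * y j + e j) - t^-1 * s.
      by apply: ge_sup => // _ [x1 [r1 [Gx1 ->]]]; exact: (lu _ _ _ _ Gx1 Gty).
    have tS : t * S (fun j => t^-1 * y j + e j) = S (fun j => y j + t * e j).
      rewrite -SZ ?ltW//; congr S; apply/funext => j.
      by rewrite mulrDr mulVKf ?gt_eqF.
    by rewrite -(ler_pM2l t0) [X in _ <= X]mulrBr tS mulVKf ?gt_eqF// => ?; lra.
  + have Nt0 : 0 < - t by rewrite oppr_gt0.
    have Gty := dominatedZ (- t)^-1 dG Gy.
    have : (- t)^-1 * s - S (fun j => (- t)^-1 * y j - e j) <= sup A.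
      by apply: ub_le_sup => //; exists (fun j => (- t)^-1 * y j), ((- t)^-1 * s).
    have tS : - t * S (fun j => (- t)^-1 * y j - e j) = S (fun j => y j + t * e j).
      rewrite -SZ ?ltW//; congr S; apply/funext => j.
      by rewrite mulrBr mulVKf ?gt_eqF// mulNr opprK.
    by rewrite -(ler_pM2l Nt0) [X in X <= _]mulrBr tS mulVKf ?gt_eqF// => ?; lra.
Qed.

Lemma hahn_banach_fin G : dominated G -> exists g : V,
  (forall x r, G x r -> r = \sum_j x j * g j) /\
  (forall x, \sum_j x j * g j <= S x).
Proof.
move=> domG.
pose e (j : J) : V := fun i => (i == j)%:R.
have [G' [domG' GG' G'e]] : exists G', [/\ dominated G', forall x r, G x r -> G' x r &
    forall j, j \in enum J -> exists c, G' (e j) c].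
  elim: (enum J) => [|j s [G1 [d1 s1 h1]]]; first by exists G.
  have [c d2] := dominated_extend1 (e j) d1.
  have [G10 _ _] := d1.
  have sub x r : G1 x r -> exists t y s,
      [/\ G1 y s, x = (fun i => y i + t * e j i) & r = s + t * c].
    move=> Gx; exists 0, x, r; rewrite mul0r addr0; split=> //.
    by apply/funext => i; rewrite mul0r addr0.
  exists (fun x r => exists t y s,
    [/\ G1 y s, x = (fun i => y i + t * e j i) & r = s + t * c]); split.
  + exact: d2.
  + by move=> x r Gx; apply: sub; exact: s1.
  + move=> i; rewrite inE => /predU1P[->|/h1[c' Gi]]; last by exists c'; exact: sub.
    exists c, 1, (fun=> 0), 0; split => //; last by rewrite mul1r add0r.
    by apply/funext => k; rewrite mul1r add0r.
have /choice[g gE] : forall j, exists c, G' (e j) c.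
  by move=> j; apply: G'e; rewrite mem_enum.
have [G0 GD GS] := domG'.
have Gall x : G' x (\sum_j x j * g j).
  have : G' (fun i => \sum_j x j * e j i) (\sum_j x j * g j).
    elim: (index_enum J) => [|j s IH].
      by rewrite big_nil; under eq_fun do rewrite big_nil.
    by rewrite big_cons; under eq_fun do rewrite big_cons; exact: GD.
  congr G'; apply/funext => i; rewrite (bigD1 i)//= big1 ?addr0 /e ?eqxx ?mulr1//.
  by move=> j ji; rewrite eq_sym (negbTE ji) mulr0.
exists g; split => [x r /GG' Gx|x]; last exact: GS.
(* The relation is not known to be single-valued; domination at 0, used with both signs, forces the
   discrepancy to vanish. *)
have Gd : G' (fun=> 0) (r - \sum_j x j * g j).
  have := GD (-1) _ _ _ _ (Gall x) Gx.
  rewrite mulN1r addrC; congr G'.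
  by apply/funext => j; rewrite mulN1r addNr.
have Gd' : G' (fun=> 0) (- (r - \sum_j x j * g j)).
  by have := dominatedZ (-1) domG' Gd; rewrite mulr0 mulN1r.
have S0 : S (fun=> 0) = 0.
  by rewrite (_ : (fun=> 0) = (fun j : J => 0 * (0 : R))) ?SZ ?mul0r//; apply/funext=> j; rewrite mul0r.
have := GS _ _ Gd; have := GS _ _ Gd'; rewrite S0.
by move: (\sum_j _) => c; lra.
Qed.

End HahnBanach.

(** * Euclidean space of functions on a finite set *)

Section Euclid.
Context (R : realType) (I : finType).
Implicit Types x y : I -> R.

Definition dot x y : R := \sum_i x i * y i.
Definition nrm2 x : R := Num.sqrt (\sum_i x i ^+ 2).

Lemma dotC x y : dot x y = dot y x.
Proof. by apply: eq_bigr => i _; rewrite mulrC. Qed.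

Lemma dot_suml (K : finType) (c : K -> R) (f : K -> I -> R) y :
  dot (fun i => \sum_k c k * f k i) y = \sum_k c k * dot (f k) y.
Proof.
rewrite /dot; under eq_bigr do rewrite big_distrl/=.
rewrite exchange_big/=; apply: eq_bigr => k _; rewrite big_distrr/=.
by apply: eq_bigr => i _; rewrite mulrA.
Qed.

Lemma nrm2_ge0 x : 0 <= nrm2 x. Proof. exact: sqrtr_ge0. Qed.

Lemma nrm2_sqr x : nrm2 x ^+ 2 = \sum_i x i ^+ 2.
Proof. by rewrite sqr_sqrtr// sumr_ge0// => i _; rewrite sqr_ge0. Qed.

Lemma nrm2_le x a : 0 <= a -> \sum_i x i ^+ 2 <= a ^+ 2 -> nrm2 x <= a.
Proof.
by move=> a0 xa; rewrite -(ler_pXn2r (ltn0Sn 1)) ?nnegrE ?nrm2_ge0// nrm2_sqr.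
Qed.

Lemma ler_nrm2 x i : `|x i| <= nrm2 x.
Proof.
rewrite -(ler_pXn2r (ltn0Sn 1)) ?nnegrE ?nrm2_ge0// nrm2_sqr real_normK ?num_real//.
by rewrite (bigD1 i)//= lerDl sumr_ge0// => j _; rewrite sqr_ge0.
Qed.

Lemma nrm2_eq0 x i : nrm2 x = 0 -> x i = 0.
Proof. by move=> x0; apply/eqP; rewrite -normr_le0 -x0 ler_nrm2. Qed.

Lemma dot_le x y : dot x y <= nrm2 x * nrm2 y.
Proof.
set a := nrm2 x; set b := nrm2 y.
have a0 : 0 <= a := nrm2_ge0 x; have b0 : 0 <= b := nrm2_ge0 y.
have [ab0|ab0] := eqVneq (a * b) 0.
  rewrite ab0 /dot big1// => i _; move/eqP: ab0; rewrite mulf_eq0 => /orP[]/eqP/nrm2_eq0 -> ;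
  by rewrite ?mul0r ?mulr0.
(* With a, b the two norms, this sum expands to 2 a b (a b - dot x y), which gives
   Cauchy-Schwarz. *)
have : 0 <= \sum_i (b * x i - a * y i) ^+ 2 by rewrite sumr_ge0// => i _; rewrite sqr_ge0.
under eq_bigr => i _.
  rewrite (_ : _ ^+ 2 = b ^+ 2 * x i ^+ 2 + (a ^+ 2 * y i ^+ 2 - 2 * (a * b) * (x i * y i))); last by ring.
  over.
rewrite big_split sumrB/= -!big_distrr/= -!nrm2_sqr -/a -/b -/(dot x y) => h.
have ab : 0 < a * b by rewrite lt_def ab0 mulr_ge0.
by rewrite -(ler_pM2l ab); nra.
Qed.

Lemma dot_norm_le x y : `|dot x y| <= nrm2 x * nrm2 y.
Proof.
rewrite ler_norml dot_le andbT lerNl.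
have -> : - dot x y = dot (fun i => - x i) y.
  by rewrite /dot -sumrN; apply: eq_bigr => i _; rewrite mulNr.
apply: le_trans (dot_le _ _) _.
by rewrite /nrm2; under eq_bigr do rewrite sqrrN.
Qed.

Lemma nrm2D x y : nrm2 (fun i => x i + y i) <= nrm2 x + nrm2 y.
Proof.
apply: nrm2_le; first by rewrite addr_ge0 ?nrm2_ge0.
under eq_bigr => i _.
  rewrite (_ : _ ^+ 2 = x i ^+ 2 + (y i ^+ 2 + 2 * (x i * y i))); last by ring.
  over.
rewrite !big_split/= -big_distrr/= -!nrm2_sqr -/(dot x y).
by have := dot_le x y; lra.
Qed.

Lemma nrm2Z a x : nrm2 (fun i => a * x i) = `|a| * nrm2 x.
Proof.
rewrite /nrm2; under eq_bigr do rewrite exprMn.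
by rewrite -big_distrr/= sqrtrM ?sqr_ge0// sqrtr_sqr.
Qed.

Lemma eq_nrm2 x y : x =1 y -> nrm2 x = nrm2 y.
Proof. by move=> /funext ->. Qed.

Lemma nrm2_0 : nrm2 (fun=> 0) = 0.
Proof. by rewrite /nrm2 big1 ?sqrtr0// => i _; rewrite expr2 mulr0. Qed.

Lemma nrm2_sum (K : finType) (f : K -> I -> R) :
  nrm2 (fun i => \sum_k f k i) <= \sum_k nrm2 (f k).
Proof.
elim: (index_enum K) => [|k s IH].
  by rewrite big_nil; under eq_nrm2 do rewrite big_nil; rewrite nrm2_0.
rewrite big_cons; under eq_nrm2 do rewrite big_cons.
by apply: le_trans (nrm2D _ _) _; rewrite lerD2l.
Qed.

Lemma nrm2_le_l1 x : nrm2 x <= \sum_i `|x i|.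
Proof.
apply: nrm2_le; first exact: sumr_ge0.
have h i : x i ^+ 2 <= `|x i| * \sum_j `|x j|.
  by rewrite -real_normK ?num_real// expr2 ler_wpM2l// (bigD1 i)//= lerDl sumr_ge0.
by apply: le_trans (ler_sum _ (fun i _ => h i)) _; rewrite -big_distrl.
Qed.

Lemma nrm2_dual x : exists y, nrm2 y <= 1 /\ dot y x = nrm2 x.
Proof.
have [x0|x0] := eqVneq (nrm2 x) 0.
  by exists (fun=> 0); rewrite nrm2_0 x0 /dot big1// => i _; rewrite mul0r.
exists (fun i => (nrm2 x)^-1 * x i); rewrite nrm2Z ger0_norm ?invr_ge0 ?nrm2_ge0//.
rewrite mulVf//; split=> //; rewrite /dot.
under eq_bigr do rewrite -mulrA -expr2.
by rewrite -big_distrr/= -nrm2_sqr expr2 mulKf.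
Qed.

End Euclid.

Section GramSchmidtFun.
Context (R : realType) (I : finType).

Let V := (I -> R^o) : lmodType R.

Lemma dot_linl (y : V) (a : R) (x x' : V) : dot (a *: x + x') y = a * dot x y + dot x' y.
Proof.
rewrite /dot big_distrr/= -big_split/=; apply: eq_bigr => i _.
by rewrite -[(a *: x + x') i]/(a * x i + x' i) mulrDl mulrA.
Qed.

Lemma dot_ge0 (x : V) : 0 <= dot x x.
Proof. by apply: sumr_ge0 => i _; rewrite -expr2 sqr_ge0. Qed.

Lemma dot_eq0 (x : V) : dot x x = 0 -> x = 0.
Proof.
move=> x0; apply/funext => i; apply: (@nrm2_eq0 _ _ x).
by rewrite /nrm2; under eq_bigr do rewrite expr2; rewrite -/(dot x x) x0 sqrtr0.
Qed.

(** Synthesis along [f] is a contraction and analysis an isometry on the span. The isometry is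
    stated for combinations over any finite [K], because [kill_factor] sums over [P] rather than
    over an ordinal. *)
Lemma gram_schmidt_fun n (v : 'I_n -> I -> R) : exists f : 'I_n -> I -> R,
  [/\ forall k i, v k i = \sum_l dot (v k) (f l) * f l i,
      forall c : 'I_n -> R, nrm2 (fun i => \sum_l c l * f l i) <= nrm2 c,
      forall y, \sum_l dot y (f l) ^+ 2 <= \sum_i y i ^+ 2,
      forall k, nrm2 (v k) = nrm2 (fun l => dot (v k) (f l)) /\
        forall (K : finType) (c : K -> R) (kk : K -> 'I_n),
        nrm2 (fun i => \sum_k c k * v (kk k) i) =
        nrm2 (fun l => \sum_k c k * dot (v (kk k)) (f l)) &
      forall Q : (I -> R) -> Prop, Q (fun=> 0) ->
        (forall a x y, Q x -> Q y -> Q (fun i => a * x i + y i)) ->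
        (forall k, Q (v k)) -> forall l, Q (f l)].
Proof.
have [f [fon vE fQ]] := gram_schmidt dot_linl (@dotC R I) dot_ge0 dot_eq0 v.
have sumE (c : 'I_n -> R) : \sum_l c l *: (f l : V) = (fun i => \sum_l c l * f l i).
  by apply/funext => i; rewrite fct_sumE.
have dotnE (x : I -> R) : dot x x = nrm2 x ^+ 2.
  by rewrite nrm2_sqr; apply: eq_bigr => i _; rewrite expr2.
have expand (K : finType) (c : K -> R) (kk : K -> 'I_n) i :
    \sum_k c k * v (kk k) i = \sum_l (\sum_k c k * dot (v (kk k)) (f l)) * f l i.
  under [RHS]eq_bigr do rewrite big_distrl/=.
  rewrite exchange_big/=; apply: eq_bigr => k _.
  rewrite [in LHS](vE (kk k)) sumE big_distrr/=.
  by apply: eq_bigr => l _; rewrite mulrA.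
have le2 (c : 'I_n -> R) : nrm2 (fun i => \sum_l c l * f l i) <= nrm2 c.
  apply: nrm2_le; first exact: nrm2_ge0.
  rewrite nrm2_sqr -nrm2_sqr -dotnE -sumE.
  exact: (form_expand dot_linl (@dotC R I) c fon).
have bessel y : \sum_l dot y (f l) ^+ 2 <= \sum_i y i ^+ 2.
  (* Null vectors are tolerated here: |y - g|^2 = |y|^2 + |g|^2 - 2 |c|^2, and |g| <= |c|. *)
  pose c l := dot y (f l); pose g i := \sum_l c l * f l i.
  have : 0 <= nrm2 (fun i => y i - g i) ^+ 2 by rewrite sqr_ge0.
  rewrite nrm2_sqr; under eq_bigr => i _.
    rewrite (_ : _ ^+ 2 = y i ^+ 2 + (g i ^+ 2 - 2 * (y i * g i))); last by ring.
    over.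
  rewrite big_split sumrB/= -big_distrr/= -/(dot y g) -(nrm2_sqr g).
  have -> : dot y g = nrm2 c ^+ 2.
    rewrite dotC dot_suml nrm2_sqr; apply: eq_bigr => l _.
    by rewrite dotC -/(c l) -expr2.
  have := le2 c; rewrite -(ler_pXn2r (ltn0Sn 1)) ?nnegrE ?nrm2_ge0// -/g.
  by rewrite -(nrm2_sqr c); move: (\sum_i _ ^+ 2) => D; lra.
have eq2 (K : finType) (c : K -> R) (kk : K -> 'I_n) :
    nrm2 (fun i => \sum_k c k * v (kk k) i) =
    nrm2 (fun l => \sum_k c k * dot (v (kk k)) (f l)).
  pose x : V := fun i => \sum_k c k * v (kk k) i.
  have xf l : dot x (f l) = \sum_k c k * dot (v (kk k)) (f l) by rewrite /x dot_suml.
  have xE : x = \sum_l dot x (f l) *: (f l : V).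
    rewrite sumE; apply/funext => i; rewrite /x expand.
    by apply: eq_bigr => l _; rewrite -xf.
  have := form_expand_eq dot_linl (@dotC R I) fon xE.
  rewrite -/x dotnE nrm2_sqr /nrm2 => ->.
  by congr Num.sqrt; apply: eq_bigr => l _; rewrite xf.
exists f; split => //.
- by move=> k i; rewrite [in LHS](vE k) sumE.
- move=> k; split; last exact: eq2.
  have := eq2 unit (fun=> 1) (fun=> k).
  under eq_nrm2 do rewrite big_const card_unit/= mul1r addr0.
  by under [X in _ = X -> _]eq_nrm2 do rewrite big_const card_unit/= mul1r addr0.
Qed.

End GramSchmidtFun.

(** * Operators into Euclidean space: extension by killing coordinates *)

Section Summing.
Context (R : realType).

Definition app (I J : finType) (A : I -> J -> R) (x : I -> R) (j : J) : R :=
  \sum_i x i * A i j.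

Lemma app_suml (I J K : finType) (A : I -> J -> R) (c : K -> R) (x : K -> I -> R) j :
  app A (fun i => \sum_k c k * x k i) j = \sum_k c k * app A (x k) j.
Proof. exact: dot_suml. Qed.

Lemma app_sumr (I J K : finType) (f : K -> J -> R) (M : I -> K -> R) x j :
  app (fun i j => \sum_k M i k * f k j) x j = \sum_k app M x k * f k j.
Proof.
rewrite /app; under eq_bigr do rewrite big_distrr/=.
rewrite exchange_big/=; apply: eq_bigr => k _; rewrite big_distrl/=.
by apply: eq_bigr => i _; rewrite mulrA.
Qed.

Lemma appD (I J : finType) (A : I -> J -> R) x y j :
  app A (fun i => x i + y i) j = app A x j + app A y j.
Proof. by rewrite /app -big_split/=; apply: eq_bigr => i _; rewrite mulrDl. Qed.

Lemma appZ (I J : finType) (A : I -> J -> R) a x j :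
  app A (fun i => a * x i) j = a * app A x j.
Proof. by rewrite /app big_distrr/=; apply: eq_bigr => i _; rewrite mulrA. Qed.

Lemma appB (I J : finType) (A : I -> J -> R) x y j :
  app A (fun i => x i - y i) j = app A x j - app A y j.
Proof. by rewrite /app -sumrB; apply: eq_bigr => i _; rewrite mulrBl. Qed.

Lemma app_delta (I J : finType) (A : I -> J -> R) i :
  app A (fun i' => (i' == i)%:R) =1 A i.
Proof.
move=> j; rewrite /app (bigD1 i)//= eqxx mul1r big1 ?addr0// => k /negbTE ->.
by rewrite mul0r.
Qed.

Definition sgn (b : bool) : R := (-1) ^+ b.

Lemma sgn_norm b : `|sgn b| = 1.
Proof. by rewrite /sgn normrX normrN1 expr1n. Qed.

Lemma sgn_lt0 (x : R) : sgn (x < 0) * x = `|x|.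
Proof.
rewrite /sgn; have [x0|x0] := ltrP x 0.
  by rewrite expr1 mulN1r ltr0_norm.
by rewrite expr0 mul1r ger0_norm.
Qed.

(* By convexity the weak l_1 norm of a finite family is the largest norm of a signed sum. *)
Definition summing (I J : finType) (W : (I -> R) -> Prop) (N : (I -> R) -> R)
    (A : I -> J -> R) (c : R) :=
  forall (K : finType) (x : K -> I -> R) (B : R), (forall k, W (x k)) ->
    (forall s : K -> bool, N (fun i => \sum_k sgn (s k) * x k i) <= B) ->
    \sum_k nrm2 (app A (x k)) <= c * B.

Lemma signs_l1 (I K : finType) (N : (I -> R) -> R) (x : K -> I -> R) B i :
  (forall y, `|y i| <= N y) ->
  (forall s : K -> bool, N (fun i => \sum_k sgn (s k) * x k i) <= B) ->
  \sum_k `|x k i| <= B.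
Proof.
move=> N1 NB; apply: le_trans (NB (fun k => x k i < 0)).
apply: le_trans (N1 _); apply: le_trans (ler_norm _).
by under eq_bigr do rewrite -sgn_lt0.
Qed.

(** The pair [l], [y] encodes a factorization through l_1 over [M]: [x] goes to the vector of
    entries [dot x (l m) * nrm2 (y m)], whose l_1 norm is the cost, and the m-th basis vector goes
    to [y m] normalized. *)
Definition cost (I J M : finType) (l : M -> I -> R) (y : M -> J -> R) (x : I -> R) : R :=
  \sum_m `|dot x (l m)| * nrm2 (y m).

Definition decomposes (I J M : finType) (W : (I -> R) -> Prop) (A : I -> J -> R)
    (l : M -> I -> R) (y : M -> J -> R) :=
  forall x, W x -> forall j, app A x j = \sum_m dot x (l m) * y m j.

End Summing.

Lemma sum_pair (R : nmodType) (A B : finType) (F : A * B -> R) :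
  \sum_k F k = \sum_a \sum_b F (a, b).
Proof. by rewrite pair_bigA; apply: eq_bigr => -[]. Qed.

Lemma sum_sumType (R : nmodType) (A B : finType) (F : A + B -> R) :
  \sum_k F k = \sum_a F (inl a) + \sum_b F (inr b).
Proof. exact: big_sumType. Qed.

(** * Added coordinates that force factorization through l_1 *)

Section Kill.
Context (R : realType) (P G U : finType) (NE : (P -> R) -> R) (b : G -> P -> R).
Context (sg : P -> G) (u : U -> P -> P -> R).
Hypothesis NE0 : NE (fun=> 0) = 0.
Hypothesis NEge0 : forall x, 0 <= NE x.
Hypothesis NEl1 : forall x, \sum_i `|x i| <= NE x.
Hypothesis b_le1 : forall g, nrm2 (b g) <= 1.
Hypothesis bsg : forall i i', b (sg i) i' = (i' == i)%:R.
Hypothesis blift : forall y : P -> R, exists c : G -> R,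
  (forall i, \sum_g c g * b g i = y i) /\ \sum_g `|c g| <= 2 * nrm2 y.
Hypothesis u_summing : forall m, summing (fun=> True) NE (u m) 2.
Hypothesis u_net : forall A : P -> P -> R, summing (fun=> True) NE A 1 ->
  exists m, forall i, nrm2 (fun j => A i j - u m i j) <= 1.

Definition kidx : finType := (P + U * G)%type.
Definition kpt (z : kidx -> R) : P -> R := fun i => z (inl i).
Definition ksp (z : kidx -> R) := forall m i,
  \sum_g z (inr (m, g)) * b g i = app (u m) (kpt z) i.
Definition knorm (z : kidx -> R) : R :=
  Num.max (NE (kpt z)) (\big[Num.max/0]_m \sum_g `|z (inr (m, g))|).

Lemma knorm_le z B : 0 <= B -> NE (kpt z) <= B ->
  (forall m, \sum_g `|z (inr (m, g))| <= B) -> knorm z <= B.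
Proof. by move=> B0 h1 h2; rewrite /knorm ge_max h1/=; apply/bigmax_leP. Qed.

Lemma knorm_pt z : NE (kpt z) <= knorm z.
Proof. by rewrite /knorm le_max lexx. Qed.

Lemma knorm_h z m : \sum_g `|z (inr (m, g))| <= knorm z.
Proof. by rewrite /knorm le_max; apply/orP; right; apply: le_bigmax. Qed.

Definition hpart (h : U -> G -> R) : kidx -> R :=
  fun i => match i with inl _ => 0 | inr (m, g) => h m g end.

Definition kker (h : U -> G -> R) := forall m i, \sum_g h m g * b g i = 0.

Lemma ksp_hpart h : kker h -> ksp (hpart h).
Proof.
by move=> hk m i; rewrite hk /app big1// => j _; rewrite /kpt/= mul0r.
Qed.

Lemma knorm_hpart h B : 0 <= B -> (forall m, \sum_g `|h m g| <= B) ->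
  knorm (hpart h) <= B.
Proof. by move=> B0 hB; apply: knorm_le => //; rewrite /kpt/= NE0. Qed.

Section Extend.
Context (J : finType) (zeta : kidx -> J -> R).
Hypothesis zeta_summing : summing ksp knorm zeta 1.

(* With w m g = nrm2 (ka m g), the summing inequality is applied to the columns of
   sqrt w * Q * sqrt w, Q being the orthogonal projection onto the span of the coordinates of
   ka m / sqrt w: the columns lie in the kernel because ka does, and Bessel's inequality bounds
   their signed sums. *)
Lemma trace_le (ka : U -> G -> J -> R) (s : R) : 0 <= s ->
  (forall j, kker (fun m g => ka m g j)) ->
  (forall m, \sum_g nrm2 (ka m g) <= s) ->
  \sum_m \sum_g dot (ka m g) (zeta (inr (m, g))) <= s.
Proof.
move=> s0 kk ks.
pose w m g := nrm2 (ka m g).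
have w0 m g : 0 <= w m g by exact: nrm2_ge0.
pose S m (l : 'I_#|J|) g := (Num.sqrt (w m g))^-1 * ka m g (enum_val l).
have kaS m g l : Num.sqrt (w m g) * S m l g = ka m g (enum_val l).
  have [h|h] := eqVneq (Num.sqrt (w m g)) 0; last by rewrite mulVKf.
  rewrite h mul0r; move/eqP: h; rewrite sqrtr_eq0 => h.
  by rewrite (@nrm2_eq0 _ _ (ka m g))//; apply/eqP; rewrite eq_le h w0.
have /choice[f fP] : forall m, exists f : 'I_#|J| -> G -> R, [/\
    forall l g, S m l g = \sum_t dot (S m l) (f t) * f t g,
    forall y, \sum_t dot y (f t) ^+ 2 <= \sum_g y g ^+ 2 &
    forall t i, \sum_g Num.sqrt (w m g) * f t g * b g i = 0].
  move=> m; have [f [f1 _ f2 _ f3]] := gram_schmidt_fun (S m).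
  exists f; split => // t.
  apply: (f3 (fun x => forall i, \sum_g Num.sqrt (w m g) * x g * b g i = 0)).
  - by move=> i; rewrite big1// => g _; rewrite mulr0 mul0r.
  - move=> a x y xQ yQ i; rewrite -[RHS](mulr0 a) -[RHS]addr0.
    rewrite -[in X in _ = a * X + _](xQ i) -[X in _ = _ + X](yQ i).
    by rewrite big_distrr/= -big_split/=; apply: eq_bigr => g _; ring.
  - by move=> l i; rewrite -[RHS](kk (enum_val l) m i); apply: eq_bigr => g _; rewrite kaS.
pose z (k : U * G) : kidx -> R := hpart (fun m g =>
  (m == k.1)%:R * (Num.sqrt (w m g) * (\sum_t f m t k.2 * f m t g) * Num.sqrt (w m k.2))).
have zW k : ksp (z k).
  apply: ksp_hpart => m i.
  have [_ _ f3] := fP m.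
  transitivity (\sum_t (m == k.1)%:R * f m t k.2 * Num.sqrt (w m k.2) *
     \sum_g Num.sqrt (w m g) * f m t g * b g i); last first.
    by rewrite big1// => t _; rewrite f3 mulr0.
  under [RHS]eq_bigr do rewrite big_distrr/=.
  rewrite exchange_big/=; apply: eq_bigr => g _.
  rewrite big_distrr/= big_distrl/= big_distrr/= big_distrl/=.
  by apply: eq_bigr => t _; ring.
have zB (e : U * G -> bool) : knorm (fun i => \sum_k sgn R (e k) * z k i) <= s.
  have -> : (fun i => \sum_k sgn R (e k) * z k i) =
      hpart (fun m g => \sum_k sgn R (e k) * z k (inr (m, g))).
    by apply/funext => -[i|[m g]]//=; rewrite big1// => k _; rewrite /= mulr0.
  apply: knorm_hpart => // m; apply: le_trans (ks m); rewrite -/(w m _).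
  have [_ bes _] := fP m.
  (* The signed sum is sqrt w times the projection of the signed sqrt w. Pairing it with its own
     signs gives the inner product of the projections of [y'] and [y], each of squared norm at most
     the sum of [w m]. *)
  pose y g := sgn R (e (m, g)) * Num.sqrt (w m g).
  pose r g := \sum_k sgn R (e k) * z k (inr (m, g)).
  have rE g : r g = Num.sqrt (w m g) * \sum_t dot y (f m t) * f m t g.
    rewrite /r sum_pair/=.
    rewrite (bigD1 m)//= [X in _ + X]big1 ?addr0; last first.
      move=> m' /negbTE mm; rewrite big1// => g' _.
      by rewrite eq_sym mm mul0r mulr0.
    under [X in _ = _ * X]eq_bigr do rewrite /dot big_distrl/=.
    rewrite exchange_big/= big_distrr/=; apply: eq_bigr => g' _.
    rewrite eqxx mul1r big_distrr/= big_distrl/= !big_distrr/=.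
    by apply: eq_bigr => t _; rewrite /y; ring.
  pose y' g := sgn R (r g < 0) * Num.sqrt (w m g).
  have -> : \sum_g `|r g| = \sum_t dot y' (f m t) * dot y (f m t).
    under eq_bigr do rewrite -sgn_lt0 [X in _ * X]rE mulrA -/(y' _) big_distrr/=.
    rewrite exchange_big/=; apply: eq_bigr => t _.
    by rewrite [dot y' _]/dot big_distrl/=; apply: eq_bigr => g _; ring.
  have yw (e' : G -> bool) : \sum_g (sgn R (e' g) * Num.sqrt (w m g)) ^+ 2 = \sum_g w m g.
    apply: eq_bigr => g _; rewrite exprMn sqr_sqrtr//.
    by rewrite -real_normK ?num_real// sgn_norm expr1n mul1r.
  have h1 := bes y; have h2 := bes y'.
  rewrite (yw (fun g => e (m, g))) in h1; rewrite (yw (fun g => r g < 0)) in h2.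
  have : \sum_t dot y' (f m t) * dot y (f m t) <=
      \sum_t 2^-1 * (dot y' (f m t) ^+ 2 + dot y (f m t) ^+ 2).
    apply: ler_sum => t _.
    have := sqr_ge0 (dot y' (f m t) - dot y (f m t)).
    by rewrite sqrrB -mulr_natl; lra.
  rewrite -big_distrr/= big_split/=; lra.
have := zeta_summing zW zB; rewrite mul1r; apply: le_trans.
rewrite sum_pair/=.
(* The projection fixes the coordinates of [ka m] over sqrt w, so [ka] is recovered from the columns
   [z] with coefficients [ka] over [w], vectors of Euclidean norm at most 1. *)
have E m j : \sum_g ka m g j * zeta (inr (m, g)) j =
    \sum_g ((w m g)^-1 * ka m g j) * app zeta (z (m, g)) j.
  have [f1 _ _] := fP m.
  have kaE g' : ka m g' j = \sum_g (w m g)^-1 * ka m g j * z (m, g) (inr (m, g')).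
    transitivity (Num.sqrt (w m g') * \sum_t dot (S m (enum_rank j)) (f m t) * f m t g').
      by rewrite -f1 kaS enum_rankK.
    under eq_bigr do rewrite /dot big_distrl/=.
    rewrite exchange_big/= big_distrr/=; apply: eq_bigr => g _.
    rewrite eqxx mul1r !(big_distrr, big_distrl)/=; apply: eq_bigr => t _.
    rewrite /S enum_rankK.
    have -> : (w m g)^-1 = (Num.sqrt (w m g))^-1 * (Num.sqrt (w m g))^-1.
      by rewrite -invfM -expr2 sqr_sqrtr.
    have [h|h] := eqVneq (Num.sqrt (w m g)) 0; first by rewrite h invr0 !(mul0r, mulr0).
    by field.
  under [LHS]eq_bigr do rewrite kaE big_distrl/=.
  rewrite exchange_big/=; apply: eq_bigr => g _.
  rewrite /app sum_sumType/= [X in X + _]big1 ?add0r; last first.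
    by move=> i _; rewrite mul0r.
  rewrite sum_pair/=.
  rewrite (bigD1 m)//= [X in _ + X]big1 ?addr0; last first.
    move=> m' /negbTE mm; rewrite big1// => g' _.
    by rewrite mm !mul0r.
  by rewrite big_distrr/=; apply: eq_bigr => g' _; ring.
apply: ler_sum => m _.
rewrite /dot exchange_big/=; under eq_bigr do rewrite E.
rewrite exchange_big/=; apply: ler_sum => g _.
apply: le_trans (dot_le (fun j => (w m g)^-1 * ka m g j) _) _.
apply: ler_piMl; first exact: nrm2_ge0.
rewrite nrm2Z ger0_norm ?invr_ge0// -/(w m g).
by have [->|h] := eqVneq (w m g) 0; rewrite ?mulr0 ?mulVf.
Qed.

(** Trace duality. On tuples [ka] of kernel elements, [zeta] acts as a functional bounded by
    [trace_le] for the norm max_m sum_g nrm2. A Hahn-Banach extension [p] has dual norm at most 1,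
    and the dual norm is sum_m max_g nrm2. *)
Lemma kernel_extension : exists (p : U -> G -> J -> R) (th : U -> R),
  [/\ forall m, 0 <= th m, forall m g, nrm2 (p m g) <= th m, \sum_m th m <= 1 &
      forall h, kker h -> forall j,
        app zeta (hpart h) j = \sum_m \sum_g h m g * p m g j].
Proof.
pose S (ka : U * G * J -> R) : R :=
  \big[Num.max/0]_m \sum_g nrm2 (fun j => ka (m, g, j)).
have S0 ka : 0 <= S ka by rewrite /S; apply: bigmax_ge_id.
have SZ (a : R) x : 0 <= a -> S (fun j => a * x j) = a * S x.
  move=> a0; rewrite /S (big_morph _ (fun y z => maxr_pMr y z a0) (mulr0 a)).
  apply: eq_bigr => m _; rewrite big_distrr/=; apply: eq_bigr => g _.
  by rewrite nrm2Z ger0_norm.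
have leS ka m : \sum_g nrm2 (fun j => ka (m, g, j)) <= S ka.
  exact: (@le_bigmax _ _ _ 0 (fun m => \sum_g nrm2 (fun j => ka (m, g, j)))).
have SD x y : S (fun j => x j + y j) <= S x + S y.
  apply/bigmax_leP; split=> [|m _]; first by rewrite addr_ge0.
  apply: le_trans (lerD (leS x m) (leS y m)); rewrite -big_split/=.
  by apply: ler_sum => g _; exact: nrm2D.
pose T (x : U * G * J -> R) : R := \sum_m \sum_g dot (fun j => x (m, g, j)) (zeta (inr (m, g))).
pose Gr (x : U * G * J -> R) r := (forall j, kker (fun m g => x (m, g, j))) /\ r = T x.
have dGr : dominated S Gr.
  split.
  - split; first by move=> j m i; rewrite big1// => g _; rewrite mul0r.
    by rewrite /T big1// => m _; rewrite big1// => g _; rewrite /dot big1// => j _; rewrite mul0r.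
  - move=> a x r y t [kx ->] [ky ->]; split.
      move=> j m i; rewrite -[RHS](mulr0 a) -[RHS]addr0.
      rewrite -[in X in _ = a * X + _](kx j m i) -[X in _ = _ + X](ky j m i).
      by rewrite big_distrr/= -big_split/=; apply: eq_bigr => g _; ring.
    rewrite /T big_distrr/= -big_split/=; apply: eq_bigr => m _.
    rewrite big_distrr/= -big_split/=; apply: eq_bigr => g _.
    rewrite /dot big_distrr/= -big_split/=; apply: eq_bigr => j _; ring.
  - move=> x r [kx ->]; apply: (trace_le (ka := fun m g j => x (m, g, j))) => //.
have [gg [gE gS]] := hahn_banach_fin SZ SD dGr.
pose p m g j := gg (m, g, j).
have gsum x : \sum_k x k * gg k = \sum_m \sum_g dot (fun j => x (m, g, j)) (p m g).
  by rewrite !sum_pair.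
exists p, (fun m => \big[Num.max/0]_g nrm2 (p m g)); split.
- by move=> m; apply: bigmax_ge_id.
- by move=> m g; apply: (@le_bigmax _ _ _ 0 (fun g => nrm2 (p m g))).
(* For each [m], a vector norming the largest [p m g], placed at that [g], attains the maximum. *)
- have /choice[ka kaP] : forall m, exists k : G -> J -> R, \sum_g nrm2 (k g) <= 1 /\
      \sum_g dot (k g) (p m g) = \big[Num.max/0]_g nrm2 (p m g).
    move=> m; have [->|[g ->]] : \big[Num.max/0]_g nrm2 (p m g) = 0 \/
        exists g, \big[Num.max/0]_g nrm2 (p m g) = nrm2 (p m g).
      elim/big_ind: _ => [|x y hx hy|g _]; [by left|by rewrite maxEle; case: ifP|].
      by right; exists g.
      exists (fun _ _ => 0); rewrite big1 => [|g _]; last by rewrite nrm2_0.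
      by split=> //; rewrite big1// => g _; rewrite /dot big1// => j _; rewrite mul0r.
    have [d [d1 dE]] := nrm2_dual (p m g).
    exists (fun g' j => (g' == g)%:R * d j); split.
      under eq_bigr do rewrite nrm2Z normr_nat.
      by rewrite (bigD1 g)//= eqxx mul1r big1 ?addr0// => g' /negbTE ->; rewrite mul0r.
    rewrite (bigD1 g)//= -dE big1 ?addr0.
      by rewrite /dot; apply: eq_bigr => j _; rewrite eqxx mul1r.
    by move=> g' /negbTE ->; rewrite /dot big1// => j _; rewrite !mul0r.
  have := gS (fun k => ka k.1.1 k.1.2 k.2); rewrite gsum/=.
  under eq_bigr do rewrite (kaP _).2.
  move/le_trans; apply; apply/bigmax_leP; split=> // m _; exact: (kaP m).1.
- move=> h hk j.
  (* Testing on [h] tensored with the j-th unit vector reads off coordinate [j]. *)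
  pose x (k : U * G * J) := h k.1.1 k.1.2 * (k.2 == j)%:R.
  have xd m g (y : J -> R) : dot (fun j => x (m, g, j)) y = h m g * y j.
    rewrite /dot /x/= (bigD1 j)//= eqxx mulr1 big1 ?addr0// => i /negbTE ->.
    by rewrite mulr0 mul0r.
  have Gx : Gr x (app zeta (hpart h) j).
    split.
      move=> i m k; rewrite /x/= -[RHS](mulr0 (i == j)%:R) -[X in _ = _ * X](hk m k).
      by rewrite big_distrr/=; apply: eq_bigr => g _; ring.
    rewrite /T /app sum_sumType/= big1 ?add0r => [|i _]; last by rewrite mul0r.
    by rewrite sum_pair/=; apply: eq_bigr => m _; apply: eq_bigr => g _; rewrite xd.
  rewrite (gE _ _ Gx) gsum; apply: eq_bigr => m _; apply: eq_bigr => g _.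
  by rewrite xd.
Qed.

End Extend.

Lemma sum_delta (I : finType) (F : I -> R) i : \sum_k (k == i)%:R * F k = F i.
Proof.
by rewrite (bigD1 i)//= eqxx mul1r big1 ?addr0// => k /negbTE ->; rewrite mul0r.
Qed.

Lemma sg_sum (t : P -> R) k : \sum_g (\sum_i (g == sg i)%:R * t i) * b g k = t k.
Proof.
under eq_bigr do rewrite big_distrl/=.
rewrite exchange_big/=; under eq_bigr => i _.
  under eq_bigr do rewrite -mulrA.
  rewrite sum_delta bsg; over.
by under eq_bigr do rewrite eq_sym mulrC; exact: sum_delta.
Qed.

(** A linear lifting of [x] without control of the norm: [u m x] is written on the generators
    [sg i], which [b] sends to the unit vectors. *)
Definition klift (k : P) : kidx -> R := fun z => match z with
  | inl i => (i == k)%:R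
  | inr (m, g) => \sum_i (g == sg i)%:R * u m k i end.

Lemma kpt_klift x : kpt (app klift x) = x.
Proof.
apply/funext => i; rewrite /kpt /app/=.
by under eq_bigr do rewrite eq_sym mulrC; exact: sum_delta.
Qed.

Lemma klift_ksp x : ksp (app klift x).
Proof.
move=> m i; rewrite kpt_klift /app/=.
under eq_bigr do rewrite big_distrl/=.
rewrite exchange_big/=; apply: eq_bigr => k _.
by under eq_bigr do rewrite -mulrA; rewrite -big_distrr/= sg_sum.
Qed.

Lemma nrm2_rank (I : finType) (F : 'I_#|I| -> R) :
  nrm2 (fun i => F (enum_rank i)) = nrm2 F.
Proof.
rewrite /nrm2 [in RHS](reindex enum_rank)//=.
by apply: onW_bij; exists enum_val; [exact: enum_rankK|exact: enum_valK].
Qed.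

Lemma ksp_lin a z z' : ksp z -> ksp z' -> ksp (fun i => a * z i + z' i).
Proof.
move=> kz kz' m i; have -> : kpt (fun i => a * z i + z' i) = fun i => a * kpt z i + kpt z' i by [].
rewrite appD appZ -kz -kz' big_distrr/= -big_split/=.
by apply: eq_bigr => g _; ring.
Qed.

Lemma ksp0 : ksp (fun=> 0).
Proof.
move=> m i; rewrite /app !big1// => [j _|g _]; last by rewrite mul0r.
by rewrite /kpt mul0r.
Qed.

Lemma knorm_ge0 z : 0 <= knorm z.
Proof. exact: le_trans (knorm_pt z). Qed.

Lemma knorm_coord z i : `|z i| <= knorm z.
Proof.
case: i => [i|[m g]].
  apply: le_trans (knorm_pt z); apply: le_trans (NEl1 _).
  by rewrite (bigD1 i)//= lerDl sumr_ge0.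
apply: le_trans (knorm_h z m).
by rewrite (bigD1 g)//= lerDl sumr_ge0.
Qed.

Lemma knormD z z' : (forall x y, NE (fun i => x i + y i) <= NE x + NE y) ->
  knorm (fun i => z i + z' i) <= knorm z + knorm z'.
Proof.
move=> NED; apply: knorm_le; first by rewrite addr_ge0 ?knorm_ge0.
  by apply: le_trans (lerD (knorm_pt z) (knorm_pt z')); exact: NED.
move=> m; apply: le_trans (lerD (knorm_h z m) (knorm_h z' m)).
by rewrite -big_split/=; apply: ler_sum => g _; exact: ler_normD.
Qed.

Lemma knormZ a z : (forall a x, NE (fun i => a * x i) = `|a| * NE x) ->
  knorm (fun i => a * z i) = `|a| * knorm z.
Proof.
move=> NEZ; rewrite /knorm maxr_pMr//; congr Num.max; first exact: NEZ.
rewrite (big_morph _ (fun y z => maxr_pMr y z (normr_ge0 a)) (mulr0 _)).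
apply: eq_bigr => m _; rewrite big_distrr/=; apply: eq_bigr => g _.
by rewrite normrM.
Qed.

Lemma knorm_le_l1 K z : 0 <= K -> (forall x, NE x <= K * \sum_i `|x i|) ->
  knorm z <= (K + 1) * \sum_i `|z i|.
Proof.
move=> K0 NEK; rewrite sum_sumType/=.
set a := \sum_i `|z (inl i)|; set c := \sum_(m : U * G) _.
have a0 : 0 <= a by exact: sumr_ge0.
have c0 : 0 <= c by exact: sumr_ge0.
apply: knorm_le; first by rewrite mulr_ge0 ?addr_ge0.
  by apply: le_trans (NEK _) _; rewrite -/a; nra.
move=> m; have : \sum_g `|z (inr (m, g))| <= c.
  rewrite /c sum_pair/= (bigD1 m)//= lerDl.
  by apply: sumr_ge0 => m' _; exact: sumr_ge0.
by move: (\sum_g _) => t; nra.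
Qed.

(** The rows of a projection onto [ksp]: [x] is lifted by [klift], and a generator [g] is corrected
    by the combination of the [sg i] that has the same image under [b]. *)
Definition kproj (k : kidx) : kidx -> R := match k with
  | inl i => klift i
  | inr (m, g) => hpart (fun m' g' =>
      (m' == m)%:R * ((g' == g)%:R - \sum_i (g' == sg i)%:R * b g i)) end.

Lemma kproj_ksp k : ksp (kproj k).
Proof.
case: k => [i|[m g]] /=.
  have := klift_ksp (fun k => (k == i)%:R); congr ksp.
  by apply/funext => z; rewrite app_delta.
apply: ksp_hpart => m' i'.
under eq_bigr do rewrite -mulrA mulrBl.
by rewrite -big_distrr/= sumrB sum_delta sg_sum subrr mulr0.
Qed.

Lemma kprojK z : ksp z -> app kproj z = z.
Proof.
move=> kz; apply/funext => k; rewrite /app sum_sumType/=.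
case: k => [i|[m g']] /=.
  rewrite [X in _ + X]big1 ?addr0; last by move=> [m g] _ /=; rewrite mulr0.
  by under eq_bigr do rewrite eq_sym mulrC; exact: sum_delta.
rewrite sum_pair/= (bigD1 m)//= [X in _ + (_ + X)]big1 ?addr0; last first.
  move=> m' /negbTE mm; rewrite big1// => g _.
  by rewrite eq_sym mm mul0r mulr0.
under [X in _ + X]eq_bigr do rewrite eqxx mul1r mulrBr.
rewrite sumrB (_ : \sum_g z (inr (m, g)) * (g' == g)%:R = z (inr (m, g'))); last first.
  by under eq_bigr do rewrite mulrC eq_sym; exact: (sum_delta (fun g => z (inr (m, g)))).
rewrite addrCA -[RHS]addr0; congr (_ + _); apply/eqP; rewrite subr_eq0; apply/eqP.
transitivity (\sum_i (g' == sg i)%:R * app (u m) (kpt z) i).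
  under eq_bigr do rewrite big_distrr/=.
  rewrite exchange_big/=; apply: eq_bigr => i _.
  by rewrite /app big_distrr/=; apply: eq_bigr => k _; rewrite /kpt; ring.
under eq_bigr => i _ do rewrite -(kz m i) big_distrr/=.
rewrite exchange_big/=; apply: eq_bigr => g _.
by rewrite big_distrr/=; apply: eq_bigr => i _; ring.
Qed.

Theorem kill_factor (J : finType) (zeta : kidx -> J -> R) :
  summing ksp knorm zeta 1 ->
  exists (M : finType) (l : M -> kidx -> R) (y : M -> J -> R),
    decomposes ksp zeta l y /\ forall z, ksp z -> cost l y z <= 17 * knorm z.
Proof.
move=> zs; have [p [th [th0 pth th1 pE]]] := kernel_extension zs.
(* Once the extension [p] is subtracted, kernels are annihilated and only a function of x is left;
   see [zlift]. *)
pose zeta' (i : kidx) j := zeta i j - match i with inl _ => 0 | inr (m, g) => p m g j end.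
have zE z j : app zeta' z j = app zeta z j - \sum_m \sum_g z (inr (m, g)) * p m g j.
  rewrite /app /zeta'; under eq_bigr do rewrite mulrBr.
  rewrite sumrB; congr (_ - _); rewrite sum_sumType/= sum_pair/= big1 ?add0r//.
  by move=> i _; rewrite mulr0.
have zlift z j : ksp z -> app zeta' z j = app zeta' (app klift (kpt z)) j.
  move=> kz; apply/eqP; rewrite -subr_eq0 -appB.
  pose h m g := z (inr (m, g)) - app klift (kpt z) (inr (m, g)).
  have -> : (fun i => z i - app klift (kpt z) i) = hpart h.
    apply/funext => -[i|[m g]] //=.
    by rewrite -[app klift _ _]/(kpt (app klift (kpt z)) i) kpt_klift subrr.
  rewrite zE pE ?subrr//.
  move=> m i; under eq_bigr do rewrite mulrBl.
  by rewrite sumrB kz (klift_ksp (kpt z)) kpt_klift subrr.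
pose Q k j := app zeta' (klift k) j.
have QE x j : app Q x j = app zeta' (app klift x) j by rewrite app_suml.
(* Lifting costs a factor 2 and [u m] has constant 2, so the lifted family is bounded by 4 B. Then
   [zeta] and the correction by [p] contribute 4 B each. *)
have Qs : summing (fun=> True) NE Q 8.
  move=> K x B _ xB.
  have B0 : 0 <= B by apply: le_trans (xB (fun=> false)).
  have /choice[c cP] : forall km : K * U, exists c : G -> R,
      (forall i, \sum_g c g * b g i = app (u km.2) (x km.1) i) /\
      \sum_g `|c g| <= 2 * nrm2 (app (u km.2) (x km.1)).
    by move=> km; exact: blift.
  pose z k (i : kidx) : R := match i with inl i => x k i | inr (m, g) => c (k, m) g end.
  have zW k : ksp (z k) by move=> m i; rewrite (cP (k, m)).1.
  have cB m : \sum_k \sum_g `|c (k, m) g| <= 4 * B.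
    apply: (@le_trans _ _ (\sum_k 2 * nrm2 (app (u m) (x k)))).
      by apply: ler_sum => k _; exact: (cP (k, m)).2.
    rewrite -big_distrr/= (_ : 4 = 2 * 2); last by ring.
    by rewrite -mulrA ler_wpM2l// u_summing.
  have zB (s : K -> bool) : knorm (fun i => \sum_k sgn R (s k) * z k i) <= 4 * B.
    apply: knorm_le; first by rewrite mulr_ge0.
    - apply: le_trans (xB s) _; by rewrite ler_peMl// ler1n.
    - move=> m; apply: le_trans (cB m); rewrite exchange_big/=; apply: ler_sum => g _.
      apply: le_trans (ler_norm_sum _ _ _) _; apply: ler_sum => k _.
      by rewrite normrM sgn_norm mul1r.
  have h1 := zs _ _ _ zW zB.
  apply: (@le_trans _ _ (\sum_k (nrm2 (app zeta (z k)) + \sum_m \sum_g `|c (k, m) g| * th m))).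
    apply: ler_sum => k _.
    have -> : nrm2 (app Q (x k)) = nrm2 (fun j => app zeta (z k) j +
        \sum_mg (- c (k, mg.1) mg.2) * p mg.1 mg.2 j).
      apply: eq_nrm2 => j; rewrite QE (_ : x k = kpt (z k))// -zlift// zE sum_pair/= -sumrN.
      by congr (_ + _); apply: eq_bigr => m _; rewrite -sumrN; apply: eq_bigr => g _; rewrite mulNr.
    apply: le_trans (nrm2D _ _) _; rewrite lerD2l.
    apply: le_trans (nrm2_sum _) _; rewrite sum_pair/=.
    apply: ler_sum => m _; apply: ler_sum => g _.
    by rewrite nrm2Z normrN ler_wpM2l.
  rewrite big_split/= (_ : 8 = 4 + 4); last by ring.
  rewrite mulrDl; apply: lerD; first by rewrite -[leRHS]mul1r.
  rewrite exchange_big/=.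
  apply: (@le_trans _ _ (\sum_m th m * (4 * B))).
    apply: ler_sum => m _; under eq_bigr do rewrite -big_distrl/=.
    rewrite -big_distrl/= mulrC.
    by rewrite ler_wpM2l.
  by rewrite -big_distrl/= ler_piMl// mulr_ge0.
(* The rows of Q span at most |P| dimensions; orthonormal coordinates turn Q / 8 into a matrix over
   P, to which the net applies. *)
have [f [fE fle _ feq _]] := gram_schmidt_fun (fun k : 'I_#|P| => Q (enum_val k)).
pose A i i' := 8^-1 * dot (Q i) (f (enum_rank i')).
have nA x : nrm2 (app A x) = 8^-1 * nrm2 (app Q x).
  have AE : app A x =1 fun i' => 8^-1 * app (fun i l => dot (Q i) (f l)) x (enum_rank i').
    by move=> i'; rewrite /app big_distrr/=; apply: eq_bigr => i _; rewrite /A; ring.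
  rewrite (eq_nrm2 AE) nrm2Z ger0_norm ?invr_ge0//; congr (_ * _).
  rewrite nrm2_rank.
  have [k0 _|P0] := pickP (fun _ : P => true).
    have [_ /(_ P x (fun i => enum_rank i))] := feq (enum_rank k0).
    under eq_nrm2 do under eq_bigr do rewrite enum_rankK.
    rewrite -/(app Q x) => ->.
    by apply: eq_nrm2 => l; apply: eq_bigr => k _; rewrite enum_rankK.
  rewrite /nrm2 [in RHS]big1 => [|i _]; last by rewrite /app big_pred0// expr2 mul0r.
  by rewrite [in LHS]big1// => i _; rewrite /app big_pred0// expr2 mul0r.
have As : summing (fun=> True) NE A 1.
  move=> K x B xT xB; under eq_bigr do rewrite nA.
  rewrite -big_distrr/= ler_pdivrMl// mul1r; exact: Qs.
have [m0 um0] := u_net As.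
pose fP (c : P -> R) j := \sum_t c (enum_val t) * f t j.
have fPle c : nrm2 (fP c) <= nrm2 c.
  apply: le_trans (fle (fun t => c (enum_val t))) _.
  by rewrite -nrm2_rank; under eq_nrm2 do rewrite enum_rankK.
exists (U * G + (G + P))%type.
pose de (k : kidx) (a : R) (i : kidx) := (i == k)%:R * a.
have dotde z k a : dot z (de k a) = z k * a.
  rewrite /dot /de; under eq_bigr do rewrite mulrCA.
  exact: (sum_delta (fun i => z i * a)).
(* The functionals are all coordinates of the [h_m] against [p], those of [h_m0] against 8 [b g],
   and those of x against 8 times the row error of the net. *)
exists (fun m => match m with
  | inl mg => de (inr mg) 1 | inr (inl g) => de (inr (m0, g)) 8 | inr (inr i) => de (inl i) 8 end).
exists (fun m => match m with
  | inl mg => p mg.1 mg.2 | inr (inl g) => fP (b g)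
  | inr (inr i) => fP (fun j => A i j - u m0 i j) end).
split=> [z kz j|z kz].
  have -> : app zeta z j = \sum_m \sum_g z (inr (m, g)) * p m g j + app Q (kpt z) j.
    by rewrite QE -zlift// zE addrC subrK.
  rewrite !sum_sumType sum_pair/=; congr (_ + _).
    by apply: eq_bigr => m _; apply: eq_bigr => g _; rewrite dotde mulr1.
  under eq_bigr do rewrite dotde.
  under [X in _ + X]eq_bigr do rewrite dotde.
  have -> : app Q (kpt z) j = \sum_i kpt z i * \sum_t 8 * A i (enum_val t) * f t j.
    apply: eq_bigr => i _; congr (_ * _).
    have := fE (enum_rank i) j; rewrite enum_rankK => ->.
    by apply: eq_bigr => t _; rewrite /A enum_valK mulVKf ?pnatr_eq0.
  transitivity (\sum_t 8 * app (u m0) (kpt z) (enum_val t) * f t j +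
      \sum_i z (inl i) * 8 * fP (fun j => A i j - u m0 i j) j).
    have -> : \sum_t 8 * app (u m0) (kpt z) (enum_val t) * f t j =
        \sum_i kpt z i * \sum_t 8 * u m0 i (enum_val t) * f t j.
      under [RHS]eq_bigr do rewrite big_distrr/=.
      rewrite exchange_big/=; apply: eq_bigr => t _.
      by rewrite /app big_distrr big_distrl/=; apply: eq_bigr => i _; ring.
    rewrite -big_split/=; apply: eq_bigr => i _.
    rewrite /fP /kpt -mulrA -mulrDr; congr (_ * _).
    rewrite big_distrr -big_split/=; apply: eq_bigr => t _; ring.
  congr (_ + _).
  under [LHS]eq_bigr => t _ do rewrite -(kz m0 (enum_val t)) big_distrr big_distrl/=.
  rewrite exchange_big/=; apply: eq_bigr => g _.
  by rewrite /fP big_distrr/=; apply: eq_bigr => t _; ring.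
(* The summand 1 is the total mass of [th]; each 8 undoes the normalization of Q, once for [h_m0]
   and once for the l_1 norm of x. *)
rewrite /cost !sum_sumType sum_pair/= (_ : 17 = 1 + (8 + 8)); last by ring.
rewrite mulrDl mul1r mulrDl; apply: lerD; last apply: lerD.
- apply: (@le_trans _ _ (\sum_m th m * knorm z)); last first.
    by rewrite -big_distrl/= ler_piMl// (le_trans _ (knorm_pt z)).
  apply: ler_sum => m _; apply: (@le_trans _ _ (th m * \sum_g `|z (inr (m, g))|)).
    by rewrite big_distrr/=; apply: ler_sum => g _; rewrite dotde mulr1 mulrC ler_wpM2r.
  by rewrite ler_wpM2l// knorm_h.
- apply: (@le_trans _ _ (8 * \sum_g `|z (inr (m0, g))|)); last by rewrite ler_wpM2l// knorm_h.
  rewrite big_distrr/=; apply: ler_sum => g _; rewrite dotde normrM [_ * `|8|]mulrC normr_nat.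
  by apply: ler_piMr; rewrite ?mulr_ge0//; apply: le_trans (fPle _) _.
- apply: (@le_trans _ _ (8 * \sum_i `|kpt z i|)); last first.
    by rewrite ler_wpM2l// (le_trans _ (knorm_pt z)).
  rewrite big_distrr/=; apply: ler_sum => i _; rewrite dotde normrM [_ * `|8|]mulrC normr_nat.
  by apply: ler_piMr; rewrite ?mulr_ge0//; apply: le_trans (fPle _) _.
Qed.

End Kill.

Lemma sum_unit (V : nmodType) (F : unit -> V) : \sum_k F k = F tt.
Proof. by rewrite (big_pred1 tt)// => -[]. Qed.

(** * Finite nets of vectors and of operators *)

Section Nets.
Context (R : realType) (P : finType).

(** Rounding is towards 0: with [|t| <= |x|] coordinatewise, a rounded vector of the unit ball
    remains in the ball. *)
Lemma grid_approx (x K : R) (d D : nat) : (0 < d)%N -> `|x| <= K -> K * d%:R < D%:R ->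
  exists ks : 'I_D * bool, let t := sgn R ks.2 * (ks.1%:R / d%:R) in
    `|x - t| <= d%:R^-1 /\ `|t| <= `|x|.
Proof.
move=> d0 xK KD; have dR : 0 < d%:R :> R by rewrite ltr0n.
pose k := Num.truncn (`|x| * d%:R).
have /andP[k1 k2] : (k%:R <= `|x| * d%:R < k.+1%:R).
  by apply: truncn_itv; rewrite mulr_ge0.
have kD : (k < D)%N.
  rewrite -(ltr_nat R); apply: le_lt_trans k1 (le_lt_trans _ KD).
  by rewrite ler_wpM2r// ltW.
exists (Ordinal kD, x < 0) => /=.
have kx : k%:R / d%:R <= `|x| by rewrite ler_pdivrMr.
have xk : `|x| <= k%:R / d%:R + d%:R^-1.
  by rewrite -{2}[d%:R^-1]mul1r -mulrDl ler_pdivlMr// natr1 ltW.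
split; last by rewrite normrM sgn_norm mul1r ger0_norm// divr_ge0.
move: kx xk; move: (k%:R / d%:R) => v; move: (d%:R^-1) => e kx xk.
rewrite ler_norml /sgn; have [x0|x0] := ltrP x 0.
  by rewrite expr1 (ltr0_norm x0) in kx xk *; lra.
by rewrite expr0 (ger0_norm x0) in kx xk *; lra.
Qed.

Lemma euclid_net : exists (G : finType) (b : G -> P -> R) (sg : P -> G),
  [/\ forall g, nrm2 (b g) <= 1, forall i i', b (sg i) i' = (i' == i)%:R &
      forall y : P -> R, exists c : G -> R,
        (forall i, \sum_g c g * b g i = y i) /\ \sum_g `|c g| <= 2 * nrm2 y].
Proof.
pose d := #|P|.+1; have d0 : d%:R != 0 :> R by rewrite pnatr_eq0.
pose G := {ffun P -> 'I_d.+1 * bool}.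
pose raw (g : G) i : R := sgn R (g i).2 * ((g i).1%:R / d%:R).
(* Codes of points outside the ball are sent to 0, so the bound holds for every code. *)
pose b (g : G) : P -> R := if nrm2 (raw g) <= 1 then raw g else fun=> 0.
pose sg (i : P) : G := [ffun i' => (if i' == i then ord_max else ord0, false)].
have rsg i i' : raw (sg i) i' = (i' == i)%:R.
  rewrite /raw ffunE/= /sgn expr0 mul1r.
  by case: eqP => _/=; rewrite ?divff// mul0r.
have bsg i : b (sg i) = raw (sg i).
  rewrite /b ifT//; apply: nrm2_le => //; rewrite (bigD1 i)//= rsg eqxx.
  by rewrite big1 ?addr0// => j /negbTE ji; rewrite rsg ji expr2 mulr0.
exists G, b, sg; split.
- by move=> g; rewrite /b; case: ifPn => //; rewrite nrm2_0.
- by move=> i i'; rewrite bsg rsg.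
move=> y; pose a := nrm2 y; have a0 : 0 <= a := nrm2_ge0 y.
pose y' i := a^-1 * y i.
have ay i : a * y' i = y i.
  rewrite /y'; have [h|h] := eqVneq a 0; last by rewrite mulVKf.
  by rewrite h mul0r (nrm2_eq0 _ h).
have y'1 : nrm2 y' <= 1.
  rewrite nrm2Z ger0_norm ?invr_ge0// -/a.
  by have [->|h] := eqVneq a 0; [rewrite mulr0|rewrite mulVf].
have /choice[t tP] : forall i, exists ks : 'I_d.+1 * bool, let t := sgn R ks.2 * (ks.1%:R / d%:R) in
    `|y' i - t| <= d%:R^-1 /\ `|t| <= `|y' i|.
  move=> i; apply: (@grid_approx _ 1) => //; first exact: le_trans (ler_nrm2 _ _) y'1.
  by rewrite mul1r ltr_nat.
pose g : G := finfun t.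
have rg i : raw g i = sgn R (t i).2 * ((t i).1%:R / d%:R) by rewrite /raw ffunE.
have bg : b g = raw g.
  rewrite /b ifT//; apply: le_trans _ y'1; rewrite /nrm2 ler_wsqrtr//.
  apply: ler_sum => i _; rewrite -(real_normK (num_real (raw g i))) -(real_normK (num_real (y' i))).
  by rewrite lerXn2r ?nnegrE// rg; exact: (tP i).2.
(* The normalized vector is a grid point plus an error of at most 1 / d per coordinate, carried by
   the unit vectors. As |P| < d, the total is at most 1 + 1. *)
exists (fun g' => a * ((g' == g)%:R + \sum_i (g' == sg i)%:R * (y' i - raw g i))); split.
  move=> i; under eq_bigr do rewrite -mulrA mulrDl.
  rewrite -big_distrr/= big_split/= sum_delta bg.
  under eq_bigr do rewrite big_distrl/=.
  rewrite exchange_big/=; under eq_bigr => k _.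
    under eq_bigr do rewrite -mulrA.
    rewrite sum_delta bsg rsg eq_sym mulrC; over.
  by rewrite sum_delta addrC subrK ay.
under eq_bigr do rewrite normrM (ger0_norm a0).
rewrite -big_distrr/= mulrC ler_wpM2r//.
apply: (@le_trans _ _ (\sum_g' ((g' == g)%:R * 1 + \sum_i (g' == sg i)%:R * `|y' i - raw g i|))).
  apply: ler_sum => g' _; apply: le_trans (ler_normD _ _) _.
  rewrite mulr1 normr_nat lerD2l; apply: le_trans (ler_norm_sum _ _ _) _.
  by apply: ler_sum => i _; rewrite normrM normr_nat.
rewrite big_split/= (sum_delta (fun=> 1)) exchange_big/=.
under eq_bigr do rewrite (sum_delta (fun=> _)).
rewrite (_ : 2 = 1 + 1)// lerD2l.
apply: (@le_trans _ _ (\sum_(i : P) d%:R^-1)).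
  by apply: ler_sum => i _; rewrite rg; exact: (tP i).1.
rewrite sumr_const -[leLHS]mulr_natr ler_pdivrMl ?ltr0n// mulr1 ler_nat.
exact: leqnSn.
Qed.

Lemma op_net (NE : (P -> R) -> R) (K : R) : (forall x, 0 <= NE x) ->
  (forall x, \sum_i `|x i| <= NE x) -> (forall x, NE x <= K * \sum_i `|x i|) ->
  exists (U : finType) (u : U -> P -> P -> R),
    (forall m, summing (fun=> True) NE (u m) 2) /\
    forall A : P -> P -> R, summing (fun=> True) NE A 1 ->
      exists m, forall i, nrm2 (fun j => A i j - u m i j) <= 1.
Proof.
move=> NE0 NEl1 NEK.
(* Rounding the entries by 1 / d moves each row by at most |P| / d and the summing constant by at
   most |P|^2 / d <= 1, from 1 to 2. *)
pose d := (#|P| * #|P|).+1; have d0 : 0 < d%:R :> R by rewrite ltr0n.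
pose D := (Num.truncn (`|K| * d%:R)).+1.
pose U := {ffun P * P -> 'I_D * bool}.
pose raw (m : U) i j : R := sgn R (m (i, j)).2 * ((m (i, j)).1%:R / d%:R).
pose u (m : U) : P -> P -> R :=
  if `[< summing (fun=> True) NE (raw m) 2 >] then raw m else fun _ _ => 0.
exists U, u; split.
  move=> m; rewrite /u; case: asboolP => // _ Q x B _ xB.
  rewrite big1 ?mulr_ge0 ?(le_trans _ (xB (fun=> false)))// => k _.
  rewrite (eq_nrm2 (y := fun=> 0)) ?nrm2_0// => j.
  by rewrite /app big1// => i _; rewrite mulr0.
move=> A As.
have AK i j : `|A i j| <= `|K|.
  apply: le_trans (ler_nrm2 (A i) j) _.
  have h : forall s : unit -> bool, NE (fun i' => \sum_k sgn R (s k) * (i' == i)%:R) <= `|K|.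
    move=> s; apply: le_trans (NEK _) _.
    rewrite (_ : \sum_i0 _ = 1); first by rewrite mulr1 ler_norm.
    rewrite -[RHS](sum_delta (fun=> 1) i); apply: eq_bigr => i' _.
    by rewrite sum_unit normrM sgn_norm mul1r normr_nat mulr1.
  have := As unit (fun _ i' => (i' == i)%:R) `|K| (fun=> Logic.I) h.
  by rewrite sum_unit mul1r (eq_nrm2 (app_delta _ _)).
have /choice[t tP] : forall ij : P * P, exists ks : 'I_D * bool,
    let t := sgn R ks.2 * (ks.1%:R / d%:R) in
    `|A ij.1 ij.2 - t| <= d%:R^-1 /\ `|t| <= `|A ij.1 ij.2|.
  move=> ij; apply: (@grid_approx _ `|K|) => //.
  by have /andP[] := @truncn_itv R (`|K| * d%:R) (mulr_ge0 (normr_ge0 _) (ltW d0)).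
pose m : U := finfun t.
have rm i j : raw m i j = sgn R (t (i, j)).2 * ((t (i, j)).1%:R / d%:R) by rewrite /raw ffunE.
have near i : nrm2 (fun j => A i j - raw m i j) <= #|P|%:R / d%:R.
  apply: le_trans (nrm2_le_l1 _) _; apply: (@le_trans _ _ (\sum_(j : P) d%:R^-1)).
    by apply: ler_sum => j _; rewrite rm; exact: (tP (i, j)).1.
  by rewrite sumr_const mulr_natl.
have Pd : (#|P| * #|P|)%:R <= d%:R :> R by rewrite ler_nat leqnSn.
have nearS : summing (fun=> True) NE (raw m) 2.
  move=> Q x B xT xB.
  have B0 : 0 <= B by apply: le_trans (xB (fun=> false)).
  apply: (@le_trans _ _ (\sum_k (nrm2 (app A (x k)) + \sum_i `|x k i| * (#|P|%:R / d%:R)))).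
    apply: ler_sum => k _.
    rewrite (eq_nrm2 (y := fun j => app A (x k) j + \sum_i (- x k i) * (A i j - raw m i j))).
      apply: le_trans (nrm2D _ _) _; rewrite lerD2l; apply: le_trans (nrm2_sum _) _.
      by apply: ler_sum => i _; rewrite nrm2Z normrN ler_wpM2l.
    by move=> j; rewrite /app -big_split/=; apply: eq_bigr => i _; ring.
  rewrite big_split/= (_ : 2 * B = 1 * B + B); last by ring.
  apply: lerD; first exact: As.
  rewrite exchange_big/=; under eq_bigr do rewrite -big_distrl/=.
  apply: (@le_trans _ _ (\sum_(i : P) B * (#|P|%:R / d%:R))).
    apply: ler_sum => i _; rewrite ler_wpM2r ?divr_ge0//.
    apply: (signs_l1 (N := NE)) => // y; apply: le_trans (NEl1 y).
    by rewrite (bigD1 i)//= lerDl sumr_ge0.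
  rewrite sumr_const (_ : _ *+ _ = B * ((#|P| * #|P|)%:R / d%:R)); last first.
    by rewrite -[LHS]mulr_natl natrM; ring.
  rewrite ler_piMr//.
  by rewrite ler_pdivrMr// mul1r.
exists m => i; rewrite /u; case: asboolP => // _.
apply: le_trans (near i) _; rewrite ler_pdivrMr// mul1r ler_nat.
by rewrite /d ltnW// ltnS; case: #|P| => // n; rewrite leq_pmulr.
Qed.

End Nets.

(** * Khinchine's inequality by the fourth moment *)

Section Khinchine.
Context (R : realType) (P : finType).
Let S := {ffun P -> bool}.
Implicit Types (x : P -> R) (s : S) (l : seq P).

Let flip (a : P) (s : S) : S := [ffun i => s i (+) (i == a)].

Let flipK a : involutive (flip a).
Proof. by move=> s; apply/ffunP => i; rewrite !ffunE addbK. Qed.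

Let ssum x l s := \sum_(i <- l) sgn R (s i) * x i.

Let ssum_flip x l a s : a \notin l -> ssum x l (flip a s) = ssum x l s.
Proof.
move=> al; apply: eq_big_seq => i il; rewrite ffunE.
by rewrite (_ : (i == a) = false) ?addbF//; apply: contraNF al => /eqP <-.
Qed.

(** Flipping the sign at [a] permutes the sign vectors and negates every term. *)
Let sum_odd a (H : S -> R) : (forall s, H (flip a s) = H s) ->
  \sum_(s : S) sgn R (s a) * H s = 0.
Proof.
move=> Hf; have : \sum_(s : S) sgn R (s a) * H s = - \sum_(s : S) sgn R (s a) * H s.
  rewrite {1}(reindex_inj (inv_inj (flipK a)))/= -sumrN; apply: eq_bigr => s _.
  by rewrite Hf ffunE eqxx /sgn; case: (s a); rewrite /= ?expr0 ?expr1; ring.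
lra.
Qed.

Let sgn_sqr c : sgn R c ^+ 2 = 1.
Proof. by rewrite -real_normK ?num_real// sgn_norm expr1n. Qed.

Let moment2 x l : uniq l ->
  \sum_(s : S) ssum x l s ^+ 2 = #|S|%:R * \sum_(i <- l) x i ^+ 2.
Proof.
elim: l => [_|a l IH /= /andP[al ul]].
  by rewrite big_nil mulr0 big1// => s _; rewrite /ssum big_nil expr0n.
rewrite big_cons mulrDr -IH//.
transitivity (\sum_(s : S) (x a ^+ 2 + ssum x l s ^+ 2 + sgn R (s a) * (2 * x a * ssum x l s))).
  apply: eq_bigr => s _; rewrite /ssum big_cons -/(ssum x l s).
  by rewrite sqrrD exprMn sgn_sqr mul1r mulr2n; ring.
rewrite big_split/= sum_odd ?addr0; last by move=> s; rewrite ssum_flip.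
by rewrite big_split/= sumr_const -[X in X + _]mulr_natl.
Qed.

Let moment4 x l : uniq l ->
  \sum_(s : S) ssum x l s ^+ 4 <= 3 * #|S|%:R * (\sum_(i <- l) x i ^+ 2) ^+ 2.
Proof.
elim: l => [_|a l IH /= /andP[al ul]].
  by rewrite big_nil expr0n/= mulr0 big1// => s _; rewrite /ssum big_nil expr0n.
have IH' := IH ul; have M2 := moment2 x ul.
have -> : \sum_(s : S) ssum x (a :: l) s ^+ 4 =
    \sum_(s : S) (x a ^+ 4 + 6 * x a ^+ 2 * ssum x l s ^+ 2 + ssum x l s ^+ 4).
  transitivity (\sum_(s : S) (x a ^+ 4 + 6 * x a ^+ 2 * ssum x l s ^+ 2 + ssum x l s ^+ 4 +
      sgn R (s a) * (4 * x a ^+ 3 * ssum x l s + 4 * x a * ssum x l s ^+ 3))).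
    apply: eq_bigr => s _; rewrite /ssum big_cons -/(ssum x l s).
    by rewrite /sgn; case: (s a); rewrite ?expr0 ?expr1; ring.
  by rewrite big_split/= [X in _ + X]sum_odd ?addr0// => s; rewrite ssum_flip.
rewrite !big_split/= sumr_const -[X in X + _ + _]mulr_natl -big_distrr/= M2 big_cons.
move: IH'; move: (\sum_(s : S) _ ^+ 4) (#|S|%:R) (ler0n R #|S|) (\sum_(i <- l) _) => A n n0 q h.
have : 0 <= n * x a ^+ 4 by rewrite mulr_ge0// exprn_even_ge0.
have -> : 3 * n * (x a ^+ 2 + q) ^+ 2 = 3 * (n * x a ^+ 4) + 6 * x a ^+ 2 * (n * q) + 3 * n * q ^+ 2 by ring.
lra.
Qed.

(** Averaging r a^3 >= r^2 a^2 - r^4 / 6 over the signs, with second moment a^2 and fourth moment at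
    most 3 a^4, leaves a^4 - a^4 / 2. *)
Lemma khinchine x :
  nrm2 x <= 2 / #|S|%:R * \sum_(s : S) `|\sum_i sgn R (s i) * x i|.
Proof.
pose a := nrm2 x; have a0 : 0 <= a := nrm2_ge0 x.
have S0 : 0 < #|S|%:R :> R by rewrite ltr0n; apply/card_gt0P; exists [ffun=> false].
have [->|an0] := eqVneq (nrm2 x) 0; first by rewrite mulr_ge0 ?sumr_ge0// divr_ge0// ltW.
have apos : 0 < a by rewrite lt_def an0.
have us := index_enum_uniq P.
have := moment2 x us; have := moment4 x us; rewrite -nrm2_sqr -/a => m4 m2.
have main s : ssum x (index_enum P) s ^+ 2 * a ^+ 2 - ssum x (index_enum P) s ^+ 4 / 6 <=
    `|ssum x (index_enum P) s| * a ^+ 3.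
  rewrite -[X in X * _ - _]real_normK ?num_real//.
  have -> : ssum x (index_enum P) s ^+ 4 = `|ssum x (index_enum P) s| ^+ 4.
    by rewrite -[RHS]/(_ ^+ (2 * 2)) exprM real_normK ?num_real// -exprM.
  move: (`|_|) (normr_ge0 (ssum x (index_enum P) s)) => r r0.
  rewrite -subr_ge0.
  (* The cubic r^3 - 6 r a^2 + 6 a^3 is smallest at r = sqrt 2 a; 10/7 is a rational substitute for
     sqrt 2 that leaves nonnegative remainders. *)
  have -> : r * a ^+ 3 - (r ^+ 2 * a ^+ 2 - r ^+ 4 / 6) = r / 6 * ((r + 20/7 * a) *
      (r - 10/7 * a) ^+ 2 + 6/49 * (r * a ^+ 2) + 58/343 * a ^+ 3) by field.
  have h1 : 0 <= (r + 20/7 * a) * (r - 10/7 * a) ^+ 2.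
    by rewrite mulr_ge0 ?sqr_ge0//; lra.
  have h2 : 0 <= r * a ^+ 2 by rewrite mulr_ge0 ?sqr_ge0.
  have h3 : 0 <= a ^+ 3 by rewrite exprn_ge0.
  by apply: mulr_ge0; lra.
have : \sum_(s : S) (ssum x (index_enum P) s ^+ 2 * a ^+ 2 - ssum x (index_enum P) s ^+ 4 / 6) <=
    (\sum_(s : S) `|ssum x (index_enum P) s|) * a ^+ 3.
  by rewrite big_distrl/=; apply: ler_sum.
rewrite sumrB -!big_distrl/= m2 => h.
have h2 : #|S|%:R * a / 2 * a ^+ 3 <= (\sum_(s : S) `|ssum x (index_enum P) s|) * a ^+ 3.
  apply: le_trans h; move: m4; move: (\sum_(s : S) _ ^+ 4) (#|S|%:R) => A n m4.
  have -> : n * a / 2 * a ^+ 3 = n * a ^+ 2 * a ^+ 2 - 3 * n * (a ^+ 2) ^+ 2 / 6 by field.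
  lra.
rewrite ler_pM2r ?exprn_gt0// in h2.
rewrite mulrAC ler_pdivlMr// -/a.
by move: h2; rewrite /ssum; move: (\sum_(s : S) _) => E; lra.
Qed.
End Khinchine.

(** * The quadratic-phase level *)

Section Level.
Context (R : realType) (X F : finType) (lam : R).
Let P : finType := (X * X)%type.
Let p : R := #|X|%:R.
Context (h : P -> P -> R) (j0 : P) (ev : F -> X -> X).
Hypothesis X0 : (0 < #|X|)%N.
Hypothesis lam1 : 1 <= lam.
Hypothesis h_le2 : forall j i, `|h j i| <= 2.
Hypothesis h_orthl : forall i i', \sum_j h j i * h j i' = p ^+ 2 * (i == i')%:R.
Hypothesis h_orthr : forall j j', \sum_i h j i * h j' i = p ^+ 2 * (j == j')%:R.
Hypothesis h_j0 : forall i, h j0 i = 1.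

Let p0 : 0 < p. Proof. by rewrite ltr0n. Qed.
Let pn0 : p != 0. Proof. by rewrite gt_eqF. Qed.
Let p2 : 0 < p ^+ 2. Proof. by rewrite exprn_gt0. Qed.
Let lam0 : 0 < lam. Proof. exact: lt_le_trans lam1. Qed.

Definition NE (x : P -> R) : R :=
  Num.max (\sum_i `|x i|) (lam * \big[Num.max/0]_(j | j != j0) `|dot x (h j)|).

Lemma NE_le x B : 0 <= B -> \sum_i `|x i| <= B ->
  (forall j, j != j0 -> lam * `|dot x (h j)| <= B) -> NE x <= B.
Proof.
move=> B0 h1 h2; rewrite /NE ge_max h1/= mulrC -ler_pdivlMr//.
apply/bigmax_leP; split=> [|j /h2]; first by rewrite divr_ge0// ltW.
by rewrite ler_pdivlMr// mulrC.
Qed.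

Lemma NEl1 (x : P -> R) : \sum_i `|x i| <= NE x.
Proof. by rewrite /NE le_max lexx. Qed.

Lemma NEh x j : j != j0 -> lam * `|dot x (h j)| <= NE x.
Proof.
move=> jj0; rewrite /NE le_max; apply/orP; right; rewrite ler_pM2l//.
exact: (le_bigmax_cond _ (fun j => `|dot x (h j)|)).
Qed.

Lemma NEge0 x : 0 <= NE x.
Proof. by apply: le_trans (NEl1 x); exact: sumr_ge0. Qed.

Lemma dotZl (I : finType) a (x y : I -> R) : dot (fun i => a * x i) y = a * dot x y.
Proof. by rewrite /dot big_distrr/=; apply: eq_bigr => i _; rewrite mulrA. Qed.

Lemma dotDl (I : finType) (x x' y : I -> R) : dot (fun i => x i + x' i) y = dot x y + dot x' y.
Proof. by rewrite /dot -big_split/=; apply: eq_bigr => i _; rewrite mulrDl. Qed.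

Lemma NED x y : NE (fun i => x i + y i) <= NE x + NE y.
Proof.
apply: NE_le; first by rewrite addr_ge0 ?NEge0.
  by apply: le_trans (lerD (NEl1 x) (NEl1 y)); rewrite -big_split/= ler_sum// => i _; exact: ler_normD.
move=> j jj0; apply: le_trans (lerD (NEh x jj0) (NEh y jj0)).
by rewrite -mulrDr ler_pM2l// dotDl ler_normD.
Qed.

Lemma NEZ a x : NE (fun i => a * x i) = `|a| * NE x.
Proof.
rewrite /NE maxr_pMr// big_distrr/=; congr Num.max.
  by apply: eq_bigr => i _; rewrite normrM.
rewrite mulrCA (big_morph _ (fun y z => maxr_pMr y z (normr_ge0 a)) (mulr0 _)).
by congr (_ * _); apply: eq_bigr => j _; rewrite dotZl normrM.
Qed.

Lemma NE0 : NE (fun=> 0) = 0.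
Proof.
rewrite (_ : (fun=> 0) = fun i : P => 0 * (0 : R)); first by rewrite NEZ normr0 mul0r.
by apply/funext => i; rewrite mul0r.
Qed.

Lemma NEK x : NE x <= 2 * lam * \sum_i `|x i|.
Proof.
apply: NE_le; first by rewrite mulr_ge0 ?sumr_ge0// mulr_ge0// ltW.
  by rewrite ler_peMl ?sumr_ge0//; have := lam1; lra.
move=> j _; rewrite -mulrA mulrCA ler_pM2l// big_distrr/=.
apply: le_trans (ler_norm_sum _ _ _) _; apply: ler_sum => i _.
by rewrite normrM mulrC ler_wpM2r.
Qed.

Lemma parseval (c : P -> R) : \sum_i (\sum_j c j * h j i) ^+ 2 = p ^+ 2 * \sum_j c j ^+ 2.
Proof.
transitivity (\sum_j \sum_j' c j * c j' * \sum_i h j i * h j' i).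
  under [RHS]eq_bigr => j _.
    under eq_bigr do rewrite big_distrr/=.
    rewrite exchange_big/=; over.
  rewrite exchange_big/=; apply: eq_bigr => i _.
  rewrite expr2 big_distrl/=; apply: eq_bigr => j _.
  by rewrite big_distrr/=; apply: eq_bigr => j' _; ring.
rewrite big_distrr/=; apply: eq_bigr => j _.
under eq_bigr do rewrite h_orthr.
rewrite (bigD1 j)//= eqxx mulr1 big1 ?addr0; first by ring.
by move=> j' /negbTE jj; rewrite eq_sym jj !mulr0.
Qed.

Lemma l1_le (x : P -> R) : \sum_i `|x i| <= p * nrm2 x.
Proof.
under eq_bigr do rewrite -sgn_lt0.
apply: le_trans (dot_le (fun i => sgn R (x i < 0)) x) _.
rewrite ler_wpM2r ?nrm2_ge0//; apply: nrm2_le; first exact: ltW.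
under eq_bigr do rewrite -real_normK ?num_real// sgn_norm expr1n.
by rewrite sumr_const card_prod natrM expr2.
Qed.

Lemma hartley_inv (x : P -> R) i : x i = p ^- 2 * \sum_j dot x (h j) * h j i.
Proof.
have -> : \sum_j dot x (h j) * h j i = p ^+ 2 * x i.
  under eq_bigr do rewrite /dot big_distrl/=.
  rewrite exchange_big/=.
  under eq_bigr => k _.
    under eq_bigr do rewrite -mulrA.
    rewrite -big_distrr/= h_orthl; over.
  rewrite (bigD1 i)//= eqxx mulr1 big1 ?addr0; first by rewrite mulrC.
  by move=> k /negbTE ki; rewrite ki !mulr0.
by rewrite mulKf// gt_eqF.
Qed.

Definition sf f (i : P) : R := (i.2 == ev f i.1)%:R / p.

Lemma sum_on (a : P -> R) f : \sum_i (i.2 == ev f i.1)%:R * a i = \sum_x a (x, ev f x).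
Proof.
rewrite sum_pair/=; apply: eq_bigr => x _.
by rewrite (sum_delta (fun y => a (x, y))).
Qed.

Lemma sum_sf a f : \sum_i sf f i * a i = p^-1 * \sum_x a (x, ev f x).
Proof. by rewrite -sum_on big_distrr/=; apply: eq_bigr => i _; rewrite /sf; ring. Qed.

Lemma sf_ge0 f i : 0 <= sf f i.
Proof. by rewrite /sf divr_ge0 ?ler0n. Qed.

Lemma sum_sf1 f : \sum_i sf f i = 1.
Proof.
under eq_bigr do rewrite -[sf _ _]mulr1.
by rewrite (sum_sf (fun=> 1)) sumr_const mulVf.
Qed.

Lemma sf_l1 f : \sum_i `|sf f i| = 1.
Proof. by under eq_bigr do rewrite ger0_norm ?sf_ge0//; exact: sum_sf1. Qed.

Context (good : pred F).
Hypothesis sf_h : forall f j, good f -> j != j0 -> lam * `|dot (sf f) (h j)| <= 1.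
Hypothesis ev_int : forall f g, f != g -> (#|[set x | ev f x == ev g x]| <= 2)%N.

Lemma NE_sf f : good f -> NE (sf f) <= 1.
Proof. by move=> gf; apply: NE_le => //; [rewrite sf_l1|move=> j jj; exact: sf_h]. Qed.

Lemma int_le f g : f != g -> \sum_x (ev f x == ev g x)%:R <= 2 :> R.
Proof.
move=> fg; rewrite (_ : \sum_x _ = #|[set x | ev f x == ev g x]|%:R).
  by rewrite (ler_nat R _ 2) ev_int.
rewrite -sum1_card natr_sum [RHS]big_mkcond/=; apply: eq_bigr => x _.
by rewrite inE; case: eqP.
Qed.

(** * Decomposition of a summing operator for N *)

Section Decomp.
Context (J : finType) (A : P -> J -> R).
Hypothesis As : summing (fun=> True) NE A 1.

Let Ah j := app A (h j).
Let b j := nrm2 (Ah j).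
Let b0 j : 0 <= b j. Proof. exact: nrm2_ge0. Qed.

(* The family w_j h_j is tested in the summing inequality; its signed sums are controlled by
   Parseval and by orthogonality. *)
Lemma test_le (w : P -> R) B : (forall j, 0 <= w j) -> w j0 = 0 ->
  p ^+ 2 * nrm2 w <= B -> (forall j, lam * (p ^+ 2 * w j) <= B) ->
  \sum_j w j * b j <= B.
Proof.
move=> w0 wj0 h1 h2.
have B0 : 0 <= B by apply: le_trans h1; rewrite mulr_ge0 ?nrm2_ge0// ltW.
have hB (s : P -> bool) : NE (fun i => \sum_j sgn R (s j) * (w j * h j i)) <= B.
  pose c j := sgn R (s j) * w j.
  have cE i : \sum_j sgn R (s j) * (w j * h j i) = \sum_j c j * h j i.
    by apply: eq_bigr => j _; rewrite mulrA.
  rewrite (_ : (fun i => _) = (fun i => \sum_j c j * h j i)); last exact/funext.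
  apply: NE_le => //.
    apply: le_trans (l1_le _) (le_trans _ h1).
    rewrite expr2 -mulrA ler_pM2l//; apply: nrm2_le.
      by rewrite mulr_ge0 ?nrm2_ge0// ltW.
    rewrite parseval exprMn nrm2_sqr ler_pM2l//; apply: ler_sum => j _.
    by rewrite exprMn -real_normK ?num_real// sgn_norm expr1n mul1r.
  move=> j jj0; rewrite dot_suml.
  rewrite (_ : \sum_k _ = c j * p ^+ 2).
    by rewrite normrM (gtr0_norm p2) normrM sgn_norm mul1r (ger0_norm (w0 j)) mulrC [w j * _]mulrC mulrC h2.
  rewrite (bigD1 j)//= /dot h_orthr eqxx mulr1 big1 ?addr0// => k /negbTE kj.
  by rewrite h_orthr kj !mulr0.
have := As (fun=> Logic.I) hB; rewrite mul1r; apply: le_trans.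
apply: ler_sum => j _.
rewrite (eq_nrm2 (y := fun t => w j * Ah j t)) ?nrm2Z ?ger0_norm// => t.
by rewrite /Ah -appZ.
Qed.

Lemma single_le x : nrm2 (app A x) <= NE x.
Proof.
have hB (s : unit -> bool) : NE (fun i => \sum_k sgn R (s k) * x i) <= NE x.
  rewrite (_ : (fun i => _) = fun i => sgn R (s tt) * x i).
    by rewrite NEZ sgn_norm mul1r.
  by apply/funext => i; rewrite sum_unit.
by have := @As unit (fun=> x) _ (fun=> Logic.I) hB; rewrite sum_unit mul1r.
Qed.

(** At the threshold p^2 / lam the two conditions of [test_le] balance: there are few coefficients
    above it, and those below are square summable. *)
Let Jb j := (j != j0) && (p ^+ 2 / lam < b j).
Let Gd j := (j != j0) && (b j <= p ^+ 2 / lam).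

(** The test is the indicator of the large coefficients. Were there more than lam^2 of them,
    [test_le] with bound p^2 N would contradict that each exceeds p^2 / lam. *)
Lemma sum_Jb : \sum_(j | Jb j) b j <= lam * p ^+ 2.
Proof.
pose w j : R := (Jb j)%:R.
have wE : \sum_(j | Jb j) b j = \sum_j w j * b j.
  rewrite big_mkcond; apply: eq_bigr => j _.
  by rewrite /w; case: (Jb j); rewrite ?mul1r ?mul0r.
have w0 j : 0 <= w j by rewrite ler0n.
have wj0 : w j0 = 0 by rewrite /w /Jb eqxx.
pose N := nrm2 w.
have N0 : 0 <= N := nrm2_ge0 _.
have N2 : N ^+ 2 = \sum_j w j.
  by rewrite nrm2_sqr; apply: eq_bigr => j _; rewrite /w; case: (Jb j); rewrite ?expr1n ?expr0n.
have lower : N ^+ 2 * (p ^+ 2 / lam) <= \sum_j w j * b j.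
  rewrite N2 big_distrl/=; apply: ler_sum => j _.
  rewrite /w /Jb; case: (j == j0) => /=; rewrite ?mul0r//.
  have [hj|hj] := ltP (p ^+ 2 / lam) (b j); last by rewrite !mul0r.
  by rewrite !mul1r ltW.
have w1 j : w j <= 1 by rewrite /w; case: (Jb j).
have [Nl|Nl] := leP N lam.
  rewrite wE mulrC; apply: test_le => //; first by rewrite ler_pM2l.
  by move=> j; rewrite [leRHS]mulrC ler_pM2l// ler_piMr// ltW.
exfalso.
have : \sum_j w j * b j < N ^+ 2 * (p ^+ 2 / lam).
  apply: (@le_lt_trans _ _ (p ^+ 2 * N)).
    apply: test_le => // j; rewrite mulrC -mulrA ler_pM2l//.
    apply: le_trans (_ : lam <= N); last exact: ltW.
    by rewrite ler_piMl// ltW.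
  rewrite mulrCA ltr_pM2l// expr2 -mulrA -[ltLHS]mulr1 ltr_pM2l ?ltr_pdivlMr ?mul1r//.
  exact: lt_trans Nl.
by rewrite ltNge lower.
Qed.

(** The small coefficients are tested against themselves: the sum is then |w|_2^2, and the bound p^2
    |w|_2 yields |w|_2 <= p^2. Their smallness takes care of the other condition of [test_le]. *)
Lemma sum_Gd : \sum_(j | Gd j) b j ^+ 2 <= (p ^+ 2) ^+ 2.
Proof.
pose w j : R := if Gd j then b j else 0.
have wE : \sum_(j | Gd j) b j ^+ 2 = \sum_j w j * b j.
  by rewrite big_mkcond; apply: eq_bigr => j _; rewrite /w; case: (Gd j); rewrite ?mul0r ?expr2.
have w0 j : 0 <= w j by rewrite /w; case: (Gd j).
have wj0 : w j0 = 0 by rewrite /w /Gd eqxx.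
have wN : \sum_j w j * b j = nrm2 w ^+ 2.
  rewrite nrm2_sqr; apply: eq_bigr => j _.
  by rewrite /w; case: (Gd j); rewrite ?mul0r expr2 ?mul0r.
have wl j : lam * (p ^+ 2 * w j) <= (p ^+ 2) ^+ 2.
  rewrite /w /Gd; case: (j == j0) => /=; first by rewrite !mulr0 sqr_ge0.
  have [hj|hj] := leP (b j) (p ^+ 2 / lam); last by rewrite !mulr0 sqr_ge0.
  by rewrite mulrCA expr2 ler_pM2l// mulrC -ler_pdivlMr.
rewrite wE; have [Nl|Nl] := leP (nrm2 w) (p ^+ 2).
  by apply: test_le => //; rewrite expr2 ler_pM2l.
have : nrm2 w ^+ 2 <= p ^+ 2 * nrm2 w.
  rewrite -{1}wN; apply: test_le => // j; apply: le_trans (wl j) _.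
  by rewrite expr2 ler_pM2l// ltW.
by rewrite expr2 ler_pM2r ?(lt_trans p2)// leNgt Nl.
Qed.

Lemma b_j0 : b j0 <= p ^+ 2.
Proof.
apply: le_trans (single_le _) _; apply: NE_le; first exact: ltW.
  under eq_bigr do rewrite h_j0 normr1.
  by rewrite sumr_const card_prod natrM expr2.
move=> j /negbTE jj0; rewrite /dot h_orthr eq_sym jj0 mulr0 normr0 mulr0.
exact: ltW.
Qed.

Let Hb j := (j == j0) || Jb j.

Let Gd_Hb j : Gd j = ~~ Hb j.
Proof. by rewrite /Gd /Hb /Jb negb_or negb_and negbK -leNgt; case: (j == j0). Qed.

(** The part of [A] carried by the small coefficients. By Parseval its rows, of norm [a i], have
    mean square at most 1 over the p^2 points; see [sum_a2]. *)
Let V1 i t := p ^- 2 * \sum_(j | Gd j) h j i * Ah j t.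
Let a i := nrm2 (V1 i).
Let a0 i : 0 <= a i. Proof. exact: nrm2_ge0. Qed.
Let hcost x := \sum_(j | Hb j) `|dot x (h j)| / p ^+ 2 * b j.

Lemma app_split x t :
  app A x t = \sum_(j | Hb j) dot x (h j) / p ^+ 2 * Ah j t + app V1 x t.
Proof.
have -> : app A x t = \sum_j dot x (h j) / p ^+ 2 * Ah j t.
  rewrite -app_suml; congr app; apply/funext => i.
  rewrite [LHS]hartley_inv big_distrr/=; apply: eq_bigr => j _; ring.
rewrite (bigID Hb)/=; congr (_ + _).
under eq_bigl do rewrite -Gd_Hb.
rewrite /app; under [RHS]eq_bigr do rewrite /V1 mulrA big_distrr/=.
rewrite exchange_big/=; apply: eq_bigr => j _.
by rewrite /dot !big_distrl/=; apply: eq_bigr => i _; ring.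
Qed.

Lemma hcost_le x u v : 0 <= u -> 0 <= v -> `|dot x (h j0)| <= u ->
  (forall j, j != j0 -> `|dot x (h j)| <= v) -> hcost x <= u + v * lam.
Proof.
move=> u0 v0 hu hv; rewrite /hcost (bigD1 j0)/=; last by rewrite /Hb eqxx.
apply: lerD.
  apply: (@le_trans _ _ (u / p ^+ 2 * p ^+ 2)); last by rewrite divfK// gt_eqF.
  by apply: ler_pM => //; [rewrite divr_ge0// ltW|rewrite ler_pM2r ?invr_gt0|exact: b_j0].
apply: (@le_trans _ _ (\sum_(j | Jb j) v / p ^+ 2 * b j)).
  rewrite big_mkcond [leRHS]big_mkcond/=; apply: ler_sum => j _.
  rewrite /Hb /Jb; case: eqP => //= /eqP jj0; rewrite andbT; case: ifP => // _.
  by rewrite ler_wpM2r// ler_pM2r ?invr_gt0// hv.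
rewrite -big_distrr/= -mulrA ler_wpM2l//.
by rewrite mulrC ler_pdivrMr//; exact: sum_Jb.
Qed.

Let dl (i : P) : P -> R := fun i' => (i' == i)%:R.

Lemma dot_dl i y : dot (dl i) y = y i.
Proof. exact: sum_delta. Qed.

Lemma hcost_sf f : good f -> hcost (sf f) <= 2.
Proof.
move=> gf; apply: le_trans (_ : 1 + lam^-1 * lam <= 2); last first.
  by rewrite mulVf ?gt_eqF.
apply: hcost_le => //; first by rewrite invr_ge0 ltW.
  by rewrite /dot; under eq_bigr do rewrite h_j0 mulr1; rewrite sum_sf1 normr1.
by move=> j jj0; rewrite -[leRHS]mulr1 ler_pdivlMl//; exact: sf_h.
Qed.

Lemma hcost_dl i : hcost (dl i) <= 3 * lam.
Proof.
apply: le_trans (_ : 1 + 2 * lam <= _); last by have := lam1; lra.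
apply: hcost_le => //; first by rewrite dot_dl h_j0 normr1.
by move=> j _; rewrite dot_dl.
Qed.

Lemma V1_le x : nrm2 (app V1 x) <= NE x + hcost x.
Proof.
apply: le_trans (_ : nrm2 (app A x) + hcost x <= _); last by rewrite lerD2r single_le.
rewrite (eq_nrm2 (y := fun t => app A x t + \sum_j (if Hb j then - (dot x (h j) / p ^+ 2) else 0) * Ah j t)).
  apply: le_trans (nrm2D _ _) _; rewrite lerD2l; apply: le_trans (nrm2_sum _) _.
  rewrite /hcost [leRHS]big_mkcond; apply: ler_sum => j _.
  rewrite nrm2Z; case: ifP => _; last by rewrite normr0 mul0r.
  by rewrite normrN normrM (gtr0_norm (x := _^-1)) ?invr_gt0.
move=> t; rewrite app_split big_mkcond/= addrAC -big_split/= big1 ?add0r// => j _.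
by case: ifP => _; ring.
Qed.

Lemma nrm2_V1_dl i : nrm2 (app V1 (dl i)) = a i.
Proof. by apply: eq_nrm2 => t; rewrite app_delta. Qed.

Lemma a_le i : a i <= 5 * lam.
Proof.
rewrite -nrm2_V1_dl; apply: le_trans (V1_le _) _.
apply: le_trans (lerD (NEK _) (hcost_dl i)) _.
rewrite (_ : \sum_i0 _ = 1); first by lra.
rewrite -[RHS](sum_delta (fun=> 1) i); apply: eq_bigr => i' _.
by rewrite /dl normr_nat mulr1.
Qed.

Lemma sum_a2 : \sum_i a i ^+ 2 <= p ^+ 2.
Proof.
have -> : \sum_i a i ^+ 2 = p ^- 2 * \sum_(j | Gd j) b j ^+ 2.
  under eq_bigr do rewrite nrm2_sqr.
  rewrite exchange_big/=.
  under [in RHS]eq_bigr do rewrite nrm2_sqr.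
  rewrite [in RHS]exchange_big/= big_distrr/=; apply: eq_bigr => t _.
  pose c j := if Gd j then p ^- 2 * Ah j t else 0.
  transitivity (p ^+ 2 * \sum_j c j ^+ 2).
    rewrite -parseval; apply: eq_bigr => i _; congr (_ ^+ 2).
    rewrite /V1 big_mkcond big_distrr/=; apply: eq_bigr => j _.
    by rewrite /c; case: ifP => _; ring.
  rewrite [in RHS]big_mkcond !big_distrr/=; apply: eq_bigr => j _.
  rewrite /c; case: ifP => _; last by rewrite expr0n/= !mulr0.
  by field.
by rewrite ler_pdivrMl// -expr2; exact: sum_Gd.
Qed.

Let gs f := \sum_x a (x, ev f x).
(* A good f is bad when V1 is too large, on average, at the points of its graph; there V1 is
   evaluated at sf f as a whole, by means of a functional cb f living on the points of the graph
   that lie on at most 4 bad graphs. *)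
Let bad f := good f && (2 * p < gs f).
Let on f (i : P) : R := (i.2 == ev f i.1)%:R.
Let d i := \sum_(f | bad f) on f i.
Let r : R := #|bad|%:R.

Let d_ge0 i : 0 <= d i. Proof. by apply: sumr_ge0. Qed.
Let r_ge0 : 0 <= r. Proof. by rewrite ler0n. Qed.

Lemma sum_d f : bad f -> \sum_x d (x, ev f x) <= p + 2 * r.
Proof.
move=> bf; rewrite /d exchange_big/= (bigD1 f)//=; apply: lerD.
  by rewrite /on/=; under eq_bigr do rewrite eqxx; rewrite sumr_const.
apply: (@le_trans _ _ (\sum_(g | bad g) 2)); last by rewrite sumr_const -[leLHS]mulr_natr.
rewrite [leRHS](bigD1 f)//= -[leLHS]add0r lerD// ler_sum// => g /andP[_ gf].
by rewrite /on/=; apply: int_le; rewrite eq_sym.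
Qed.

(** Cauchy-Schwarz for the multiplicity [d] against the row norms [a]. The second moment of [d]
    counts the incidences of pairs of bad graphs, and distinct graphs share at most 2 points. *)
Lemma sum_gs_sqr : (\sum_(f | bad f) gs f) ^+ 2 <= r * (p + 2 * r) * p ^+ 2.
Proof.
have -> : \sum_(f | bad f) gs f = dot d a.
  rewrite /dot /d; under [RHS]eq_bigr do rewrite big_distrl/=.
  by rewrite [RHS]exchange_big/=; apply: eq_bigr => f _; rewrite /on sum_on.
apply: le_trans (_ : (nrm2 d * nrm2 a) ^+ 2 <= _).
  rewrite lerXn2r ?nnegrE ?mulr_ge0 ?nrm2_ge0 ?dot_le//.
  by apply: sumr_ge0 => i _; rewrite mulr_ge0.
rewrite exprMn; apply: ler_pM; rewrite ?sqr_ge0// nrm2_sqr; last exact: sum_a2.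
have -> : \sum_i d i ^+ 2 = \sum_(f | bad f) \sum_x d (x, ev f x).
  under [RHS]eq_bigr do rewrite -sum_on.
  rewrite [RHS]exchange_big/=; apply: eq_bigr => i _.
  by rewrite -big_distrl/= expr2.
apply: (@le_trans _ _ (\sum_(f | bad f) (p + 2 * r))).
  by apply: ler_sum => f; exact: sum_d.
by rewrite sumr_const -[leLHS]mulr_natl.
Qed.

(** Each bad graph contributes more than 2 p, so (2 p r)^2 <= r (p + 2 r) p^2, that is 4 r <= p + 2
    r. The factor 2 in [bad] makes this close. *)
Lemma r_le : 2 * r <= p.
Proof.
have : (r * (2 * p)) ^+ 2 <= (\sum_(f | bad f) gs f) ^+ 2.
  rewrite lerXn2r ?nnegrE ?mulr_ge0//; try exact: ltW.
    by apply: sumr_ge0 => f _; apply: sumr_ge0.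
  apply: (@le_trans _ _ (\sum_(f | bad f) (2 * p))).
    by rewrite sumr_const -[leRHS]mulr_natl.
  by apply: ler_sum => f /andP[_ /ltW].
move=> /le_trans/(_ sum_gs_sqr).
rewrite (_ : (r * (2 * p)) ^+ 2 = r * (4 * r) * p ^+ 2); last by ring.
rewrite ler_pM2r//; have [->|r0] := eqVneq r 0; first by move=> _; rewrite mulr0 ltW.
by rewrite ler_pM2l ?lt_def ?r0//; lra.
Qed.

Lemma sum_gs : \sum_(f | bad f) gs f <= p ^+ 2.
Proof.
rewrite -(ler_pXn2r (ltn0Sn 1)) ?nnegrE ?sqr_ge0//; last first.
  by apply: sumr_ge0 => f _; apply: sumr_ge0.
apply: le_trans sum_gs_sqr _; rewrite [leRHS]expr2 ler_pM2r//.
have := r_le; have := r_ge0; have := p0; nra.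
Qed.

Let low i := d i <= 4.
Let K f : R := \sum_x (low (x, ev f x))%:R.

(** Along a bad graph [d] has mean at most 2, by [sum_d] and [r_le]; by Markov it is at most 4 on
    half of the points. *)
Lemma K_ge f : bad f -> p <= 2 * K f.
Proof.
move=> bf; have h1 := sum_d bf; have h2 := r_le.
suff : 4 * (p - K f) <= \sum_x d (x, ev f x) by lra.
have -> : p - K f = \sum_x (1 - (low (x, ev f x))%:R).
  by rewrite sumrB sumr_const.
rewrite big_distrr/=; apply: ler_sum => x _.
rewrite /low; have [_|/ltW] := leP (d (x, ev f x)) 4; first by rewrite subrr mulr0.
by rewrite subr0 mulr1.
Qed.

(** Normalized to take the value 1 at [sf f]. At any other [sf] the value is at most 4 / p, from two
    common points and K >= p / 2. *)
Let cb f i := (bad f)%:R * on f i * (low i)%:R * (p / K f).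

Lemma cb_ge0 f i : 0 <= cb f i.
Proof.
rewrite /cb; have [bf|_] := boolP (bad f); last by rewrite !mul0r.
rewrite !mulr_ge0// ?ltW// invr_gt0.
have := K_ge bf; have := p0; lra.
Qed.

Lemma dot_sf_cb f g : bad g -> dot (sf f) (cb g) =
  (\sum_x (ev f x == ev g x)%:R * (low (x, ev f x))%:R) / K g.
Proof.
move=> bg; rewrite /dot sum_sf big_distrl/= big_distrr/=; apply: eq_bigr => x _.
by rewrite /cb bg /on/= mul1r; move: (K g)^-1 => k; field.
Qed.

Lemma K_gt0 f : bad f -> 0 < K f.
Proof. by move=> bf; have := K_ge bf; have := p0; lra. Qed.

Lemma dot_sf_cb_self f : bad f -> dot (sf f) (cb f) = 1.
Proof.
move=> bf; rewrite dot_sf_cb//; under eq_bigr do rewrite eqxx mul1r.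
by rewrite -/(K f) divff// gt_eqF// K_gt0.
Qed.

Lemma dot_sf_cb_ge0 f g : 0 <= dot (sf f) (cb g).
Proof. by apply: sumr_ge0 => i _; rewrite mulr_ge0 ?sf_ge0 ?cb_ge0. Qed.

Lemma dot_sf_cb_le f g : bad g -> f != g -> dot (sf f) (cb g) <= 4 / p.
Proof.
move=> bg fg; rewrite dot_sf_cb// ler_pdivrMr ?K_gt0//.
apply: (@le_trans _ _ 2).
  apply: le_trans (int_le fg); apply: ler_sum => x _.
  by rewrite ler_piMr ?ler0n// lern1 leq_b1.
by rewrite mulrAC ler_pdivlMr//; have := K_ge bg; lra.
Qed.

(** At most 4 bad graphs pass through a low point, each with weight p / K <= 2. *)
Lemma sum_cb i : \sum_g cb g i <= 8.
Proof.
apply: (@le_trans _ _ (\sum_g (bad g)%:R * on g i * (low i)%:R * 2)).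
  apply: ler_sum => g _; rewrite /cb; have [bg|_] := boolP (bad g); last by rewrite !mul0r.
  rewrite ler_wpM2l ?mulr_ge0 ?ler0n//.
  by rewrite ler_pdivrMr ?K_gt0// K_ge.
rewrite -!big_distrl/=.
have -> : \sum_g (bad g)%:R * on g i = d i.
  by rewrite /d [RHS]big_mkcond; apply: eq_bigr => g _; case: ifP; rewrite ?mul1r ?mul0r.
rewrite /low; have [h4|_] := boolP (d i <= 4); last by rewrite mulr0 mul0r.
by rewrite mulr1; lra.
Qed.

(** Coordinate [i] of what is left of x after its components [cb g] along the [sf g] are removed. *)
Let lr i (i' : P) : R := (i' == i)%:R - \sum_g cb g i' * sf g i.

Lemma dot_lr x i : dot x (lr i) = x i - \sum_g dot x (cb g) * sf g i.
Proof.
rewrite /dot /lr; under eq_bigr do rewrite mulrBr.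
rewrite sumrB; congr (_ - _).
  by under eq_bigr do rewrite mulrC; exact: sum_delta.
under [RHS]eq_bigr do rewrite big_distrl/=.
rewrite [RHS]exchange_big/=; apply: eq_bigr => k _.
by rewrite big_distrr/=; apply: eq_bigr => g _; rewrite mulrA.
Qed.

Lemma nv_le g : good g -> nrm2 (app V1 (sf g)) <= 3.
Proof.
move=> gg; apply: le_trans (V1_le _) _.
apply: le_trans (lerD (NE_sf gg) (hcost_sf gg)) _; lra.
Qed.

Lemma sum_lr_le x (u : F -> R) (t : P -> R) : (forall g, 0 <= u g) ->
  (forall i, `|dot x (lr i)| <= t i + \sum_(g | bad g) u g * sf g i) ->
  \sum_i `|dot x (lr i)| * a i <= \sum_i t i * a i + \sum_(g | bad g) u g * (p^-1 * gs g).
Proof.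
move=> u0 xl.
apply: (@le_trans _ _ (\sum_i (t i + \sum_(g | bad g) u g * sf g i) * a i)).
  by apply: ler_sum => i _; rewrite ler_wpM2r.
under eq_bigr do rewrite mulrDl big_distrl/=.
rewrite big_split/= lerD2l exchange_big/=; apply: ler_sum => g _.
by rewrite -sum_sf big_distrr/=; apply: ler_sum => i _; rewrite mulrA.
Qed.

(** Large coefficients are treated one by one, bad graphs through the whole vector [sf g], on which
    [V1] has norm at most 3, and the rest point by point, which is cheap along graphs that are not
    bad. *)
Theorem level_decomposition : exists (M : finType) (l : M -> P -> R) (y : M -> J -> R),
  [/\ decomposes (fun=> True) A l y,
      forall f, good f -> cost l y (sf f) <= 17 &
      forall i, cost l y (fun i' => (i' == i)%:R) <= 72 * lam].
Proof.
exists (P + (F + P))%type.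
exists (fun m => match m with
  | inl j => fun i => if Hb j then h j i / p ^+ 2 else 0
  | inr (inl g) => cb g
  | inr (inr i) => lr i end).
exists (fun m => match m with
  | inl j => Ah j
  | inr (inl g) => app V1 (sf g)
  | inr (inr i) => V1 i end).
have dotH x j : dot x (fun i => if Hb j then h j i / p ^+ 2 else 0) =
    if Hb j then dot x (h j) / p ^+ 2 else 0.
  case: ifP => _; last by rewrite /dot big1// => i _; rewrite mulr0.
  by rewrite /dot big_distrl/=; apply: eq_bigr => i _; rewrite mulrA.
have costE x : cost (fun m => match m with
    | inl j => fun i => if Hb j then h j i / p ^+ 2 else 0
    | inr (inl g) => cb g | inr (inr i) => lr i end)
  (fun m => match m with
    | inl j => Ah j | inr (inl g) => app V1 (sf g) | inr (inr i) => V1 i end) x =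
  hcost x + (\sum_g `|dot x (cb g)| * nrm2 (app V1 (sf g)) + \sum_i `|dot x (lr i)| * a i).
  rewrite /cost !sum_sumType/=; congr (_ + _).
  rewrite /hcost [RHS]big_mkcond; apply: eq_bigr => j _; rewrite dotH.
  case: ifP => _; last by rewrite normr0 mul0r.
  by rewrite normrM (gtr0_norm (x := _^-1)) ?invr_gt0.
split.
- move=> x _ t; rewrite app_split !sum_sumType/=; congr (_ + _).
    rewrite big_mkcond; apply: eq_bigr => j _; rewrite dotH.
    by case: ifP => _; rewrite ?mul0r.
  have -> : app V1 x t = app V1 (fun i => \sum_g dot x (cb g) * sf g i + dot x (lr i)) t.
    by congr app; apply/funext => i; rewrite dot_lr addrC subrK.
  by rewrite appD app_suml.
(* Here 2 is [hcost]; 9 = 3 + 6 comes from [cb f] and from r terms of size 12 / p with 2 r <= p; 6 =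
   2 + 4 is the pointwise rest, 2 along [f] itself if it is not bad and 4 / p^2 times [sum_gs]. *)
- move=> f gf; rewrite costE (_ : 17 = 2 + (9 + 6)); last by ring.
  apply: lerD (hcost_sf gf) _; apply: lerD.
    apply: (@le_trans _ _ (\sum_g ((g == f)%:R * 3 + (bad g)%:R * (12 / p)))).
      apply: ler_sum => g _; have [bg|nbg] := boolP (bad g); last first.
        rewrite (_ : dot _ _ = 0) ?normr0 ?mul0r ?addr0 ?mulr_ge0//.
        by rewrite /dot big1// => i _; rewrite /cb (negbTE nbg) !mul0r mulr0.
      have nvg : nrm2 (app V1 (sf g)) <= 3 by apply: nv_le; case/andP: bg.
      rewrite ger0_norm ?dot_sf_cb_ge0// mul1r.
      have [gE|gf'] := eqVneq g f.
        rewrite gE in bg nvg *; rewrite dot_sf_cb_self// !mul1r.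
        by apply: le_trans nvg _; rewrite lerDl divr_ge0// ltW.
      rewrite mul0r add0r (_ : 12 / p = 4 / p * 3); last by field.
      by apply: ler_pM; rewrite ?dot_sf_cb_ge0 ?nrm2_ge0// dot_sf_cb_le// eq_sym.
    rewrite big_split/= (sum_delta (fun=> 3)) -big_distrl/=.
    have -> : \sum_g (bad g)%:R = r.
      by rewrite /r -sum1_card natr_sum [RHS]big_mkcond; apply: eq_bigr => g _; rewrite -[g \in bad]/(bad g); case: (bad g).
    have -> : 9 = 3 + 6 :> R by ring.
    rewrite lerD2l mulrA ler_pdivrMr//; have := r_le; lra.
  pose t i := if bad f then 0 else sf f i.
  apply: le_trans (sum_lr_le (u := fun=> 4 / p) (t := t) _ _) _.
  + by move=> _; rewrite divr_ge0// ltW.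
  + move=> i; rewrite dot_lr.
    have sub g : (bad g) && (g != f) -> `|dot (sf f) (cb g) * sf g i| <= 4 / p * sf g i.
      move=> /andP[bg gf']; rewrite normrM !ger0_norm ?sf_ge0 ?dot_sf_cb_ge0//.
      by rewrite ler_wpM2r ?sf_ge0// dot_sf_cb_le// eq_sym.
    have zero g : ~~ bad g -> dot (sf f) (cb g) * sf g i = 0.
      move=> nbg; rewrite /dot big1 ?mul0r// => k _.
      by rewrite /cb (negbTE nbg) !mul0r mulr0.
    have -> : \sum_g dot (sf f) (cb g) * sf g i =
        \sum_(g | bad g) dot (sf f) (cb g) * sf g i.
      rewrite [RHS]big_mkcond; apply: eq_bigr => g _.
      by case: ifP => // /negbT/zero.
    rewrite /t; have [bf|nbf] := boolP (bad f).
      (* For bad [f] the term g = f cancels [sf f] exactly, and only cross terms of size 4 / p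
         survive. *)
      rewrite (bigD1 f)//= dot_sf_cb_self// mul1r opprD addrA subrr !add0r normrN.
      apply: le_trans (ler_norm_sum _ _ _) _.
      rewrite [leRHS](bigD1 f)//= -[leLHS]add0r lerD//; last by apply: ler_sum => g; exact: sub.
      by rewrite mulr_ge0 ?sf_ge0// divr_ge0// ltW.
    apply: le_trans (ler_normB _ _) _; rewrite ger0_norm ?sf_ge0// lerD2l.
    apply: le_trans (ler_norm_sum _ _ _) _; apply: ler_sum => g bg; apply: sub.
    by rewrite bg/=; apply: contraNneq nbf => <-.
  have -> : 6 = 2 + 4 :> R by ring.
  apply: lerD.
    rewrite /t; have [bf|nbf] := boolP (bad f).
      by rewrite big1// => i _; rewrite mul0r.
    rewrite sum_sf ler_pdivrMl// mulrC.
    by move: nbf; rewrite /bad gf/= -leNgt.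
  rewrite -big_distrr/= -big_distrr/= mulrA.
  rewrite (_ : 4 / p / p = 4 / p ^+ 2); last by field.
  rewrite mulrAC ler_pdivrMr// ler_pM2l//; exact: sum_gs.
- move=> i; rewrite costE -/(dl i).
  (* 24 = 8 * 3 by [sum_cb] and [nv_le]; 45 = 5 + 8 * 5 by [a_le], at the point and along the bad
     graphs through it. *)
  apply: (@le_trans _ _ (3 * lam + (24 + 45 * lam))); last by have := lam1; lra.
  apply: lerD (hcost_dl i) _; apply: lerD.
    apply: (@le_trans _ _ (\sum_g cb g i * 3)).
      apply: ler_sum => g _; rewrite dot_dl ger0_norm ?cb_ge0//.
      have [bg|nbg] := boolP (bad g); last by rewrite /cb (negbTE nbg) !mul0r.
      by rewrite ler_wpM2l ?cb_ge0// nv_le//; case/andP: bg.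
    by rewrite -big_distrl/=; have := sum_cb i; lra.
  apply: le_trans (sum_lr_le (u := fun g => cb g i) (t := dl i) _ _) _.
  + by move=> g; exact: cb_ge0.
  + move=> k; rewrite dot_lr; apply: le_trans (ler_normB _ _) _.
    rewrite /dl normr_nat lerD2l; apply: le_trans (ler_norm_sum _ _ _) _.
    rewrite [leRHS]big_mkcond; apply: ler_sum => g _.
    rewrite -/(dl i) dot_dl ger0_norm; last by apply: mulr_ge0; [exact: cb_ge0|exact: sf_ge0].
    by case: ifP => // /negbT nbg; rewrite /cb (negbTE nbg) !mul0r.
  have -> : 45 * lam = 5 * lam + 8 * (5 * lam) by ring.
  apply: lerD; first by apply: le_trans (a_le i); rewrite le_eqVlt (sum_delta a i) eqxx.
  apply: (@le_trans _ _ (\sum_g cb g i * (5 * lam))).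
    rewrite big_mkcond; apply: ler_sum => g _.
    have l5 : 0 <= 5 * lam by rewrite mulr_ge0// ltW.
    case: ifP => _; last by rewrite mulr_ge0 ?cb_ge0.
    rewrite ler_wpM2l ?cb_ge0// ler_pdivrMl//.
    apply: (@le_trans _ _ (\sum_(x : X) 5 * lam)); first by apply: ler_sum => x _; exact: a_le.
    by rewrite sumr_const -[leLHS]mulr_natl.
  rewrite -big_distrl/= ler_wpM2r ?sum_cb//.
  by rewrite mulr_ge0// ltW.
Qed.

End Decomp.
End Level.

(** * The test inequality, by averaging over graphs *)

Section Star.
Context (R : realType) (X F : finType) (lam : R) (ev : F -> X -> X).
Let P : finType := (X * X)%type.
Let p : R := #|X|%:R.
Hypothesis X3 : (2 < #|X|)%N.
Hypothesis lam1 : 1 <= lam.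
Hypothesis lam_p : lam ^+ 4 <= p.
Hypothesis ev_indep : forall x1 x2 x3, x1 != x2 -> x1 != x3 -> x2 != x3 ->
  forall H : X -> X -> X -> R,
  \sum_f H (ev f x1) (ev f x2) (ev f x3) = \sum_a \sum_b \sum_c H a b c.

Let p0 : 0 < p. Proof. by rewrite ltr0n (ltn_trans _ X3). Qed.
Let pn0 : p != 0. Proof. by rewrite gt_eqF. Qed.
Let lam0 : 0 < lam. Proof. exact: lt_le_trans lam1. Qed.

Lemma other_point x1 x2 : exists x3 : X, x1 != x3 /\ x2 != x3.
Proof.
have [x3 _] : exists2 x3, x3 \in [set: X]%SET & x3 \notin [set x1; x2]%SET.
  apply/subsetPn; apply: contraTN X3 => /subset_leq_card.
  by rewrite cardsT -leqNgt => /leq_trans; apply; rewrite cards2; case: (_ != _).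
by rewrite !inE negb_or ![x3 == _]eq_sym => /andP[]; exists x3.
Qed.

Lemma ev_indep2 x1 x2 (H : X -> X -> R) : x1 != x2 ->
  \sum_f H (ev f x1) (ev f x2) = p * \sum_a \sum_b H a b.
Proof.
move=> x12; have [x3 [x13 x23]] := other_point x1 x2.
rewrite (ev_indep x12 x13 x23 (fun a b _ => H a b)) big_distrr/=.
apply: eq_bigr => a _; rewrite big_distrr/=; apply: eq_bigr => b _.
by rewrite sumr_const -[LHS]mulr_natl.
Qed.

Lemma ev_indep1 x1 (H : X -> R) : \sum_f H (ev f x1) = p ^+ 2 * \sum_a H a.
Proof.
have [x2 [x12 _]] := other_point x1 x1.
rewrite (ev_indep2 (fun a _ => H a) x12) expr2 -mulrA; congr (_ * _).
by rewrite big_distrr/=; apply: eq_bigr => a _; rewrite sumr_const -[LHS]mulr_natl.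
Qed.

Context (phi : P -> R).
Hypothesis phi1 : forall i, `|phi i| <= 1.
Hypothesis phi2 : \sum_i phi i ^+ 2 <= lam ^+ 2.

Let M x := p^-1 * \sum_y phi (x, y).
Let psi (i : P) := phi i - M i.1.
(* After centering in y, phi (x, y) is recovered by averaging Psi over the f whose graph contains
   (x, y), since the values of f at distinct points are independent; truncating Psi at level 4
   costs at most the conditional variance of the other terms. *)
Let Psi f := \sum_x psi (x, ev f x).
Let on f (i : P) : R := (i.2 == ev f i.1)%:R.

Let sum_psi x : \sum_y psi (x, y) = 0.
Proof.
by rewrite /psi sumrB/= sumr_const -[X in _ - X]mulr_natl /M mulrA mulfV// mul1r subrr.
Qed.

Let M_sqr x : p * M x ^+ 2 <= \sum_y phi (x, y) ^+ 2.
Proof.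
have : 0 <= \sum_y psi (x, y) ^+ 2 by apply: sumr_ge0 => y _; exact: sqr_ge0.
have -> : \sum_y psi (x, y) ^+ 2 = \sum_y phi (x, y) ^+ 2 - p * M x ^+ 2.
  transitivity (\sum_y (phi (x, y) ^+ 2 - (2 * M x * psi (x, y) + M x ^+ 2))).
    by apply: eq_bigr => y _; rewrite /psi/=; ring.
  rewrite sumrB big_split/= -big_distrr/= sum_psi mulr0 add0r sumr_const.
  by rewrite -[X in _ - X]mulr_natl.
by rewrite subr_ge0.
Qed.

Let psi_sqr x : \sum_y psi (x, y) ^+ 2 <= \sum_y phi (x, y) ^+ 2.
Proof.
have -> : \sum_y psi (x, y) ^+ 2 = \sum_y phi (x, y) ^+ 2 - p * M x ^+ 2.
  transitivity (\sum_y (phi (x, y) ^+ 2 - (2 * M x * psi (x, y) + M x ^+ 2))).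
    by apply: eq_bigr => y _; rewrite /psi/=; ring.
  rewrite sumrB big_split/= -big_distrr/= sum_psi mulr0 add0r sumr_const.
  by rewrite -[X in _ - X]mulr_natl.
by rewrite gerBl mulr_ge0 ?sqr_ge0// ltW.
Qed.

Let lam_le : lam ^+ 2 / p <= lam^-1.
Proof.
rewrite ler_pdivrMr// mulrC ler_pdivlMr// -exprSr.
by apply: le_trans lam_p; rewrite ler_weXn2l.
Qed.

(** From p M^2 <= lam^2 and lam^4 <= p. *)
Let M_le x : `|M x| <= lam^-1.
Proof.
rewrite -(ler_pXn2r (ltn0Sn 1)) ?nnegrE ?invr_ge0 ?(ltW lam0)// real_normK ?num_real//.
have h : p * M x ^+ 2 <= lam ^+ 2.
  apply: le_trans (M_sqr x) (le_trans _ phi2).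
  rewrite [leRHS]sum_pair/= [leRHS](bigD1 x)//= lerDl.
  by apply: sumr_ge0 => x' _; apply: sumr_ge0 => y _; exact: sqr_ge0.
rewrite -(ler_pM2l p0); apply: le_trans h _.
rewrite exprVn ler_pdivlMr ?exprn_gt0// -exprD; exact: lam_p.
Qed.

Let psi_le2 i : `|psi i| <= 2.
Proof.
apply: le_trans (ler_normB _ _) _; rewrite (_ : 2 = 1 + 1)// lerD//.
apply: le_trans (M_le _) _; rewrite invf_le1//.
Qed.

Let on_other i x' : i.1 != x' -> \sum_f on f i * psi (x', ev f x') = 0.
Proof.
move=> xx; rewrite (ev_indep2 (fun a b => (i.2 == a)%:R * psi (x', b)) xx).
under eq_bigr do rewrite -big_distrr/= sum_psi mulr0.
by rewrite big1 ?mulr0.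
Qed.

(** The other abscissas contribute nothing since [psi] is centred in y, and p^2 of the [f] pass
    through [i]. *)
Let on_Psi i : \sum_f on f i * Psi f = p ^+ 2 * psi i.
Proof.
under eq_bigr do rewrite /Psi big_distrr/=.
rewrite exchange_big/= (bigD1 i.1)//= [X in _ + X]big1 ?addr0; last first.
  by move=> x xi; apply: on_other; rewrite eq_sym.
rewrite (ev_indep1 i.1 (fun a => (i.2 == a)%:R * psi (i.1, a))); congr (_ * _).
under eq_bigr do rewrite eq_sym.
by rewrite (sum_delta (fun a => psi (i.1, a))); case: i.
Qed.

Let Xi f x := \sum_(x' | x' != x) psi (x', ev f x').

(** Independence at three points removes the cross terms; the diagonal is bounded by p times the sum
    of phi^2. *)
Let on_Xi i : \sum_f on f i * Xi f i.1 ^+ 2 <= p * lam ^+ 2.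
Proof.
under eq_bigr => f _.
  rewrite expr2 /Xi big_distrl big_distrr/=.
  under eq_bigr do rewrite big_distrr big_distrr/=.
  over.
rewrite exchange_big/=.
apply: (@le_trans _ _ (\sum_(x' | x' != i.1) p * \sum_b psi (x', b) ^+ 2)).
  apply: ler_sum => x' xi; rewrite exchange_big/= (bigD1 x')//= [X in _ + X]big1 ?addr0.
    rewrite (ev_indep2 (fun a b => (i.2 == a)%:R * (psi (x', b) * psi (x', b)))); last by rewrite eq_sym.
    rewrite ler_pM2l//; under [leLHS]eq_bigr do rewrite -big_distrr/= eq_sym.
    by rewrite (sum_delta (fun=> _)).
  move=> x'' /andP[xi'' xx].
  rewrite (@ev_indep i.1 x' x'' _ _ _ (fun a b c => (i.2 == a)%:R * (psi (x', b) * psi (x'', c)))).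
  - rewrite big1// => a _; rewrite big1// => b _.
    by rewrite -!big_distrr/= sum_psi !mulr0.
  - by rewrite eq_sym.
  - by rewrite eq_sym.
  - by rewrite eq_sym.
rewrite -big_distrr/= ler_pM2l//; apply: le_trans phi2.
rewrite [leRHS]sum_pair/= big_mkcond/=; apply: ler_sum => x _.
case: ifP => _; first exact: psi_sqr.
by apply: sumr_ge0 => y _; exact: sqr_ge0.
Qed.

Let T (t : R) := Num.max (-4) (Num.min 4 t).

Let T_le t : `|T t| <= 4.
Proof.
rewrite /T ler_norml le_max lexx/= ge_max ge_min lexx/=; lra.
Qed.

(** Truncation alters u + v only if |v| > 2, and then by at most |v| - 2, which is below v^2. *)
Let T_err (u v : R) : `|u| <= 2 -> `|(u + v) - T (u + v)| <= v ^+ 2.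
Proof.
rewrite ler_norml => /andP[u1 u2]; rewrite /T ler_norml.
have h1 := sqr_ge0 v; have h2 := sqr_ge0 (v - 1); have h3 := sqr_ge0 (v + 1).
have [w1|w1] := lerP 4 (u + v); first by rewrite max_r; lra.
have [w2|w2] := lerP (-4) (u + v); lra.
Qed.

(** One 1 / lam pays for the means [M], the other for the truncation, whose error is at most lam^2 /
    p. The constant 4 is the truncation level. *)
Lemma star (g : P -> R) : \sum_i phi i * g i <=
  2 / lam * \sum_i `|g i| + 4 / p * \sum_f `|\sum_i sf R ev f i * g i|.
Proof.
have onsf f : \sum_i on f i * g i = p * \sum_i sf R ev f i * g i.
  by rewrite big_distrr/=; apply: eq_bigr => i _; rewrite /sf -/p -/(on f i); field.
have main : \sum_i p ^- 2 * (\sum_f on f i * T (Psi f)) * g i <= 4 / p * \sum_f `|\sum_i sf R ev f i * g i|.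
  have -> : \sum_i p ^- 2 * (\sum_f on f i * T (Psi f)) * g i =
      \sum_f p ^- 2 * T (Psi f) * \sum_i on f i * g i.
    under [RHS]eq_bigr do rewrite big_distrr/=.
    rewrite [RHS]exchange_big/=; apply: eq_bigr => i _.
    by rewrite big_distrr big_distrl/=; apply: eq_bigr => f _; ring.
  rewrite big_distrr/=; apply: ler_sum => f _; rewrite onsf.
  apply: le_trans (ler_norm _) _; rewrite !normrM (gtr0_norm p0) normfV normrX (gtr0_norm p0).
  rewrite mulrA ler_wpM2r// -mulrA [_ * p]mulrC mulrA.
  rewrite (_ : p ^- 2 * p = p^-1); last by field.
  by rewrite mulrC ler_pM2r ?invr_gt0.
have err i : `|psi i - p ^- 2 * (\sum_f on f i * T (Psi f))| <= lam^-1.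
  apply: le_trans lam_le.
  rewrite (_ : psi i = p ^- 2 * (\sum_f on f i * Psi f)); last by rewrite on_Psi mulKf// gt_eqF// exprn_gt0.
  rewrite -mulrBr normrM ger0_norm ?invr_ge0 ?sqr_ge0//.
  rewrite ler_pdivrMl ?exprn_gt0// (_ : p ^+ 2 * _ = p * lam ^+ 2); last by field.
  rewrite -sumrB; apply: le_trans (ler_norm_sum _ _ _) _.
  apply: le_trans (on_Xi i); apply: ler_sum => f _.
  rewrite -mulrBr normrM normr_nat /on; case: eqP => [if_|_]; last by rewrite !mul0r.
  rewrite !mul1r (_ : Psi f = psi i + Xi f i.1); first exact: T_err.
  by rewrite /Psi (bigD1 i.1)//= -if_ /Xi; case: i if_.
have -> : \sum_i phi i * g i = \sum_i (M i.1 * g i +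
   (psi i - p ^- 2 * (\sum_f on f i * T (Psi f))) * g i) +
   \sum_i p ^- 2 * (\sum_f on f i * T (Psi f)) * g i.
  by rewrite -big_split/=; apply: eq_bigr => i _; rewrite /psi; ring.
apply: lerD main; rewrite big_distrr/=; apply: ler_sum => i _.
have -> : 2 / lam * `|g i| = lam^-1 * `|g i| + lam^-1 * `|g i| by ring.
by apply: lerD; apply: le_trans (ler_norm _) _; rewrite normrM ler_wpM2r.
Qed.

End Star.

(** * Characters of F_p, Gauss sums and quadratic polynomials *)

Section Characters.
Context (R : realType) (p : nat).
Hypothesis p_prime : prime p.
Hypothesis p_gt2 : (2 < p)%N.

Let t : R := pi *+ 2 / p%:R.
Let pR0 : 0 < p%:R :> R. Proof. by rewrite ltr0n prime_gt0. Qed.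

Definition chc (a : 'F_p) : R := cos (t *+ (a : nat)).
Definition chs (a : 'F_p) : R := sin (t *+ (a : nat)).

Let t_period n q : t *+ (n + q * p) = t *+ n + pi *+ 2 *+ q.
Proof.
rewrite mulrnDr mulnC mulrnA; congr (_ + _ *+ q).
by rewrite -[LHS]mulr_natr divfK// gt_eqF.
Qed.

Let cos_mod n : cos (t *+ (n %% p)) = cos (t *+ n).
Proof. by rewrite [in RHS](divn_eq n p) addnC t_period (periodicn (@cosD2pi R)). Qed.

Let sin_mod n : sin (t *+ (n %% p)) = sin (t *+ n).
Proof. by rewrite [in RHS](divn_eq n p) addnC t_period (periodicn (@sinD2pi R)). Qed.

Let val_add (a b : 'F_p) : (a + b : 'F_p) = ((a + b) %% p)%N :> nat.
Proof. by transitivity ((a + b) %% (Zp_trunc (pdiv p)).+2)%N => //; congr modn; exact: Fp_cast. Qed.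

Lemma chcD a b : chc (a + b) = chc a * chc b - chs a * chs b.
Proof. by rewrite /chc val_add cos_mod mulrnDr cosD. Qed.

Lemma chsD a b : chs (a + b) = chs a * chc b + chc a * chs b.
Proof. by rewrite /chs val_add sin_mod mulrnDr sinD. Qed.

Lemma chc0 : chc 0 = 1. Proof. by rewrite /chc mulr0n cos0. Qed.
Lemma chs0 : chs 0 = 0. Proof. by rewrite /chs mulr0n sin0. Qed.

Lemma chcs a : chc a ^+ 2 + chs a ^+ 2 = 1. Proof. exact: cos2Dsin2. Qed.

(** The addition formulas for a + (- a) form a linear system of determinant 1, which avoids
    computing the representative of [- a]. *)
Lemma chcN a : chc (- a) = chc a.
Proof.
have := chcD a (- a); have := chsD a (- a); rewrite subrr chc0 chs0 => h1 h2.
have h3 := chcs a; transitivity (chc a * 1 + chs a * 0); last by ring.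
rewrite h1 h2 -[LHS]mulr1 -h3; ring.
Qed.

Lemma chsN a : chs (- a) = - chs a.
Proof.
have := chcD a (- a); have := chsD a (- a); rewrite subrr chc0 chs0 => h1 h2.
have h3 := chcs a; transitivity (chc a * 0 - chs a * 1); last by ring.
rewrite h1 h2 -[LHS]mulr1 -h3; ring.
Qed.

Lemma sum_chs : \sum_a chs a = 0.
Proof.
have : \sum_a chs a = - \sum_a chs a.
  by rewrite {1}(reindex_inj oppr_inj)/= -sumrN; apply: eq_bigr => a _; rewrite chsN.
lra.
Qed.

Lemma chc1 : chc 1 < 1.
Proof.
have -> : chc 1 = cos (pi / p%:R *+ 2).
  rewrite /chc (_ : (1 : 'F_p) = 1%N :> nat); first by rewrite mulr1n /t mulrnAl.
  by have := val_Fp_nat p_prime 1; rewrite modn_small// prime_gt1.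
rewrite cos_mulr2n cos2sin2.
have : 0 < sin (pi / p%:R : R).
  apply: sin_gt0_pi; rewrite divr_gt0 ?pi_gt0//= ltr_pdivrMr//.
  by rewrite ltr_pMr ?pi_gt0// ltr1n prime_gt1.
by move=> s0; have := exprn_gt0 2 s0; rewrite -mulr_natl; lra.
Qed.

(** Translation by 1 multiplies the sum by [chc 1], since the sines cancel, and [chc 1 < 1]. *)
Lemma sum_chc : \sum_a chc a = 0.
Proof.
have : \sum_a chc a = chc 1 * \sum_a chc a.
  rewrite {1}(reindex_inj (addrI 1))/=; under eq_bigr do rewrite chcD.
  by rewrite sumrB -!big_distrr/= sum_chs mulr0 subr0.
have := chc1; move: (chc 1) (\sum_a _) => x S x1 SS.
by apply/eqP; have : (1 - x) * S == 0 by [rewrite mulrBl mul1r -SS subrr];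
  rewrite mulf_eq0 => /orP[/eqP|//]; lra.
Qed.

Lemma sum_lin (u : 'F_p -> R) k b : k != 0 -> \sum_a u (a * k + b) = \sum_a u a.
Proof.
move=> k0; have inj : injective (fun a : 'F_p => a * k + b).
  by move=> a a' /addIr /(mulIf k0).
by rewrite [RHS](reindex_inj inj).
Qed.

Local Notation X := (Finite.clone _ 'F_p).
Let P : finType := (X * X)%type.
Let q : R := #|X|%:R.

Let pair_dot (j i : P) : 'F_p := j.1 * i.1 + j.2 * i.2.

Lemma sum_pair_dot (u : 'F_p -> R) (k : P) : \sum_a u a = 0 -> k != (0, 0) ->
  \sum_j u (pair_dot j k) = 0.
Proof.
case: k => k1 k2 u0 k0; rewrite sum_pair/= /pair_dot/=.
have [k2E|k20] := eqVneq k2 0; last first.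
  rewrite big1// => a _; under eq_bigr do rewrite addrC.
  by rewrite sum_lin.
have k10 : k1 != 0 by apply: contraNneq k0 => ->; rewrite k2E.
rewrite exchange_big/= big1// => b _.
by rewrite sum_lin.
Qed.

Lemma sum_pair_dot_c (k : P) : \sum_j chc (pair_dot j k) = q ^+ 2 * (k == (0, 0))%:R.
Proof.
have [->|k0] := eqVneq k (0, 0); last by rewrite mulr0 sum_pair_dot// sum_chc.
rewrite mulr1; under eq_bigr do rewrite /pair_dot !mulr0 addr0 chc0.
by rewrite sumr_const card_prod natrM expr2.
Qed.

Lemma sum_pair_dot_s (k : P) : \sum_j chs (pair_dot j k) = 0.
Proof.
have [->|k0] := eqVneq k (0, 0); last by rewrite sum_pair_dot// sum_chs.
by rewrite big1// => j _; rewrite /pair_dot !mulr0 addr0 chs0.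
Qed.

(** The kernel cos + sin: a real, symmetric and orthogonal substitute for the characters of
    F_p^2. *)
Definition hartley (j i : P) : R := chc (pair_dot j i) + chs (pair_dot j i).

Lemma hartleyC j i : hartley j i = hartley i j.
Proof. by rewrite /hartley /pair_dot ![i.1 * _]mulrC ![i.2 * _]mulrC. Qed.

Lemma hartley_le2 j i : `|hartley j i| <= 2.
Proof.
apply: le_trans (ler_normD _ _) _; rewrite (_ : 2 = 1 + 1)//.
by apply: lerD; [exact: cos_max|exact: sin_max].
Qed.

Lemma hartley0 i : hartley (0, 0) i = 1.
Proof. by rewrite /hartley /pair_dot !mul0r addr0 chc0 chs0 addr0. Qed.

(** The product of the kernels at angles a and b is cos (a - b) + sin (a + b), and the sines sum to
    0. *)
Lemma hartley_orthl i i' : \sum_j hartley j i * hartley j i' = q ^+ 2 * (i == i')%:R.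
Proof.
have -> : (i == i') = ((i.1 - i'.1, i.2 - i'.2) == (0, 0) :> P).
  by case: i i' => [a b] [a' b']; rewrite !xpair_eqE !subr_eq0.
rewrite -sum_pair_dot_c -[RHS]addr0.
rewrite -[X in _ = _ + X](sum_pair_dot_s (i.1 + i'.1, i.2 + i'.2)) -big_split/=.
apply: eq_bigr => j _.
have -> : pair_dot j (i.1 - i'.1, i.2 - i'.2) = pair_dot j i + - pair_dot j i'.
  by rewrite /pair_dot/=; ring.
have -> : pair_dot j (i.1 + i'.1, i.2 + i'.2) = pair_dot j i + pair_dot j i'.
  by rewrite /pair_dot/=; ring.
by rewrite chcD chsD chcN chsN /hartley; ring.
Qed.

Lemma hartley_orthr j j' : \sum_i hartley j i * hartley j' i = q ^+ 2 * (j == j')%:R.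
Proof.
by under eq_bigr do rewrite hartleyC [hartley j' _]hartleyC; exact: hartley_orthl.
Qed.

(** All polynomials of degree at most 2 are kept, so that evaluation at three points is a bijection;
    those without quadratic term, p^2 out of p^3, are excluded only by [good]. *)
Definition code : finType := (X * X * X)%type.
Definition quad (f : code) (x : X) : X := f.1.1 * x ^+ 2 + f.1.2 * x + f.2.

Let two_neq0 : (2 : 'F_p) != 0.
Proof.
apply/eqP => /(congr1 (@nat_of_ord _)).
by rewrite (val_Fp_nat p_prime 2) modn_small.
Qed.

(** Weyl differencing: C^2 + D^2 is a double sum over y and z of characters of Q (y + z) - Q y,
    which is affine in y with nonzero slope unless z = 0. If j.2 = 0 the phase is itself linear. *)
Lemma quad_sum (f : code) (j : P) : f.1.1 != 0 -> j != (0, 0) ->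
  (\sum_x hartley j (x, quad f x)) ^+ 2 <= 4 * q.
Proof.
move=> a0 j0; have q0 : 0 <= q by rewrite ler0n.
pose Q x := pair_dot j (x, quad f x).
rewrite -/(\sum_x (chc (Q x) + chs (Q x))) big_split/=.
have [j2|j2] := eqVneq j.2 0.
  have j1 : j.1 != 0 by apply: contraNneq j0; case: (j) j2 => a b /= -> ->.
  have QE x : Q x = x * j.1 + 0 by rewrite /Q /pair_dot/= j2 mul0r mulrC.
  under eq_bigr do rewrite QE; under [X in _ + X]eq_bigr do rewrite QE.
  by rewrite !sum_lin// sum_chc sum_chs addr0 expr0n/= mulr_ge0.
set C := \sum_x chc _; set D := \sum_x chs _.
suff CD : C ^+ 2 + D ^+ 2 = q.
  have := sqr_ge0 (C - D); move: CD; nra.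
transitivity (\sum_y \sum_x chc (Q x - Q y)).
  rewrite !expr2 /C /D !big_distrr/= -big_split/=; apply: eq_bigr => y _.
  rewrite !big_distrl -big_split/=; apply: eq_bigr => x _.
  by rewrite chcD chcN chsN; ring.
transitivity (\sum_y \sum_z chc (Q (y + z) - Q y)).
  by apply: eq_bigr => y _; rewrite (reindex_inj (addrI y)).
rewrite exchange_big/=.
have QE y z : Q (y + z) - Q y = y * (2 * j.2 * f.1.1 * z) + (Q z - Q 0).
  by rewrite /Q /pair_dot /quad/=; ring.
rewrite (bigD1 0)//= [X in _ + X]big1 ?addr0.
  by under eq_bigr do rewrite addr0 subrr chc0; rewrite sumr_const.
move=> z z0; under eq_bigr do rewrite QE.
by rewrite sum_lin ?sum_chc// !mulf_neq0.
Qed.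

Lemma quad_inj3 f g x1 x2 x3 : x1 != x2 -> x1 != x3 -> x2 != x3 ->
  quad f x1 = quad g x1 -> quad f x2 = quad g x2 -> quad f x3 = quad g x3 -> f = g.
Proof.
case: f g => [[a b] c] [[a' b'] c']; rewrite /quad/= => n12 n13 n23 e1 e2 e3.
have sub x y : x != y -> a * x ^+ 2 + b * x + c = a' * x ^+ 2 + b' * x + c' ->
    a * y ^+ 2 + b * y + c = a' * y ^+ 2 + b' * y + c' ->
    (a - a') * (x + y) + (b - b') = 0.
  move=> xy ex ey; apply/eqP; rewrite -(mulIr_eq0 _ (mulIf (_ : x - y != 0))) ?subr_eq0//.
  apply/eqP; transitivity ((a * x ^+ 2 + b * x + c - (a' * x ^+ 2 + b' * x + c')) -
    (a * y ^+ 2 + b * y + c - (a' * y ^+ 2 + b' * y + c'))); first by ring.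
  by rewrite ex ey !subrr.
have s12 := sub _ _ n12 e1 e2; have s13 := sub _ _ n13 e1 e3.
have aE : a = a'.
  apply/eqP; rewrite -subr_eq0 -(mulIr_eq0 _ (mulIf (_ : x2 - x3 != 0))) ?subr_eq0//.
  apply/eqP; transitivity ((a - a') * (x1 + x2) + (b - b') - ((a - a') * (x1 + x3) + (b - b'))); first by ring.
  by rewrite s12 s13 subrr.
move: s12; rewrite aE subrr mul0r add0r => /eqP; rewrite subr_eq0 => /eqP bE.
by move: e1; rewrite aE bE => /addrI ->.
Qed.

Lemma quad_int f g : f != g -> (#|[set x | quad f x == quad g x]| <= 2)%N.
Proof.
move=> fg; rewrite leqNgt; apply/negP => /card_gt2P[x1 [x2 [x3 [[]]]]].
rewrite !inE => /eqP e1 /eqP e2 /eqP e3 [n12 n23 n31].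
by move/eqP: fg; apply; apply: (quad_inj3 n12 _ n23 e1 e2 e3); rewrite eq_sym.
Qed.

(** Evaluation at three points is an injective map from the finite type [code] to itself. *)
Lemma quad_indep x1 x2 x3 : x1 != x2 -> x1 != x3 -> x2 != x3 ->
  forall H : X -> X -> X -> R,
  \sum_f H (quad f x1) (quad f x2) (quad f x3) = \sum_a \sum_b \sum_c H a b c.
Proof.
move=> n12 n13 n23 H.
pose ev3 (f : code) : code := (quad f x1, quad f x2, quad f x3).
have inj : injective ev3.
  move=> f g /eqP; rewrite !xpair_eqE => /andP[/andP[/eqP e1 /eqP e2] /eqP e3].
  exact: (quad_inj3 n12 n13 n23).
transitivity (\sum_(t : code) H t.1.1 t.1.2 t.2); first by rewrite [RHS](reindex_inj inj).
by rewrite !sum_pair.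
Qed.

Lemma sum_not_good : \sum_(f : code) (f.1.1 == 0)%:R = q ^+ 2.
Proof.
transitivity (\sum_(a : X) (a == 0)%:R * q ^+ 2); last by rewrite (sum_delta (fun=> q ^+ 2)).
rewrite !sum_pair/=; apply: eq_bigr => a _.
rewrite (eq_bigr (fun=> (a == 0)%:R * q)) => [|b _]; last by rewrite sumr_const -[LHS]mulr_natr.
by rewrite sumr_const -[LHS]mulr_natr expr2 mulrA.
Qed.

End Characters.

Theorem level_exists (R : realType) (lam : R) : 1 <= lam ->
  exists (X F : finType) (h : X * X -> X * X -> R) (j0 : X * X) (ev : F -> X -> X)
    (good : pred F), let p : R := #|X|%:R in
  [/\ (2 < #|X|)%N /\ lam ^+ 4 <= p,
      (forall j i, `|h j i| <= 2) /\ (forall i, h j0 i = 1),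
      (forall i i', \sum_j h j i * h j i' = p ^+ 2 * (i == i')%:R) /\
      (forall j j', \sum_i h j i * h j' i = p ^+ 2 * (j == j')%:R),
      (forall f j, good f -> j != j0 -> lam * `|dot (sf R ev f) (h j)| <= 1) /\
      (forall f g, f != g -> (#|[set x | ev f x == ev g x]| <= 2)%N) &
      (forall x1 x2 x3, x1 != x2 -> x1 != x3 -> x2 != x3 ->
        forall H : X -> X -> X -> R,
        \sum_f H (ev f x1) (ev f x2) (ev f x3) = \sum_a \sum_b \sum_c H a b c) /\
      \sum_f (~~ good f)%:R = p ^+ 2].
Proof.
move=> lam1.
(* The Gauss bound needs lam^2 * 4 p <= p^2, hence the factor 4. *)
have [p p_gt p_prime] := prime_above (Num.truncn (4 * lam ^+ 4)).+2.
have p2 : (2 < p)%N by apply: leq_ltn_trans p_gt; rewrite ltnS.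
have lam0 : 0 < lam by exact: lt_le_trans lam1.
have lamp : 4 * lam ^+ 4 <= p%:R.
  have l4 : 0 <= 4 * lam ^+ 4 by rewrite mulr_ge0// exprn_ge0// ltW.
  have /andP[_ /ltW h] := truncn_itv l4; apply: le_trans h _.
  by rewrite ler_nat (leq_trans _ p_gt)// ltnW.
have pE : #|'F_p| = p := card_Fp p_prime.
have pR0 : 0 < p%:R :> R by rewrite ltr0n (ltn_trans _ p2).
exists 'F_p, (code p), (@hartley R p), (0, 0), (@quad p), (fun f => f.1.1 != 0) => q.
have qE : q = p%:R by rewrite /q pE.
split.
- split; first by rewrite pE.
  by rewrite qE; apply: le_trans lamp; rewrite ler_peMl ?ler1n ?exprn_ge0 ?(ltW lam0).
- by split; [exact: hartley_le2|exact: hartley0].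
- by split; [exact: hartley_orthl|exact: hartley_orthr].
- split; last exact: quad_int.
  move=> f j gf j0.
  have -> : dot (sf R (@quad p) f) (hartley R j) = p%:R^-1 * \sum_x hartley R j (x, quad f x).
    by rewrite /dot sum_sf -/q qE.
  rewrite normrM ger0_norm ?invr_ge0 ?(ltW pR0)// mulrCA ler_pdivrMl// mulr1.
  rewrite -(ler_pXn2r (ltn0Sn 1)) ?nnegrE ?mulr_ge0 ?(ltW pR0) ?(ltW lam0)//.
  rewrite exprMn real_normK ?num_real//.
  apply: (@le_trans _ _ (lam ^+ 2 * (4 * p%:R))).
    by rewrite ler_pM2l ?exprn_gt0// -qE quad_sum.
  rewrite mulrCA mulrA [leRHS]expr2 ler_pM2r//; apply: le_trans lamp.
  by rewrite ler_pM2l// ler_weXn2l.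
- split; first exact: quad_indep.
  by under eq_bigr do rewrite negbK; exact: sum_not_good.
Qed.

(** * Finite levels *)

(** A finite-dimensional space presented inside R^lidx, together with a matrix [lproj] that projects
    onto it. The matrix provides generators of the subspace and shows that it is closed. *)
Record level (R : realType) := Level {
  lidx : finType;
  lsp : (lidx -> R) -> Prop;
  lnorm : (lidx -> R) -> R;
  lproj : lidx -> lidx -> R;
  lsp0 : lsp (fun=> 0);
  lsp_lin : forall a x y, lsp x -> lsp y -> lsp (fun i => a * x i + y i);
  lsp_proj : forall i, lsp (lproj i);
  lprojK : forall x, lsp x -> app lproj x = x;
  lnorm_coord : forall x i, `|x i| <= lnorm x;
  lnormD : forall x y, lnorm (fun i => x i + y i) <= lnorm x + lnorm y;
  lnormZ : forall a x, lnorm (fun i => a * x i) = `|a| * lnorm x;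
  lnorm_l1 : exists K, forall x, lnorm x <= K * \sum_i `|x i| }.

Definition sup_l2_norm (R : realType) (P : finType) (lam : R) (x : P -> R) : R :=
  \big[Num.max/0]_i `|x i| + nrm2 x / lam.

Definition l1_factorable (R : realType) (L : level R) : Prop :=
  forall (J : finType) (zeta : lidx L -> J -> R),
    summing (@lsp _ L) (@lnorm _ L) zeta 1 ->
    exists (M : finType) (l : M -> lidx L -> R) (y : M -> J -> R),
      decomposes (@lsp _ L) zeta l y /\
      forall z, lsp z -> cost l y z <= 17 * lnorm z.

(** A Pietsch-type domination: functionals of norm at most 1 on the level, whose total weight bounds
    pi_1 of the restriction to the coordinates [loc]. *)
Definition dominated_coords (R : realType) (lam : R) (L : level R) (P : finType)
    (loc : P -> lidx L) : Prop :=
  exists (T : finType) (c : T -> R) (phi : T -> P -> R),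
    [/\ forall t, 0 <= c t, \sum_t c t <= 6 / lam,
        forall t z, `|dot (fun i => z (loc i)) (phi t)| <= lnorm z &
        forall x, sup_l2_norm lam x <= \sum_t c t * `|dot x (phi t)|].

(** [Lam i] lifts the i-th unit vector, while [c] and [tv] are the weights and vectors of the test
    inequality. In the lower bound |P| is compared with |v| |w| times 2000 |P|. *)
Definition tested_coords (R : realType) (lam : R) (L : level R) (P : finType)
    (loc : P -> lidx L) : Prop :=
  exists (Lam : P -> lidx L -> R) (T : finType) (c : T -> R) (tv : T -> P -> R),
    [/\ forall i, lsp (Lam i), forall i i', Lam i (loc i') = (i' == i)%:R,
        forall t, 0 <= c t,
        forall phi, (forall i, `|phi i| <= 1) -> \sum_i phi i ^+ 2 <= lam ^+ 2 ->
          forall g, \sum_i phi i * g i <= \sum_t c t * `|\sum_i tv t i * g i| &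
        \sum_t c t * lnorm (app Lam (tv t)) <= 2000 * #|P|%:R].

Theorem finite_level (R : realType) (lam : R) : 1 <= lam ->
  exists (L : level R) (P : finType) (loc : P -> lidx L),
  [/\ (0 < #|P|)%N, l1_factorable L, dominated_coords lam loc & tested_coords lam loc].
Proof.
move=> lam1.
have [X [F [h [j0 [ev [good]]]]]] := level_exists lam1.
set p : R := #|X|%:R.
move=> [[X3 lamp] [h2 hj0] [hl hr] [sfh evi] [evind notgood]].
have X0 : (0 < #|X|)%N by rewrite (ltn_trans _ X3).
have lam0 : 0 < lam := lt_le_trans ltr01 lam1.
have p0 : 0 < p by rewrite ltr0n.
have lam_le_p : lam <= p.
  by apply: le_trans lamp; rewrite -[leLHS]expr1 ler_weXn2l.
pose P : finType := (X * X)%type; pose N := NE lam h j0.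
have Nge0 := NEge0 lam h j0 : forall x, 0 <= N x.
have Nl1 := NEl1 lam h j0 : forall x, \sum_i `|x i| <= N x.
have NK x : N x <= 2 * lam * \sum_i `|x i| by exact: (NEK j0 lam1 h2).
have ND x y : N (fun i => x i + y i) <= N x + N y by exact: (NED _ _ lam1).
have NZ a x : N (fun i => a * x i) = `|a| * N x by exact: NEZ.
have N0 : N (fun=> 0) = 0 by exact: NE0.
have [U [u [us unet]]] := op_net Nge0 Nl1 NK.
have [G [b [sg [b1 bsg blift]]]] := @euclid_net R P.
have kl1 : exists K, forall x : kidx P G U -> R, knorm N x <= K * \sum_i `|x i|.
  by exists (2 * lam + 1) => x; apply: knorm_le_l1 NK; rewrite mulr_ge0// ltW.
pose L := @Level R (kidx P G U) (ksp b u) (knorm N) (kproj b sg u)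
  (@ksp0 R P G U b u) (@ksp_lin R P G U b u) (@kproj_ksp R P G U b sg u bsg) (@kprojK R P G U b sg u)
  (@knorm_coord R P G U N Nl1) (fun x y => knormD Nge0 x y ND) (fun a x => knormZ a x NZ)
  kl1.
exists L, P, inl; split.
- by rewrite card_prod muln_gt0 X0.
- by move=> J zeta zs; exact: (kill_factor N0 Nge0 Nl1 b1 bsg blift us unet zs).
- pose S := {ffun P -> bool}.
  (* Hartley inversion bounds the sup norm, [lam * h j] having norm at most 1 for j <> j0, and
     Khinchine bounds nrm2 by sign functionals. The mass is at most 2 / p^2 + 2 / lam + 2 / lam. *)
  exists (P + S)%type, (fun t : P + S => match t with
    | inl j => 2 / p ^+ 2 * (if j == j0 then 1 else lam^-1)
    | inr s => 2 / #|S|%:R / lam end), (fun t : P + S => match t with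
    | inl j => fun i => (if j == j0 then 1 else lam) * h j i
    | inr s => fun i => sgn R (s i) end); split.
  + move=> [j|s]; last by rewrite !divr_ge0// ltW.
    by rewrite mulr_ge0 ?divr_ge0 ?sqr_ge0//; case: ifP => // _; rewrite invr_ge0 ltW.
  + have q1 : p ^- 2 <= lam^-1.
      rewrite lef_pV2 ?posrE ?exprn_gt0//; apply: le_trans lam_le_p _.
      by rewrite -[leLHS]expr1 ler_weXn2l// ler1n.
    have S0 : #|S|%:R != 0 :> R by rewrite pnatr_eq0 -lt0n; apply/card_gt0P; exists [ffun=> false].
    rewrite sum_sumType/= sumr_const.
    rewrite (_ : _ *+ #|_| = 2 / lam); last by rewrite -[LHS]mulr_natr; field; rewrite S0 gt_eqF.
    rewrite -big_distrr/=.
    have : \sum_(j : P) (if j == j0 then 1 else lam^-1) <= 1 + p ^+ 2 * lam^-1.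
      apply: (@le_trans _ _ (\sum_(j : P) ((j == j0)%:R * 1 + lam^-1))).
        by apply: ler_sum => j _; case: eqP => _; rewrite ?mul1r ?mul0r ?add0r// lerDl invr_ge0 ltW.
      by rewrite big_split/= (sum_delta (fun=> 1)) lerD2l sumr_const card_prod -[leLHS]mulr_natl natrM -expr2.
    rewrite -(ler_pM2l (_ : 0 < 2 / p ^+ 2)) ?divr_gt0 ?exprn_gt0// => /(lerD)/(_ (lexx (2 / lam))).
    move/le_trans; apply.
    rewrite mulrDr mulr1 (_ : 2 / p ^+ 2 * (p ^+ 2 / lam) = 2 / lam); last by field; rewrite !gt_eqF.
    by move: q1; move: (p ^- 2) => q; lra.
  + move=> t z; apply: le_trans (knorm_pt N z); case: t => [j|s].
      rewrite (_ : dot _ _ = (if j == j0 then 1 else lam) * dot (kpt z) (h j)).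
        case: ifP => [/eqP->|/negbT jj0].
          rewrite mul1r; apply: le_trans (Nl1 _); apply: le_trans (ler_norm_sum _ _ _) _.
          by apply: ler_sum => i _; rewrite hj0 mulr1.
        by rewrite normrM (gtr0_norm lam0); exact: NEh.
      by rewrite /dot big_distrr/=; apply: eq_bigr => i _; rewrite mulrCA.
    apply: le_trans (Nl1 _); apply: le_trans (ler_norm_sum _ _ _) _.
    by apply: ler_sum => i _; rewrite normrM sgn_norm mulr1.
  + move=> x; rewrite sum_sumType/=; apply: lerD; last first.
      rewrite ler_pdivrMr//; apply: le_trans (khinchine x) _.
      rewrite big_distrl big_distrr/=; apply: ler_sum => s _.
      rewrite [leRHS]mulrAC divfK ?gt_eqF// le_eqVlt; apply/orP; left; apply/eqP; congr (_ * `|_|).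
      by apply: eq_bigr => i _; rewrite mulrC.
    apply/bigmax_leP; split=> [|i _].
      apply: sumr_ge0 => j _; rewrite mulr_ge0//.
      by rewrite mulr_ge0 ?divr_ge0 ?sqr_ge0//; case: ifP => // _; rewrite invr_ge0 ltW.
    rewrite [x i](hartley_inv X0 hl) normrM ger0_norm ?invr_ge0 ?sqr_ge0//.
    apply: le_trans (ler_wpM2l _ (ler_norm_sum _ _ _)) _; first by rewrite invr_ge0 sqr_ge0.
    rewrite big_distrr/=; apply: ler_sum => j _; rewrite normrM.
    have -> : dot x (fun i => (if j == j0 then 1 else lam) * h j i) =
        (if j == j0 then 1 else lam) * dot x (h j).
      by rewrite /dot big_distrr/=; apply: eq_bigr => k _; rewrite mulrCA.
    have -> : 2 / p ^+ 2 * (if j == j0 then 1 else lam^-1) *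
        `|(if j == j0 then 1 else lam) * dot x (h j)| = p ^- 2 * (`|dot x (h j)| * 2).
      case: ifP => _; rewrite ?mul1r ?mulr1; first by ring.
      by rewrite normrM (gtr0_norm lam0); field; rewrite !gt_eqF.
    by rewrite ler_pM2l ?invr_gt0 ?exprn_gt0// ler_wpM2l.
(* [level_decomposition] is stated for constant 1. Undoing this halving and lifting with constant 2
   multiply costs by 4: 68 = 4 * 17 and 288 = 4 * 72. *)
- have half m : summing (fun=> True) N (fun i j => 2^-1 * u m i j) 1.
    move=> K x B xT xB; rewrite mul1r.
    rewrite (eq_bigr (fun k => 2^-1 * nrm2 (app (u m) (x k)))) => [|k _]; last first.
      rewrite (eq_nrm2 (y := fun j => 2^-1 * app (u m) (x k) j)) ?nrm2Z ?ger0_norm ?invr_ge0// => j.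
      by rewrite /app big_distrr/=; apply: eq_bigr => i _; rewrite mulrCA.
    by rewrite -big_distrr/= ler_pdivrMl//; exact: us.
  have /choice[H HP] : forall m, exists H : P -> G -> R,
      [/\ forall k i, \sum_g H k g * b g i = u m k i,
          forall f, good f -> \sum_g `|app H (sf R ev f) g| <= 68 &
          forall k, \sum_g `|app H (fun i => (i == k)%:R) g| <= 288 * lam].
    move=> m; have [M [l [y [dec csf cdl]]]] :=
      level_decomposition X0 lam1 h2 hl hr hj0 sfh evi (half m).
    have /choice[c cP] : forall t, exists c : G -> R,
        (forall i, \sum_g c g * b g i = y t i) /\ \sum_g `|c g| <= 2 * nrm2 (y t).
      by move=> t; exact: blift.
    pose H k g := \sum_t (2 * l t k) * c t g.
    have HE x g : app H x g = \sum_t (2 * dot x (l t)) * c t g.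
      rewrite /H app_sumr; apply: eq_bigr => t _; congr (_ * _).
      by rewrite /app /dot big_distrr/=; apply: eq_bigr => i _; rewrite mulrCA.
    have Hc x : \sum_g `|app H x g| <= 4 * cost l y x.
      apply: (@le_trans _ _ (\sum_g \sum_t 2 * `|dot x (l t)| * `|c t g|)).
        apply: ler_sum => g _; rewrite HE; apply: le_trans (ler_norm_sum _ _ _) _.
        by apply: ler_sum => t _; rewrite !normrM normr_nat.
      rewrite exchange_big/= /cost big_distrr/=; apply: ler_sum => t _.
      rewrite -big_distrr/=.
      have -> : 4 * (`|dot x (l t)| * nrm2 (y t)) = 2 * `|dot x (l t)| * (2 * nrm2 (y t)) by ring.
      by rewrite ler_wpM2l ?mulr_ge0//; exact: (cP t).2.
    exists H; split.
    - move=> k i; have := dec (fun i => (i == k)%:R) Logic.I i; rewrite app_delta => dk.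
      rewrite -[RHS](mulVKf (_ : 2 != 0)) ?pnatr_eq0// dk big_distrr/=.
      under eq_bigr do rewrite /H big_distrl/=.
      rewrite exchange_big/=; apply: eq_bigr => t _.
      rewrite -(cP t).1 (_ : dot _ (l t) = l t k); last exact: sum_delta.
      by rewrite !big_distrr/=; apply: eq_bigr => g _; ring.
    - by move=> f gf; apply: le_trans (Hc _) _; have := csf f gf; lra.
    - by move=> k; apply: le_trans (Hc _) _; have := cdl k; lra.
  pose Lam (i : P) (z : kidx P G U) : R := match z with
    | inl k => (k == i)%:R | inr (m, g) => H m i g end.
  have Lpt x : kpt (app Lam x) = x.
    apply/funext => k; rewrite /kpt /app/=.
    by under eq_bigr do rewrite eq_sym mulrC; exact: sum_delta.
  have LN x B : 0 <= B -> N x <= B -> (forall m, \sum_g `|app (H m) x g| <= B) ->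
      knorm N (app Lam x) <= B.
    by move=> B0 xB HB; apply: knorm_le => //; rewrite Lpt.
  have L288 k : knorm N (app Lam (fun i => (i == k)%:R)) <= 288 * lam.
    apply: LN; first by apply: mulr_ge0; [exact: ler0n|exact: ltW].
      apply: le_trans (NK _) _; rewrite (_ : \sum_i0 _ = 1); first by lra.
      rewrite -[RHS](sum_delta (fun=> 1) k); apply: eq_bigr => i' _.
      by rewrite normr_nat mulr1.
    by move=> m; have [_ _] := HP m; apply.
  have L68 f : good f -> knorm N (app Lam (sf R ev f)) <= 68.
    move=> gf; apply: LN => //; first by apply: le_trans (NE_sf X0 lam1 sfh gf) _; rewrite ler1n.
    by move=> m; have [_ + _] := HP m; apply.
  (* Every [sf f] is an average of unit vectors, so the weaker bound also covers the polynomials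
     that are not good. *)
  have Lbad f : knorm N (app Lam (sf R ev f)) <= 288 * lam.
    have -> : app Lam (sf R ev f) = fun z => \sum_i sf R ev f i * app Lam (fun i' => (i' == i)%:R) z.
      by apply/funext => z; apply: eq_bigr => i _; rewrite app_delta.
    have kZ := knormZ (NE := N) _ _ NZ.
    have ksum (s : seq P) (t : P -> R) (w : P -> kidx P G U -> R) :
        knorm N (fun z => \sum_(i <- s) t i * w i z) <= \sum_(i <- s) `|t i| * knorm N (w i).
      elim: s => [|i s IH].
        rewrite big_nil; under eq_fun do rewrite big_nil.
        rewrite (_ : (fun=> 0) = fun z : kidx P G U => 0 * (0 : R)); first by rewrite kZ normr0 mul0r.
        by apply/funext => z; rewrite mul0r.
      rewrite big_cons; under eq_fun do rewrite big_cons.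
      by apply: le_trans (knormD Nge0 _ _ ND) _; apply: lerD => //; rewrite kZ.
    apply: le_trans (ksum _ _ _) _.
    apply: (@le_trans _ _ (\sum_i `|sf R ev f i| * (288 * lam))).
      by apply: ler_sum => i _; rewrite ler_wpM2l.
    by rewrite -big_distrl/= sf_l1// mul1r.
  exists Lam, (P + F)%type, (fun t : P + F => match t with inl _ => 2 / lam | inr _ => 4 / p end).
  exists (fun t : P + F => match t with inl i => fun i' => (i' == i)%:R | inr f => sf R ev f end).
  have c0 : 0 <= 2 / lam by rewrite divr_ge0// ltW.
  have c1 : 0 <= 4 / p by rewrite divr_ge0// ltW.
  split=> //.
  + move=> i m k; have [h1 _ _] := HP m; rewrite /= h1.
    have -> : kpt (Lam i) = fun k => (k == i)%:R by [].
    by rewrite app_delta.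
  + by case.
  + move=> phi phi1 phi2 g; apply: le_trans (star X3 lam1 lamp evind phi1 phi2 g) _.
    rewrite sum_sumType/= -!big_distrr/= lerD2r ler_wpM2l//.
    by apply: ler_sum => i _; rewrite sum_delta.
  + rewrite sum_sumType/=.
    have F3 : #|F|%:R = p ^+ 3.
      have [x _] := card_gt0P X0.
      have := ev_indep1 (R := R) X3 evind x (fun=> 1).
      by rewrite !sumr_const -/p => ->; rewrite -exprSr.
    have -> : #|P|%:R = p ^+ 2 by rewrite card_prod natrM expr2.
    (* 576 = 2 * 288 comes from the unit vectors; 1424 = 4 * 68 + 4 * 288 from the good polynomials
       and the p^2 others, the latter with lam <= p. *)
    have -> : 2000 * p ^+ 2 = 576 * p ^+ 2 + 1424 * p ^+ 2 by ring.
    apply: lerD.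
      apply: (@le_trans _ _ (\sum_(i : P) 576)).
        apply: ler_sum => i _; have -> : 576 = 2 / lam * (288 * lam) by field; rewrite gt_eqF.
        by rewrite ler_wpM2l.
      by rewrite sumr_const card_prod -[leLHS]mulr_natr natrM -expr2.
    rewrite -big_distrr/=.
    apply: (@le_trans _ _ (4 / p * (68 * p ^+ 3 + 288 * lam * p ^+ 2))).
      rewrite ler_wpM2l// -F3 -notgood.
      have -> : 68 * #|F|%:R = \sum_(f : F) (68 : R) by rewrite sumr_const mulr_natr.
      rewrite big_distrr -big_split/=; apply: ler_sum => f _.
      have [gf|bf] := boolP (good f); first by rewrite mulr0 addr0 L68.
      by rewrite mulr1; apply: le_trans (Lbad f) _; rewrite lerDr.
    have -> : 4 / p * (68 * p ^+ 3 + 288 * lam * p ^+ 2) = 272 * p ^+ 2 + 1152 * (lam * p).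
      by field; rewrite gt_eqF.
    have : lam * p <= p ^+ 2 by rewrite expr2 ler_pM2r.
    lra.
Qed.

(** * The l1-sum of the levels *)

Local Open Scope classical_set_scope.
Local Open Scope ring_scope.

Section LevelTheory.
Context (R : realType) (L : level R).

Lemma lnorm0 : lnorm (fun _ : lidx L => 0) = 0.
Proof.
rewrite (_ : (fun=> 0) = fun i : lidx L => 0 * (0 : R)); first by rewrite lnormZ normr0 mul0r.
by apply/funext => i; rewrite mul0r.
Qed.

Lemma lnormN (x : lidx L -> R) : lnorm (fun i => - x i) = lnorm x.
Proof.
rewrite (_ : (fun i => - x i) = fun i => -1 * x i); first by rewrite lnormZ normrN1 mul1r.
by apply/funext => i; rewrite mulN1r.
Qed.

Lemma lnorm_ge0 (x : lidx L -> R) : 0 <= lnorm x.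
Proof.
have := lnormD x (fun i => - x i); rewrite lnormN (_ : (fun i => _) = fun=> 0).
  by rewrite lnorm0; lra.
by apply/funext => i; rewrite subrr.
Qed.

Lemma lsp_sum (T : Type) (s : seq T) (c : T -> R) (z : T -> lidx L -> R) :
  (forall t, lsp (z t)) -> lsp (fun i => \sum_(t <- s) c t * z t i).
Proof.
move=> wz; elim: s => [|t s IH].
  by under eq_fun do rewrite big_nil; exact: lsp0.
by under eq_fun do rewrite big_cons; exact: lsp_lin.
Qed.

Lemma lsp_app_proj (z : lidx L -> R) : lsp (app (@lproj _ L) z).
Proof. by apply: lsp_sum => i; exact: lsp_proj. Qed.

End LevelTheory.

Section L1Sum.
Context (R : realType) (Ls : nat -> level R).

Let J := {k : nat & lidx (Ls k)}.
Definition part (x : J -> R^o) k : lidx (Ls k) -> R := fun i => x (Tagged (fun k => lidx (Ls k)) i).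
Arguments part : clear implicits.
Definition psum (x : J -> R^o) n : R := \sum_(k < n) lnorm (part x k).

Lemma psum_ge0 x n : 0 <= psum x n.
Proof. by apply: sumr_ge0 => k _; exact: lnorm_ge0. Qed.

Lemma psumD x y n : psum (x + y) n <= psum x n + psum y n.
Proof. by rewrite -big_split/=; apply: ler_sum => k _; exact: lnormD. Qed.

Lemma psumZ a x n : psum (a *: x) n = `|a| * psum x n.
Proof. by rewrite /psum big_distrr/=; apply: eq_bigr => k _; exact: lnormZ. Qed.

Lemma le_psum x m n : (m <= n)%N -> psum x m <= psum x n.
Proof.
move=> mn; rewrite /psum -!(big_mkord xpredT (fun k => lnorm (part x k))).
rewrite [leRHS](big_cat_nat (n := m))//= lerDl; apply: sumr_ge0 => k _; exact: lnorm_ge0.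
Qed.

Definition l1sum_pred : {pred J -> R^o} :=
  mem [set x | (forall k, lsp (part x k)) /\ exists C, forall n, psum x n <= C].

Record l1sum := L1Sum { l1sum_fun :> J -> R^o ; _ : l1sum_fun \in l1sum_pred }.

HB.instance Definition _ := [isSub for l1sum_fun].
HB.instance Definition _ := [Choice of l1sum by <:].

Lemma l1sum_predP x : x \in l1sum_pred <->
  (forall k, lsp (part x k)) /\ exists C, forall n, psum x n <= C.
Proof. by rewrite inE. Qed.

Lemma l1sum_submod : submod_closed l1sum_pred.
Proof.
split.
  apply/l1sum_predP; split; first by move=> k; exact: lsp0.
  by exists 0 => n; rewrite /psum big1// => k _; exact: lnorm0.
move=> a x y /l1sum_predP[wx [C Cx]] /l1sum_predP[wy [D Dy]].
apply/l1sum_predP; split; first by move=> k; apply: lsp_lin.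
exists (`|a| * C + D) => n; apply: le_trans (psumD _ _ _) _.
by rewrite psumZ lerD// ler_wpM2l.
Qed.

HB.instance Definition _ :=
  GRing.isSubmodClosed.Build R (J -> R^o) l1sum_pred l1sum_submod.
HB.instance Definition _ := [SubChoice_isSubLmodule of l1sum by <:].

Lemma l1sum_lsp (x : l1sum) k : lsp (part x k).
Proof. by case: x => x /= /l1sum_predP[]. Qed.

Definition l1sum_norm (x : l1sum) : R := sup (range (psum x)).

Lemma l1sum_has_sup (x : l1sum) : has_sup (range (psum x)).
Proof.
split; first by exists (psum x 0%N), 0%N.
by case: x => x /= /l1sum_predP[_ [C Cx]]; exists C => _ [n _ <-].
Qed.

Lemma psum_le_norm (x : l1sum) n : psum x n <= l1sum_norm x.
Proof. by apply: ub_le_sup; [exact: (l1sum_has_sup x).2|exists n]. Qed.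

Lemma l1sum_norm_le (x : l1sum) C : (forall n, psum x n <= C) -> l1sum_norm x <= C.
Proof. by move=> xC; apply: ge_sup; [exact: (l1sum_has_sup x).1|move=> _ [n _ <-]]. Qed.

Lemma l1sum_normD (x y : l1sum) : l1sum_norm (x + y) <= l1sum_norm x + l1sum_norm y.
Proof.
apply: l1sum_norm_le => n; apply: le_trans (psumD x y n) _.
by rewrite lerD ?psum_le_norm.
Qed.

Let l1sum_normZ_le a (x : l1sum) : l1sum_norm (a *: x) <= `|a| * l1sum_norm x.
Proof.
by apply: l1sum_norm_le => n; rewrite [leLHS](psumZ a x n) ler_wpM2l ?psum_le_norm.
Qed.

Lemma l1sum_normZ a (x : l1sum) : l1sum_norm (a *: x) = `|a| * l1sum_norm x.
Proof.
apply/eqP; rewrite eq_le l1sum_normZ_le/=.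
have [->|a0] := eqVneq a 0.
  by rewrite normr0 mul0r; apply: le_trans (psum_le_norm _ 0%N); exact: psum_ge0.
rewrite -ler_pdivlMl ?normr_gt0// -normfV -{1}[x]scale1r -(mulVf a0) -scalerA.
exact: l1sum_normZ_le.
Qed.

Lemma lnorm_part_le (x : l1sum) k : lnorm (part x k) <= l1sum_norm x.
Proof.
apply: le_trans (psum_le_norm x k.+1); rewrite /psum big_ord_recr/= lerDr.
exact: psum_ge0.
Qed.

Lemma l1sum_coord_le (x : l1sum) j : `|x j| <= l1sum_norm x.
Proof. by case: j => k i; apply: le_trans (lnorm_part_le x k); exact: (lnorm_coord (part x k)). Qed.

Lemma l1sum_norm0_eq0 (x : l1sum) : l1sum_norm x = 0 -> x = 0.
Proof.
move=> x0; apply/val_inj/funext => j; apply/eqP.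
by rewrite -normr_le0 (le_trans (l1sum_coord_le x j))// x0.
Qed.

HB.instance Definition _ :=
  Lmodule_isNormed.Build R l1sum l1sum_normD l1sum_normZ l1sum_norm0_eq0.

Lemma l1sum_normE (x : l1sum) : `|x| = l1sum_norm x. Proof. by []. Qed.

(** Coordinates converge, finitely many of them at a time, and bounds on the partial sums [psum]
    pass to the limit. *)
Lemma l1sum_complete (F : set_system l1sum) : ProperFilter F -> cauchy F -> cvg F.
Proof.
move=> FF Fc.
have cauchyF (e : R) : 0 < e -> exists x : l1sum, F [set y | `|x - y| < e].
  by move=> e0; have [x] := (cauchyP F).1 Fc e e0; rewrite -ball_normE; exists x.
have lim_coord j : exists l : R, forall d, 0 < d -> F [set y : l1sum | `|l - y j| < d].
  pose G := (fun y : l1sum => y j : R^o) @ F.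
  have Gc : cauchy G.
    apply: cauchy_exP => e e0; have [x Fx] := cauchyF e e0.
    exists (x j); rewrite -ball_normE.
    suff : F [set y : l1sum | `|x j - y j| < e] by [].
    apply: filterS Fx => y /= xy.
    exact: (le_lt_trans (l1sum_coord_le (x - y) j) xy).
  have /cvg_ex[/= l Gl] : cvg G by exact: cauchy_cvg.
  exists l => d d0; have /cvgrPdist_lt := Gl; exact.
have [l lP] := choice lim_coord.
have lim_level k d : 0 < d -> F [set y : l1sum | forall i, `|part l k i - part y k i| < d].
  by move=> d0; apply: filter_forall => i; exact: lP.
have lim_levels n d : 0 < d ->
    F [set y : l1sum | forall k : 'I_n, forall i, `|part l k i - part y k i| < d].
  by move=> d0; apply: filter_forall => k; exact: lim_level.
(* The subspace is closed, being the set of fixed points of a finite matrix. *)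
have lW k : lsp (part l k).
  suff -> : part l k = app (@lproj _ (Ls k)) (part l k) by exact: lsp_app_proj.
  apply/funext => i; apply/eqP; rewrite -subr_eq0 -normr_le0; apply/ler_addgt0Pr => e e0.
  pose C := 1 + \sum_i' `|lproj (l := Ls k) i' i|.
  have C0 : 0 < C by rewrite ltr_pwDl// sumr_ge0.
  have [y yl] := filter_ex (lim_level k (e / C) (divr_gt0 e0 C0)).
  have yE := lprojK (l1sum_lsp y k).
  have -> : part l k i - app (@lproj _ (Ls k)) (part l k) i =
     (part l k i - part y k i) - \sum_i' (part l k i' - part y k i') * lproj i' i.
    rewrite -[\sum_i' _]/(app (@lproj _ (Ls k)) (fun i' => part l k i' - part y k i') i).
    by rewrite appB yE; ring.
  rewrite add0r; apply: le_trans (ler_normB _ _) _.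
  apply: le_trans (lerD (ltW (yl i)) (ler_norm_sum _ _ _)) _.
  apply: (@le_trans _ _ (e / C + \sum_i' e / C * `|lproj (l := Ls k) i' i|)).
    by rewrite lerD2l; apply: ler_sum => i' _; rewrite normrM ler_wpM2r// ltW.
  by rewrite -big_distrr/= -{1}[e / C]mulr1 -mulrDr -/C divfK// gt_eqF.
(* On finitely many levels the norm is dominated by l_1 norms, so some [y] close to [x] in norm is
   also close to [l] on those levels. *)
have near_l x e : F [set y : l1sum | `|x - y| < e] ->
    forall n, psum ((x : J -> R^o) - l) n <= e.
  move=> Fx n; apply/ler_addgt0Pr => d d0.
  have /choice[K KP] : forall k, exists K, forall x : lidx (Ls k) -> R, lnorm x <= K * \sum_i `|x i|.
    by move=> k; exact: lnorm_l1.
  pose D := 1 + \sum_(k < n) `|K k| * #|lidx (Ls k)|%:R.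
  have D0 : 0 < D by rewrite ltr_pwDl// sumr_ge0.
  have [y [xy yl]] := filter_ex (filterI Fx (lim_levels n (d / D) (divr_gt0 d0 D0))).
  have -> : (x : J -> R^o) - l = l1sum_fun (x - y) + ((y : J -> R^o) - l).
    by apply/funext => j; rewrite -[LHS]/(x j - l j) -[RHS]/(x j - y j + (y j - l j)); ring.
  apply: le_trans (psumD _ _ _) _; apply: lerD.
    by apply: le_trans (psum_le_norm _ _) _; exact: ltW.
  apply: (@le_trans _ _ (\sum_(k < n) `|K k| * #|lidx (Ls k)|%:R * (d / D))).
    apply: ler_sum => k _; apply: le_trans (KP k _) _.
    apply: (@le_trans _ _ (`|K k| * \sum_i `|part ((y : J -> R^o) - l) k i|)).
      by rewrite ler_wpM2r ?ler_norm// sumr_ge0.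
    rewrite -mulrA ler_wpM2l//; apply: (@le_trans _ _ (\sum_(i : lidx (Ls k)) (d / D))).
      by apply: ler_sum => i _; rewrite -[part _ k i]/(part y k i - part l k i) distrC ltW.
    by rewrite sumr_const -[leLHS]mulr_natl.
  rewrite -big_distrl/= mulrCA ler_piMr ?(ltW d0)// ler_pdivrMr// mul1r.
  by rewrite /D; lra.
have lb : l \in l1sum_pred.
  apply/l1sum_predP; split => //.
  have [x Fx] := cauchyF 1 ltr01.
  exists (l1sum_norm x + 1) => n.
  have -> : l = (x : J -> R^o) + (-1) *: ((x : J -> R^o) - l).
    by apply/funext => j; rewrite -[RHS]/(x j + (-1) * (x j - l j)); ring.
  apply: le_trans (psumD _ _ _) _; rewrite psumZ normrN1 mul1r.
  by rewrite lerD ?psum_le_norm// near_l.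
apply/cvg_ex; exists (L1Sum lb); apply/cvgrPdist_le => /= e e0.
have e2 : 0 < e / 2 by rewrite divr_gt0.
have [x Fx] := cauchyF _ e2.
apply: filterS (Fx) => y /= xy.
have -> : L1Sum lb - y = (x - y) - (x - L1Sum lb) by rewrite opprB [RHS]addrC subrKA.
apply: le_trans (ler_normB _ _) _; rewrite (splitr e) lerD//; first exact: ltW.
rewrite l1sum_normE; apply: l1sum_norm_le => n; exact: near_l.
Qed.

HB.instance Definition _ := Uniform_isComplete.Build l1sum l1sum_complete.

End L1Sum.
Arguments part {R Ls} x k i.

(** * Embedding of the levels and density of their finite sums *)

Section Embedding.
Context (R : realType) (Ls : nat -> level R).
Implicit Types (x y : l1sum Ls).

Let tag (k : nat) (i : lidx (Ls k)) := Tagged (fun k => lidx (Ls k)) i.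

(** Projecting first makes the embedding total: it lands in the l_1-sum for every [z] and is the
    inclusion on [lsp]. *)
Let emb_fun k (z : lidx (Ls k) -> R) (j : {k : nat & lidx (Ls k)}) : R^o :=
  \sum_i app (@lproj _ (Ls k)) z i * (j == tag i)%:R.

Let part_emb_fun k (z : lidx (Ls k) -> R) :
  part (emb_fun z) k = app (@lproj _ (Ls k)) z.
Proof.
apply/funext => i; rewrite /part /emb_fun (bigD1 i)//= eqxx mulr1 big1 ?addr0// => i' ii.
by rewrite /tag eq_Tagged/= eq_sym (negbTE ii) mulr0.
Qed.

Let part_emb_fun0 k (z : lidx (Ls k) -> R) k' : k' != k -> part (emb_fun z) k' = fun=> 0.
Proof.
move=> kk; apply/funext => i; rewrite /part /emb_fun big1// => i' _.
case: eqP => [/(congr1 (@projT1 _ _))/= /eqP|_]; last by rewrite mulr0.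
by rewrite (negbTE kk).
Qed.

Let psum_emb_fun k (z : lidx (Ls k) -> R) n :
  psum (emb_fun z) n = if (k < n)%N then lnorm (app (@lproj _ (Ls k)) z) else 0.
Proof.
rewrite /psum; case: ltnP => kn; last first.
  rewrite big1// => k' _; rewrite part_emb_fun0 ?lnorm0//.
  by apply: contraTN (ltn_ord k') => /eqP ->; rewrite -leqNgt.
rewrite (bigD1 (Ordinal kn))//= part_emb_fun big1 ?addr0// => k' kk.
by rewrite part_emb_fun0 ?lnorm0.
Qed.

Let emb_subproof k (z : lidx (Ls k) -> R) : emb_fun z \in @l1sum_pred R Ls.
Proof.
apply/l1sum_predP; split => [k'|].
  have [->|kk] := eqVneq k' k; first by rewrite part_emb_fun; exact: lsp_app_proj.
  by rewrite part_emb_fun0//; exact: lsp0.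
exists (lnorm (app (@lproj _ (Ls k)) z)) => n; rewrite psum_emb_fun.
by case: ifP => // _; exact: lnorm_ge0.
Qed.

Definition emb k (z : lidx (Ls k) -> R) : l1sum Ls := L1Sum (emb_subproof z).

Lemma part_emb k (z : lidx (Ls k) -> R) : lsp z -> part (emb z) k = z.
Proof. by move=> wz; rewrite part_emb_fun lprojK. Qed.

Lemma part_emb0 k (z : lidx (Ls k) -> R) k' : k' != k -> part (emb z) k' = fun=> 0.
Proof. exact: part_emb_fun0. Qed.

Lemma emb_norm_le k (z : lidx (Ls k) -> R) : lsp z -> `|emb z| <= lnorm z.
Proof.
move=> wz; rewrite l1sum_normE; apply: l1sum_norm_le => n.
by rewrite psum_emb_fun lprojK//; case: ifP => // _; exact: lnorm_ge0.
Qed.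

Lemma l1sum_eq x y : (forall k, part x k = part y k) -> x = y.
Proof.
move=> xy; apply/val_inj/funext => -[k i].
by have := congr1 (fun f => f i) (xy k).
Qed.

Lemma part0 k : part (0 : l1sum Ls) k = fun=> 0. Proof. by []. Qed.

Lemma emb_lin k a (z z' : lidx (Ls k) -> R) : lsp z -> lsp z' ->
  emb (fun i => a * z i + z' i) = a *: emb z + emb z'.
Proof.
move=> wz wz'; apply: l1sum_eq => k'.
rewrite [RHS](_ : _ = fun i => a * part (emb z) k' i + part (emb z') k' i)//.
have [->|kk] := eqVneq k' k; first by rewrite !part_emb//; exact: lsp_lin.
by rewrite !part_emb0//; apply/funext => i; rewrite mulr0 addr0.
Qed.

Lemma emb0 k : emb (fun _ : lidx (Ls k) => 0) = 0.
Proof.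
apply: l1sum_eq => k'; rewrite part0.
have [->|kk] := eqVneq k' k; first by rewrite part_emb//; exact: lsp0.
by rewrite part_emb0.
Qed.

Lemma emb_sum k (T : finType) (c : T -> R) (z : T -> lidx (Ls k) -> R) :
  (forall t, lsp (z t)) -> emb (fun i => \sum_t c t * z t i) = \sum_t c t *: emb (z t).
Proof.
move=> wz; elim: (index_enum T) => [|t s IH].
  by under eq_fun do rewrite big_nil; rewrite big_nil; exact: emb0.
under eq_fun do rewrite big_cons; rewrite big_cons emb_lin ?IH//.
exact: lsp_sum.
Qed.

Lemma part_trunc x n k : part (\sum_(k < n) emb (part x k) : l1sum Ls) k =
  if (k < n)%N then part x k else fun=> 0.
Proof.
elim: n => [|n IH]; first by rewrite big_ord0 part0.
rewrite big_ord_recr/=.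
set y := \sum_(i < n) _ in IH *.
rewrite [LHS](_ : _ = fun i => part y k i + part (emb (part x n)) k i)// IH ltnS.
have [->|kn] := eqVneq k n.
  rewrite ltnn leqnn part_emb; last exact: l1sum_lsp.
  by apply/funext => i; rewrite add0r.
rewrite (leq_eqVlt k n) (negbTE kn)/= part_emb0//.
by case: ifP => _; apply/funext => i; rewrite addr0.
Qed.

Lemma trunc_dist x n : `|x - \sum_(k < n) emb (part x k)| <= `|x| - psum x n.
Proof.
set y := \sum_(k < n) _; rewrite [leLHS]l1sum_normE; apply: l1sum_norm_le => m.
have pr k : part (x - y : l1sum Ls) k = if (k < n)%N then (fun=> 0) else part x k.
  have -> : part (x - y : l1sum Ls) k = fun i => part x k i - part y k i by [].
  rewrite /y part_trunc; case: ifP => _; apply/funext => i; first by rewrite subrr.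
  by rewrite subr0.
rewrite lerBrDr; apply: le_trans (psum_le_norm x (maxn m n)).
apply: le_trans (lerD (le_psum (x - y : l1sum Ls) (leq_maxl m n)) (lexx _)) _.
have -> : psum x n = \sum_(k < maxn m n) (if (k < n)%N then lnorm (part x k) else 0).
  rewrite /psum (big_ord_widen _ (fun k => lnorm (part x k)) (leq_maxr m n)) big_mkcond.
  by [].
rewrite -big_split/=; apply: ler_sum => k _; rewrite pr.
by case: ifP => _; rewrite ?lnorm0 ?add0r ?addr0.
Qed.

Lemma psum_cvg x : psum x n @[n --> \oo] --> `|x|.
Proof.
apply: nondecreasing_cvgn; last exact: (l1sum_has_sup x).2.
by move=> m n; exact: le_psum.
Qed.

Lemma bop_suml (X Y : normedModType R) (F : boundedOp X Y) (I : Type) (s : seq I)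
  (c : I -> R) (f : I -> X) : F (\sum_(i <- s) c i *: f i) = \sum_(i <- s) c i *: F (f i).
Proof.
elim: s => [|i s IH]; first by rewrite !big_nil bop0.
by rewrite !big_cons bop_linear IH.
Qed.

Lemma bop_sum (X Y : normedModType R) (F : boundedOp X Y) (I : Type) (s : seq I)
  (f : I -> X) : F (\sum_(i <- s) f i) = \sum_(i <- s) F (f i).
Proof.
by have := bop_suml F s (fun=> 1) f; under eq_bigr do rewrite scale1r;
  under [X in _ = X -> _]eq_bigr do rewrite scale1r.
Qed.

Lemma bop_trunc_cvg (Y : normedModType R) (F : boundedOp (l1sum Ls) Y) x :
  \sum_(k < n) F (emb (part x k)) @[n --> \oo] --> F x.
Proof.
apply/cvgrPdist_le => /= e e0.
pose C := op_norm F + 1; have C0 : 0 < C by rewrite ltr_wpDl ?op_norm_ge0.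
have /cvgrPdist_le/(_ (e / C)) := @psum_cvg x; rewrite divr_gt0// => /(_ isT).
apply: filterS => n /=; rewrite ger0_norm ?subr_ge0 ?psum_le_norm// => h.
rewrite -(bop_sum F) (_ : F x - _ = F (x - \sum_(k < n) emb (part x k))); last first.
  by rewrite addrC -scaleN1r -bop_linear scaleN1r addrC.
apply: le_trans (ler_op_norm F _) _.
apply: le_trans (ler_wpM2l (op_norm_ge0 F) (le_trans (trunc_dist x n) h)) _.
rewrite mulrCA ler_piMr ?(ltW e0)// ler_pdivrMr// mul1r /C; lra.
Qed.

Lemma bop_emb_eq0 (Y : normedModType R) (F : boundedOp (l1sum Ls) Y) x :
  (forall k (z : lidx (Ls k) -> R), lsp z -> F (emb z) = 0) -> F x = 0.
Proof.
move=> F0; have := @bop_trunc_cvg _ F x.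
have -> : (fun n => \sum_(k < n) F (emb (part x k))) = fun=> 0.
  by apply/funext => n; rewrite big1// => k _; apply: F0; exact: l1sum_lsp.
by move=> /(cvg_unique (@norm_hausdorff _ _))/(_ (cvg_cst _)).
Qed.

End Embedding.

(** * The space L1 *)

Section L1.
Context d (T : measurableType d) (R : realType) (mu : {measure set T -> \bar R}).

Definition integrableR (f : T -> R) := mu.-integrable [set: T] (EFin \o f).

Lemma integrableR_lin a f g : integrableR f -> integrableR g ->
  integrableR (fun x => a * f x + g x).
Proof.
move=> fi gi; rewrite /integrableR.
have -> : EFin \o (fun x => a * f x + g x) = ((fun x => a%:E * (f x)%:E) \+ (EFin \o g))%E.
  by apply/funext => x /=; rewrite EFinD EFinM.
by apply: integrableD => //; exact: integrableZl.
Qed.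

Lemma integrableR0 : integrableR (fun=> 0).
Proof. by rewrite /integrableR (_ : _ \o _ = cst 0%E)//; exact: integrable0. Qed.

Lemma integrableR_abs f : integrableR f -> integrableR (fun x => `|f x|).
Proof. by move=> fi; exact: (integrable_abse fi). Qed.

Lemma integrableR_sum (I : Type) (s : seq I) (c : I -> R) (f : I -> T -> R) :
  (forall i, integrableR (f i)) -> integrableR (fun x => \sum_(i <- s) c i * f i x).
Proof.
move=> fi; elim: s => [|i s IH].
  by under eq_fun do rewrite big_nil; exact: integrableR0.
by under eq_fun do rewrite big_cons; exact: integrableR_lin.
Qed.

Let Lf f (fi : integrableR f) : LfunType mu (@lexx _ _ 1%E) :=
  Lfun_Sub (lexx 1%E) ((Lfun1_integrable mu f).2 fi).

(** A total function, with value 0 on functions that are not integrable, so that statements need not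
    carry integrability proofs. *)
Definition L1of (f : T -> R) : LspaceType1 mu :=
  if pselect (integrableR f) is left fi then Lspace_class (Lf fi) else 0.

Lemma L1of_class f (fi : integrableR f) : L1of f = Lspace_class (Lf fi).
Proof.
rewrite /L1of; case: pselect => // fi'.
by apply: Lspace_class_eq; exact: ae_eq_refl.
Qed.

Lemma L1of_lin a f g : integrableR f -> integrableR g ->
  L1of (fun x => a * f x + g x) = a *: L1of f + L1of g.
Proof.
move=> fi gi; rewrite (L1of_class fi) (L1of_class gi) -Lspace_class_linear.
by rewrite (L1of_class (integrableR_lin a fi gi)); apply: Lspace_class_eq; exact: ae_eq_refl.
Qed.

Lemma L1of0 : L1of (fun=> 0) = 0.
Proof.
have := L1of_lin (-1) integrableR0 integrableR0; rewrite scaleN1r addNr => <-.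
by congr L1of; apply/funext => x; rewrite mulN1r addNr.
Qed.

Lemma L1of_norm f : integrableR f -> `|L1of f| = Rintegral mu [set: T] (fun x => `|f x|).
Proof.
move=> fi; rewrite (L1of_class fi) -[LHS]/(Lspace_norm _) Lspace_norm_class.
by rewrite Lnorm1.
Qed.

Lemma integrableR_repr (F : LspaceType1 mu) : integrableR (Lspace_repr F).
Proof. by apply/Lfun1_integrable; exact: LfunP. Qed.

Lemma L1of_repr (F : LspaceType1 mu) : L1of (Lspace_repr F) = F.
Proof.
rewrite (L1of_class (integrableR_repr F)) -[RHS]Lspace_classK.
by apply: Lspace_class_eq; exact: ae_eq_refl.
Qed.

Lemma L1of_sum (I : Type) (s : seq I) (c : I -> R) (f : I -> T -> R) :
  (forall i, integrableR (f i)) ->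
  L1of (fun x => \sum_(i <- s) c i * f i x) = \sum_(i <- s) c i *: L1of (f i).
Proof.
move=> fi; elim: s => [|i s IH].
  by rewrite big_nil; under eq_fun do rewrite big_nil; exact: L1of0.
rewrite big_cons; under eq_fun do rewrite big_cons.
by rewrite L1of_lin ?IH//; exact: integrableR_sum.
Qed.

Lemma Rintegral_sum (I : Type) (s : seq I) (c : I -> R) (f : I -> T -> R) :
  (forall i, integrableR (f i)) ->
  Rintegral mu [set: T] (fun x => \sum_(i <- s) c i * f i x) =
  \sum_(i <- s) c i * Rintegral mu [set: T] (f i).
Proof.
move=> fi; elim: s => [|i s IH].
  rewrite big_nil (_ : (fun x => _) = fun=> 0); first by rewrite Rintegral_cst// mul0r.
  by apply/funext => x; rewrite big_nil.
rewrite big_cons -IH -RintegralZl//; last exact: fi.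
rewrite (_ : (fun x => _) = fun x => c i * f i x + \sum_(j <- s) c j * f j x).
  rewrite RintegralD//; last exact: integrableR_sum.
  have := integrableR_lin (c i) (fi i) integrableR0.
  by congr integrableR; apply/funext => x; rewrite addr0.
by apply/funext => x; rewrite big_cons.
Qed.

Lemma sfun_dense (F : LspaceType1 mu) (e : R) : 0 < e -> exists s : T -> R,
  [/\ integrableR s, measurable_fun [set: T] s, finite_set (range s) & `|F - L1of s| <= e].
Proof.
move=> e0; rewrite -(L1of_repr F); move: (Lspace_repr F : T -> R) (integrableR_repr F) => f fi.
have [s [si _ sl]] := approximation_sfun_integrable measurableT fi.
have /fine_cvgP[sfin /cvgrPdist_le/(_ e e0)] := sl.
move=> /(filterI sfin)/filter_ex[n /= [fin sle]].
exists (s n); split; [exact: si|exact: measurable_funPT|exact: (fimfunP (s n))|].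
have -> : L1of f - L1of (s n) = L1of (fun x => (-1) * s n x + f x).
  by rewrite L1of_lin//; [rewrite scaleN1r addrC|exact: si].
rewrite L1of_norm; last by apply: integrableR_lin => //; exact: si.
rewrite /Rintegral; move: sle; rewrite sub0r normrN => /(le_trans (ler_norm _)).
apply: le_trans; rewrite le_eqVlt; apply/orP; left; apply/eqP; congr fine.
by apply: eq_integral => x _ /=; congr (EFin (Num.norm _)); ring.
Qed.

End L1.

(** * Simple functions over a common partition *)

Section JointlySimple.
Context d (T : measurableType d) (R : realType) (mu : {measure set T -> \bar R}).
Context (P : finType) (s : P -> T -> R).
Hypothesis s_int : forall i, integrableR mu (s i).
Hypothesis s_meas : forall i, measurable_fun [set: T] (s i).
Hypothesis s_fin : forall i, finite_set (range (s i)).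

(** The [chi k] are indicators of joint level sets. The set where all [s i] vanish may have infinite
    measure; it is discarded, which is why [H] has to vanish at 0. *)
Lemma jointly_simple : exists (K : finType) (rho : K -> P -> R) (chi : K -> T -> R),
  [/\ forall k, integrableR mu (chi k), forall k x, 0 <= chi k x &
      forall H : (P -> R) -> R, H (fun=> 0) = 0 ->
        forall x, H (fun i => s i x) = \sum_k H (rho k) * chi k x].
Proof.
have /choice[D DP] : forall i, exists D : seq R, range (s i) = [set` D].
  by move=> i; exact/finite_seqP.
pose E := flatten [seq D i | i <- enum P].
have sE i x : s i x \in E.
  apply/flattenP; exists (D i); first by apply: map_f; rewrite mem_enum.
  by have : range (s i) (s i x) by [exists x]; rewrite DP.
pose K := {ffun P -> seq_sub E}.
pose rho (k : K) i : R := ssval (k i).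
pose A (k : K) := \big[setI/[set: T]]_(i : P) (s i @^-1` [set rho k i]).
have AP k x : A k x <-> forall i, s i x = rho k i.
  rewrite /A -bigcap_seq; split=> [h i|h i _]; last exact: h.
  by apply: h; exact: mem_index_enum.
pose nz (k : K) := [exists i, rho k i != 0].
have mA k : measurable (A k).
  apply: bigsetI_measurable => i _; rewrite -[X in measurable X]setTI.
  by apply: s_meas => //; exact: measurable_set1.
pose chi k x : R := if nz k then \1_(A k) x else 0.
exists K, rho, chi; split.
- move=> k; rewrite /chi; case: (boolP (nz k)) => [/existsP[i ri]|_]; last exact: integrableR0.
  (* Chebyshev: where [s i] takes the nonzero value [rho k i], the indicator is [|s i|] over
     [|rho k i|]. *)
  have := integrableR_lin (`|rho k i|^-1) (integrableR_abs (s_int i)) (integrableR0 mu).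
  apply: le_integrable => //.
    by apply/measurable_EFinP; exact: measurable_indic.
  move=> x _ /=; rewrite lee_fin addr0 [leRHS]ger0_norm ?mulr_ge0 ?invr_ge0//.
  rewrite ger0_norm// indicE; have [/set_mem /AP h|_] := boolP (x \in A k).
    by rewrite h mulVf// normr_eq0.
  by rewrite mulr_ge0 ?invr_ge0.
- by move=> k x; rewrite /chi; case: ifP.
move=> H H0 x.
pose k0 : K := [ffun i => SeqSub (sE i x)].
have k0E : rho k0 = fun i => s i x by apply/funext => i; rewrite /rho ffunE.
rewrite (bigD1 k0)//= big1 ?addr0.
  rewrite k0E /chi; case: (boolP (nz k0)) => [_|].
    by rewrite indicE mem_set ?mulr1//; apply/AP => i; rewrite k0E.
  rewrite negb_exists => /forallP h; rewrite mulr0.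
  rewrite -H0; congr H; apply/funext => i.
  by have := h i; rewrite negbK k0E => /eqP.
move=> k kk; rewrite /chi; case: ifP => _; last by rewrite mulr0.
rewrite indicE memNset ?mulr0// => /AP h; move/negP: kk; apply.
apply/eqP/ffunP => i; apply: val_inj; rewrite ffunE/=.
by rewrite h.
Qed.
End JointlySimple.

(* For simple g the inequality holds pointwise, phi being the values of the functionals
   on normalized indicators; density of simple functions does the rest. *)
Theorem L1_transfer d (T : measurableType d) (R : realType) (mu : {measure set T -> \bar R})
  (P I : finType) (c : I -> R) (tv : I -> P -> R) (lam W : R)
  (Psi : P -> boundedOp (LspaceType1 mu) R^o) :
  (forall t, 0 <= c t) ->
  (forall phi, (forall i, `|phi i| <= 1) -> \sum_i phi i ^+ 2 <= lam ^+ 2 ->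
    forall g, \sum_i phi i * g i <= \sum_t c t * `|\sum_i tv t i * g i|) ->
  0 <= W -> (forall f i, `|Psi i f| <= W * `|f|) ->
  (forall f, \sum_i Psi i f ^+ 2 <= (W * `|f| * lam) ^+ 2) ->
  forall g : P -> LspaceType1 mu,
  \sum_i Psi i (g i) <= W * \sum_t c t * `|\sum_i tv t i *: g i|.
Proof.
move=> c0 star W0 Psi1 Psi2 g.
(* The hypothesis rescaled by [W * |f|]; when this is 0, all [Psi i f] vanish. *)
have star' (f : LspaceType1 mu) (r : P -> R) :
    \sum_i r i * Psi i f <= W * `|f| * \sum_t c t * `|\sum_i tv t i * r i|.
  have [N0|N0] := eqVneq (W * `|f|) 0.
    rewrite N0 mul0r big1// => i _.
    have := Psi1 f i; rewrite N0 normr_le0 => /eqP ->; exact: mulr0.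
  have Npos : 0 < W * `|f| by rewrite lt_def N0 mulr_ge0.
  pose phi i : R := Psi i f / (W * `|f|).
  have : \sum_i phi i * r i <= \sum_t c t * `|\sum_i tv t i * r i|.
    apply: star => [i|].
      rewrite normrM normfV (gtr0_norm Npos) ler_pdivrMr// mul1r; exact: Psi1.
    have -> : \sum_i phi i ^+ 2 = (\sum_i (Psi i f : R) ^+ 2) / (W * `|f|) ^+ 2.
      by rewrite big_distrl/=; apply: eq_bigr => i _; rewrite exprMn exprVn.
    by rewrite ler_pdivrMr ?exprn_gt0// mulrC -exprMn; exact: Psi2.
  rewrite -(ler_pM2l Npos); apply: le_trans; rewrite big_distrr/= le_eqVlt.
  by apply/orP; left; apply/eqP; apply: eq_bigr => i _; rewrite /phi mulrA [_ * (_ / _)]mulrC divfK// mulrC.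
apply/ler_addgt0Pr => e e0.
(* Replacing each [g i] by a simple function within e / C changes the left side by at most |P| W e /
   C and the right side by W e / C times the sum of [c t * |tv t i|]. *)
pose C := 1 + #|P|%:R * W + W * \sum_t c t * \sum_i `|tv t i|.
have C0 : 0 < C.
  rewrite /C -addrA ltr_pwDl// addr_ge0 ?mulr_ge0//.
  by apply: sumr_ge0 => t _; rewrite mulr_ge0// sumr_ge0.
have eC : 0 < e / C by rewrite divr_gt0.
have /choice[s sP] := fun i => sfun_dense (g i) eC.
have si i : integrableR mu (s i) by case: (sP i).
have sm i : measurable_fun [set: T] (s i) by case: (sP i).
have sf' i : finite_set (range (s i)) by case: (sP i).
have sg i : `|g i - L1of mu (s i)| <= e / C by case: (sP i).
have [K [rho [chi [chii chi0 chiE]]]] := jointly_simple si sm sf'.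
have sE i : L1of mu (s i) = \sum_k rho k i *: L1of mu (chi k).
  rewrite -L1of_sum//; congr L1of; apply/funext => x.
  exact: (chiE (fun r => r i)).
have simple : \sum_i Psi i (L1of mu (s i)) <= W * \sum_t c t * `|\sum_i tv t i *: L1of mu (s i)|.
  have -> : \sum_i (Psi i (L1of mu (s i)) : R) = \sum_k \sum_i rho k i * Psi i (L1of mu (chi k)).
    rewrite exchange_big/=; apply: eq_bigr => i _.
    by rewrite sE bop_suml.
  apply: le_trans (ler_sum _ (fun k _ => star' (L1of mu (chi k)) (rho k))) _.
  rewrite big_distrr/=; under eq_bigr do rewrite big_distrr/=.
  rewrite exchange_big/=; apply: ler_sum => t _.
  (* The L_1 norm of a combination splits over the joint level sets, so this comparison is an
     equality. *)
  rewrite le_eqVlt; apply/orP; left; apply/eqP.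
  rewrite -L1of_sum// L1of_norm; last exact: integrableR_sum.
  have chin k : `|L1of mu (chi k)| = Rintegral mu [set: T] (chi k).
    by rewrite L1of_norm//; apply: eq_Rintegral => x _; rewrite ger0_norm.
  under eq_bigr do rewrite chin.
  transitivity (W * c t * \sum_k `|\sum_i tv t i * rho k i| * Rintegral mu [set: T] (chi k)).
    by rewrite big_distrr/=; apply: eq_bigr => k _; ring.
  rewrite -mulrA; congr (_ * (_ * _)); rewrite -Rintegral_sum//.
  apply: eq_Rintegral => x _ /=.
  rewrite (chiE (fun r => `|\sum_i tv t i * r i|))//.
  by rewrite big1 ?normr0// => i _; rewrite mulr0.
apply: (@le_trans _ _ (\sum_i Psi i (L1of mu (s i)) + #|P|%:R * W * (e / C))).
  have -> : #|P|%:R * W * (e / C) = \sum_(i : P) W * (e / C).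
    by rewrite sumr_const -[RHS]mulr_natl mulrA.
  rewrite -big_split/=; apply: ler_sum => i _.
  have : `|Psi i (g i - L1of mu (s i))| <= W * (e / C).
    by apply: le_trans (Psi1 _ _) _; rewrite ler_wpM2l.
  have -> : Psi i (g i - L1of mu (s i)) = Psi i (g i) - Psi i (L1of mu (s i)).
    by rewrite addrC -scaleN1r bop_linear scaleN1r addrC.
  by move=> /(le_trans (ler_norm _)); rewrite lerBlDl.
apply: le_trans (lerD simple (lexx _)) _.
apply: (@le_trans _ _ (W * (\sum_t c t * `|\sum_i tv t i *: g i| +
    \sum_t c t * (\sum_i `|tv t i|) * (e / C)) + #|P|%:R * W * (e / C))).
  rewrite lerD2r ler_wpM2l// -big_split/=; apply: ler_sum => t _.
  rewrite -mulrA -mulrDr ler_wpM2l// -lerBlDl.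
  apply: le_trans (lerB_dist _ _) _; rewrite -sumrB.
  apply: le_trans (ler_norm_sum _ _ _) _; rewrite big_distrl/=; apply: ler_sum => i _.
  by rewrite -scalerBr normrZ ler_wpM2l// distrC.
rewrite mulrDr -addrA lerD2l -big_distrl/=.
have CE : C = 1 + #|P|%:R * W + W * \sum_t c t * \sum_i `|tv t i| by [].
rewrite -[leRHS](divfK (lt0r_neq0 C0)) [X in _ <= _ * X]CE -subr_ge0.
by rewrite (_ : _ - _ = e / C) ?(ltW eC)//; ring.
Qed.

(** * The lower bound for GL *)

Section Pi1.
Context (R : realType) (X Y : normedModType R).
Implicit Types (u : boundedOp X Y).

Lemma weak_l1_norm_ge0 n (x : 'I_n -> X) : 0 <= weak_l1_norm x.
Proof.
apply: (@le_trans _ _ (\sum_(i < n) `|(0 : dual X) (x i)|)); first exact: sumr_ge0.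
apply: ub_le_sup; first exact: (weak_l1_norm_has_sup x).2.
by exists 0 => //=; rewrite normr0.
Qed.

Lemma le_weak_l1_norm n (x : 'I_n -> X) (f : dual X) : `|f| <= 1 ->
  \sum_(i < n) `|f (x i)| <= weak_l1_norm x.
Proof.
move=> f1; apply: ub_le_sup; first exact: (weak_l1_norm_has_sup x).2.
by exists f.
Qed.

Lemma weak_l1_norm_le n (x : 'I_n -> X) B : (forall s : 'I_n -> bool,
    `|\sum_i sgn R (s i) *: x i| <= B) -> weak_l1_norm x <= B.
Proof.
move=> xB; apply: ge_sup; first exact: (weak_l1_norm_has_sup x).1.
move=> _ [f /= f1 <-].
apply: le_trans (xB (fun i => f (x i) < 0)).
under eq_bigr => i _ do rewrite -(sgn_lt0 (f (x i) : R)).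
have := bop_suml f (index_enum 'I_n) (fun i => sgn R ((f (x i) : R) < 0)) x.
rewrite /GRing.scale/= => <-.
apply: le_trans (ler_norm _) _; apply: le_trans (ler_op_norm f _) _.
by rewrite ler_piMl.
Qed.

Lemma summing_constant_ge u x lambda : summing_constant u lambda ->
  `|u x| <= lambda * `|x|.
Proof.
move=> [l0 /(_ 1%N (fun=> x))]; rewrite big_ord1 => /le_trans; apply.
rewrite ler_pM2l//; apply: weak_l1_norm_le => s.
by rewrite big_ord1 normrZ sgn_norm mul1r.
Qed.

Lemma neq0_witness u : u != 0 -> exists x, 0 < `|u x| /\ 0 < `|x|.
Proof.
move=> u0; have [x ux] : exists x, u x != 0.
  apply: contrapT => h; move/eqP: u0; apply; apply/val_inj/funext => x.
  by apply/eqP/negPn/negP => ux; apply: h; exists x.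
exists x; rewrite !normr_gt0; split=> //.
by apply: contraNneq ux => ->; rewrite bop0.
Qed.

Lemma pi1_gt0 u : u != 0 -> (0 < pi1 u)%E.
Proof.
move=> /neq0_witness[x [ux x0]].
apply: (@lt_le_trans _ _ (`|u x| / `|x|)%:E); first by rewrite lte_fin divr_gt0.
apply/ereal_infP => _ [l ul <-]; rewrite lee_fin ler_pdivrMr//.
exact: summing_constant_ge.
Qed.

End Pi1.

(** * The target: sup norm plus Euclidean norm over lambda *)

Section CoordinateSpace.
Context (R : realType) (lam : R) (P : finType).
Hypothesis lam0 : 0 < lam.

Let N (x : P -> R) := sup_l2_norm lam x.

Let max_le (x : P -> R) B : 0 <= B -> (forall i, `|x i| <= B) -> \big[Num.max/0]_i `|x i| <= B.
Proof. by move=> B0 h; apply/bigmax_leP. Qed.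

Let le_max (x : P -> R) i : `|x i| <= \big[Num.max/0]_i `|x i|.
Proof. exact: (@le_bigmax _ _ _ 0 (fun i => `|x i|)). Qed.

Let max_ge0 (x : P -> R) : 0 <= \big[Num.max/0]_i `|x i|.
Proof. exact: bigmax_ge_id. Qed.

Let N_coord (x : P -> R) i : `|x i| <= N x.
Proof. by apply: le_trans (le_max x i) _; rewrite lerDl divr_ge0 ?nrm2_ge0// ltW. Qed.

Let ND (x y : P -> R) : N (fun i => x i + y i) <= N x + N y.
Proof.
rewrite /N /sup_l2_norm addrACA -mulrDl; apply: lerD.
  apply: max_le => [|i]; first by rewrite addr_ge0.
  by apply: le_trans (ler_normD _ _) _; rewrite lerD.
by rewrite ler_pM2r ?invr_gt0// nrm2D.
Qed.

Let NZ a (x : P -> R) : N (fun i => a * x i) = `|a| * N x.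
Proof.
rewrite /N /sup_l2_norm mulrDr nrm2Z mulrA; congr (_ + _).
rewrite (big_morph _ (fun y z => maxr_pMr y z (normr_ge0 a)) (mulr0 _)).
by apply: eq_bigr => i _; rewrite normrM.
Qed.

Let N_l1 : exists K, forall x : P -> R, N x <= K * \sum_i `|x i|.
Proof.
exists (1 + lam^-1) => x; rewrite mulrDl mul1r; apply: lerD.
  apply: max_le => [|i]; first exact: sumr_ge0.
  by rewrite (bigD1 i)//= lerDl sumr_ge0.
by rewrite mulrC ler_pM2l ?invr_gt0// nrm2_le_l1.
Qed.

Let deltaK (x : P -> R) : True -> app (fun i i' => (i' == i)%:R) x = x.
Proof.
by move=> _; apply/funext => i; rewrite /app; under eq_bigr do rewrite mulrC eq_sym; exact: sum_delta.
Qed.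

Definition sup_l2_level : level R := @Level R P (fun=> True) N
  (fun i i' => (i' == i)%:R) Logic.I (fun _ _ _ _ _ => Logic.I) (fun=> Logic.I)
  deltaK N_coord ND NZ N_l1.

Let zero_level : level R.
Proof.
refine (@Level R void (fun=> True) (fun=> 0) (fun _ _ => 0) Logic.I
  (fun _ _ _ _ _ => Logic.I) (fun=> Logic.I) _ _ _ _ _).
- by move=> x _; apply/funext => -[].
- by move=> x [].
- by move=> x y; rewrite addr0.
- by move=> a x; rewrite mulr0.
- by exists 0 => x; rewrite mul0r.
Defined.

(* A finite-dimensional normed space is obtained as an l_1-sum with a single nonzero term, which
   provides its structure of Banach space. *)
Definition sup_l2_space_levels (k : nat) : level R :=
  if k is 0%N then sup_l2_level else zero_level.

Definition sup_l2_space : completeNormedModType R := l1sum sup_l2_space_levels.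

Definition sup_l2_emb (x : P -> R) : sup_l2_space := @emb R sup_l2_space_levels 0%N x.

Lemma sup_l2_emb_lin a x y : sup_l2_emb (fun i => a * x i + y i) = a *: sup_l2_emb x + sup_l2_emb y.
Proof. exact: emb_lin. Qed.

Lemma sup_l2_emb_le x : `|sup_l2_emb x| <= sup_l2_norm lam x.
Proof. exact: emb_norm_le. Qed.

Let coord (eta : P -> R) (y : sup_l2_space) : R^o :=
  dot (part (l1sum_fun y) 0%N : P -> R) eta.

(** The first bound will give the square-sum condition of [L1_transfer], the second the bound on
    single coordinates. *)
Let coord_bounds eta y :
  `|coord eta y| <= lam * nrm2 eta * `|y| /\ `|coord eta y| <= (\sum_i `|eta i|) * `|y|.
Proof.
pose x : P -> R := part (l1sum_fun y) 0%N.
have xy : N x <= `|y| := lnorm_part_le y 0%N.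
split.
  apply: le_trans (dot_norm_le _ _) _; rewrite -/x mulrC [lam * _]mulrC -mulrA.
  rewrite ler_wpM2l ?nrm2_ge0// mulrC -ler_pdivrMr//.
  by apply: le_trans xy; rewrite /N /sup_l2_norm lerDr max_ge0.
apply: le_trans (ler_norm_sum _ _ _) _; rewrite big_distrl/=; apply: ler_sum => i _.
by rewrite normrM mulrC ler_wpM2l// (le_trans (N_coord x i)).
Qed.

Let coord_subproof eta : coord eta \in @bounded_op R sup_l2_space R^o.
Proof.
apply/bounded_opP; split; last first.
  by exists (lam * nrm2 eta) => y; have [] := coord_bounds eta y.
move=> a x y; rewrite /coord /dot /GRing.scale/= big_distrr -big_split/=.
by apply: eq_bigr => i _; rewrite mulrA -mulrDl.
Qed.

Definition sup_l2_coord (eta : P -> R) : dual sup_l2_space := BoundedOp (coord_subproof eta).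

Lemma sup_l2_coord_emb eta x : sup_l2_coord eta (sup_l2_emb x) = dot x eta.
Proof. by rewrite /= /coord part_emb. Qed.

Lemma sup_l2_coord_l2 eta : `|sup_l2_coord eta| <= lam * nrm2 eta.
Proof.
apply: op_norm_le => [|y]; first by rewrite mulr_ge0 ?nrm2_ge0// ltW.
by have [] := coord_bounds eta y.
Qed.

Lemma sup_l2_coord_l1 eta : `|sup_l2_coord eta| <= \sum_i `|eta i|.
Proof.
apply: op_norm_le => [|y]; first exact: sumr_ge0.
by have [] := coord_bounds eta y.
Qed.

Lemma sup_l2_coord_sum eta :
  sup_l2_coord eta = \sum_i eta i *: sup_l2_coord (fun i' => (i' == i)%:R).
Proof.
apply/val_inj/funext => y.
have sumE (s : seq P) : (\sum_(i <- s) eta i *: sup_l2_coord (fun i' => (i' == i)%:R)) y =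
    \sum_(i <- s) eta i * sup_l2_coord (fun i' => (i' == i)%:R) y.
  elim: s => [|i s IH]; first by rewrite !big_nil.
  by rewrite !big_cons -IH.
rewrite [RHS]sumE /= /coord /dot; apply: eq_bigr => i _.
by under [in RHS]eq_bigr do rewrite mulrC; rewrite sum_delta mulrC.
Qed.

End CoordinateSpace.

(** * Lower bound for GL from one level *)

Section GLLower.
Context (R : realType) (Ls : nat -> level R) (k : nat) (lam : R) (P : finType).
Context (loc : P -> lidx (Ls k)).
Hypothesis lam0 : 0 < lam.
Hypothesis P0 : (0 < #|P|)%N.
Hypothesis dom : dominated_coords lam loc.
Hypothesis test : tested_coords lam loc.

Let X : completeNormedModType R := l1sum Ls.
Let Y : completeNormedModType R := sup_l2_space P lam0.
Let res (x : X) : P -> R := fun i => part (l1sum_fun x) k (loc i).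

Let u_fun (x : X) : Y := sup_l2_emb lam0 (res x).

Let res_norm x : sup_l2_norm lam (res x) <= 6 / lam * `|x|.
Proof.
have [I [c [phi [c0 csum phi1 xphi]]]] := dom.
apply: le_trans (xphi _) _; apply: (@le_trans _ _ (\sum_t c t * `|x|)).
  apply: ler_sum => t _; rewrite ler_wpM2l//.
  by apply: le_trans (phi1 t (part x k)) _; exact: lnorm_part_le.
by rewrite -big_distrl/= ler_wpM2r.
Qed.

Let u_subproof : u_fun \in @bounded_op R X Y.
Proof.
apply/bounded_opP; split; last first.
  exists (6 / lam) => x; apply: le_trans (sup_l2_emb_le _ _) (res_norm x).
by move=> a x y; rewrite /u_fun -sup_l2_emb_lin.
Qed.

Let u : boundedOp X Y := BoundedOp u_subproof.

Let func (eta : P -> R) (x : X) : R^o := dot (res x) eta.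

Let func_subproof eta (h : forall z : lidx (Ls k) -> R, `|dot (fun i => z (loc i)) eta| <= lnorm z) :
  func eta \in @bounded_op R X R^o.
Proof.
apply/bounded_opP; split; last first.
  by exists 1 => x; rewrite mul1r; apply: le_trans (h (part x k)) _; exact: lnorm_part_le.
move=> a x y; rewrite /func /dot /GRing.scale/= big_distrr -big_split/=.
by apply: eq_bigr => i _; rewrite mulrA -mulrDl.
Qed.

Let u_summing : summing_constant u (6 / lam).
Proof.
split; first by rewrite divr_gt0.
move=> n x; have [I [c [phi [c0 csum phi1 xphi]]]] := dom.
apply: (@le_trans _ _ (\sum_(i < n) \sum_t c t * `|dot (res (x i)) (phi t)|)).
  by apply: ler_sum => i _; apply: le_trans (sup_l2_emb_le _ _) (xphi _).
rewrite exchange_big/=; apply: (@le_trans _ _ (\sum_t c t * weak_l1_norm x)).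
  apply: ler_sum => t _; rewrite -big_distrr/= ler_wpM2l//.
  pose f : dual X := BoundedOp (func_subproof (phi1 t)).
  apply: (le_weak_l1_norm x (f := f)).
  apply: op_norm_le => // y; rewrite mul1r.
  by apply: le_trans (phi1 t (part y k)) _; exact: lnorm_part_le.
by rewrite -big_distrl/= ler_wpM2r// weak_l1_norm_ge0.
Qed.

(** The functionals [Psi i] read the coordinates of [w], and [Psi i] is 1 on the image under [v] of
    the i-th lifted unit vector. [L1_transfer] then bounds |P| by |w| |v| times 2000 |P|. *)
Lemma factorization_lower d (T : measurableType d) (mu : {measure set T -> \bar R})
  (v : boundedOp X (LspaceType1 mu)) (w : boundedOp (LspaceType1 mu) (dual (dual Y))) :
  L1_factorization u v w -> 2000^-1 <= `|v| * `|w|.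
Proof.
move=> uvw; have [Lam [I [c [tv [LamW Lamloc c0 star csum]]]]] := test.
pose e i : dual Y := sup_l2_coord lam0 (fun i' => (i' == i)%:R).
have wf_le f y : `|(w f : dual (dual Y)) y| <= `|w| * `|f| * `|y|.
  apply: le_trans (ler_op_norm (w f : dual (dual Y)) y) _.
  by rewrite ler_wpM2r//; exact: (ler_op_norm w f).
have Psi_sub i : (fun f => (w f : dual (dual Y)) (e i)) \in @bounded_op R (LspaceType1 mu) R^o.
  apply/bounded_opP; split; first by move=> a f g; rewrite bop_linear.
  by exists (`|w| * `|e i|) => f; apply: le_trans (wf_le f (e i)) _; rewrite mulrAC.
pose Psi i := BoundedOp (Psi_sub i).
pose g i := v (@emb R Ls k (Lam i)).
have Psig i : Psi i (g i) = 1.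
  rewrite /= /g -uvw /= -/(u _) /u /=.
  rewrite -[LHS]/(sup_l2_coord lam0 (fun i' => (i' == i)%:R) (u_fun (emb (Lam i)))).
  rewrite /u_fun sup_l2_coord_emb dotC /dot (sum_delta (res _)) /res part_emb//.
  by rewrite Lamloc eqxx.
have W0 : 0 <= `|w| by [].
have Psi1 f i : `|Psi i f| <= `|w| * `|f|.
  apply: le_trans (wf_le f (e i)) _; rewrite ler_piMr ?mulr_ge0//.
  apply: le_trans (sup_l2_coord_l1 _ _) _; rewrite -[leRHS](sum_delta (fun=> 1) i).
  by apply: ler_sum => i' _; rewrite normr_nat mulr1.
have Psi2 f : \sum_i Psi i f ^+ 2 <= (`|w| * `|f| * lam) ^+ 2.
  pose eta i : R := Psi i f.
  rewrite -[leLHS](nrm2_sqr eta).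
  (* Duality: |eta|_2^2 is the value of [w f] at the functional with coefficients [eta], whose norm
     is at most lam |eta|_2. *)
  have h : nrm2 eta ^+ 2 <= `|w| * `|f| * lam * nrm2 eta.
    have -> : nrm2 eta ^+ 2 = (w f : dual (dual Y)) (sup_l2_coord lam0 eta).
      rewrite sup_l2_coord_sum bop_suml nrm2_sqr; apply: eq_bigr => i _.
      by rewrite expr2.
    apply: le_trans (ler_norm _) _; apply: le_trans (wf_le _ _) _.
    by rewrite -[_ * lam * _]mulrA ler_wpM2l ?mulr_ge0// sup_l2_coord_l2.
  have [->|n0] := eqVneq (nrm2 eta) 0; first by rewrite expr0n/= sqr_ge0.
  have npos : 0 < nrm2 eta by rewrite lt_def n0 nrm2_ge0.
  rewrite lerXn2r ?nnegrE ?mulr_ge0 ?nrm2_ge0 ?(ltW lam0)//.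
  by rewrite expr2 ler_pM2r in h.
have := L1_transfer c0 star W0 Psi1 Psi2 g.
under eq_bigr do rewrite Psig; rewrite sumr_const.
have sum_le : \sum_t c t * `|\sum_i tv t i *: g i| <= `|v| * (2000 * #|P|%:R).
  apply: (@le_trans _ _ (\sum_t c t * (`|v| * lnorm (app Lam (tv t))))).
    apply: ler_sum => t _; rewrite ler_wpM2l//.
    rewrite -(bop_suml v) -emb_sum//.
    apply: le_trans (ler_op_norm v _) _; apply: ler_wpM2l; first exact: op_norm_ge0.
    exact: (@emb_norm_le R Ls k _ (lsp_sum (index_enum P) (tv t) LamW)).
  under eq_bigr do rewrite mulrCA; rewrite -big_distrr/= ler_wpM2l//.
move=> /le_trans/(_ (ler_wpM2l W0 sum_le)) h.
have PR : 0 < #|P|%:R :> R by rewrite ltr0n.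
have c0' : 0 < 2000 :> R by rewrite ltr0n.
move: (2000 : R) c0' h => C C0 h.
rewrite -[C^-1]mul1r ler_pdivrMr// -(ler_pM2r PR) mul1r; apply: le_trans h _.
by rewrite mulrCA mulrA mulrA.
Qed.

Lemma GL_ge : ((lam / 12000)%:E <= GL X)%E.
Proof.
have u0 : u != 0.
  have [i _] := card_gt0P P0.
  have [Lam [I [c [tv [LamW Lamloc _ _ _]]]]] := test.
  apply/eqP => /(congr1 (fun f : boundedOp X Y => sup_l2_coord lam0 (fun i' => (i' == i)%:R) (f (emb (Lam i))))).
  rewrite -[LHS]/(sup_l2_coord lam0 (fun i' => (i' == i)%:R) (u_fun (emb (Lam i)))).
  rewrite /u_fun sup_l2_coord_emb dotC /dot (sum_delta (res _)) /res part_emb//.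
  rewrite Lamloc eqxx -[RHS]/(sup_l2_coord lam0 _ 0) bop0 => /eqP.
  by rewrite oner_eq0.
have g1 : (2000^-1%:E <= gamma1 u)%E.
  apply/ereal_infP => _ [d [T [mu [v [w [uvw ->]]]]]].
  by rewrite lee_fin; exact: factorization_lower.
have p0 := pi1_gt0 u0.
have p6 : (pi1 u <= (6 / lam)%:E)%E.
  by apply: ge_ereal_inf; exists (6 / lam)%:E => //; exists (6 / lam).
apply: le_ereal_sup_tmp; exists (gamma1 u / pi1 u)%E.
  by exists Y, u; split => //; exists (6 / lam).
move: p0 p6; case: (pi1 u) => [r| |]//; rewrite lte_fin lee_fin => r0 r6.
rewrite inver gt_eqF//.
apply: (@le_trans _ _ (2000^-1%:E * r^-1%:E)%E); last first.
  by rewrite lee_pmul2r// lte_fin invr_gt0.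
rewrite -EFinM lee_fin.
have -> : lam / 12000 = 2000^-1 * (6 / lam)^-1 by field; rewrite gt_eqF.
apply: ler_wpM2l; first by rewrite invr_ge0 ler0n.
by rewrite lef_pV2 ?posrE ?divr_gt0.
Qed.

End GLLower.

(** * The upper bound for GL_fin *)

Section Counting.
Context (R : realType).
Local Notation mu := (@counting nat R).

Lemma counting_set1 N : mu [set N] = 1%E.
Proof. by rewrite /counting/= asboolT// fset_set1 finmap.cardfs1. Qed.

(** Null sets of the counting measure are empty, so a class of functions has well-defined values at
    points. *)
Lemma ae_counting (Q : nat -> Prop) : {ae mu, forall n, Q n} -> forall n, Q n.
Proof.
move=> [B [mB B0 QB]] n; apply: contrapT => nQ.
have : (mu [set n] <= mu B)%E.
  by apply: le_measure; rewrite ?inE// => _ ->; exact: QB.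
by rewrite counting_set1 B0 lee_fin ler10.
Qed.

Lemma integrableR_counting (f : nat -> R) C : (forall N, \sum_(n < N) `|f n| <= C) ->
  integrableR mu f /\ Rintegral mu [set: nat] (fun n => `|f n|) <= C.
Proof.
move=> fC.
have h : (\int[mu]_n `|f n|%:E <= C%:E)%E.
  rewrite ge0_integral_count//.
  apply: lime_le; first exact: is_cvg_nneseries.
  by apply: nearW => N; rewrite sumEFin lee_fin big_mkord.
have fi : integrableR mu f.
  apply/integrableP; split => //.
  by apply: le_lt_trans h _; rewrite ltry.
split=> //; rewrite /Rintegral -lee_fin fineK//.
rewrite ge0_fin_numE ?integral_ge0//.
by apply: le_lt_trans h _; rewrite ltry.
Qed.

Lemma Rintegral_counting_delta (c : nat -> R) N :
  integrableR mu (fun n => (n == N)%:R * c n) /\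
  Rintegral mu [set: nat] (fun n => (n == N)%:R * c n) = c N.
Proof.
have E : (fun n => (n == N)%:R * c n) = fun n => c N * \1_[set N] n.
  apply/funext => n; rewrite indicE; have [->|nN] := eqVneq n N.
    by rewrite mem_set// mulr1 mul1r.
  by rewrite memNset ?mulr0 ?mul0r//= => /eqP; rewrite (negbTE nN).
have i1 : integrableR mu (\1_[set N]).
  apply: (@integrableR_counting _ 1 _).1 => M.
  have -> : \sum_(n < M) `|\1_[set N] (n : nat)| = \sum_(n < M | n == N :> nat) (1 : R).
    rewrite [RHS]big_mkcond; apply: eq_bigr => n _; rewrite indicE.
    case: eqP => [->|nN]; first by rewrite mem_set// normr1.
    by rewrite memNset ?normr0.
  have [NM|MN] := ltnP N M.
    by rewrite (big_pred1 (Ordinal NM))// => n; rewrite -val_eqE.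
  by rewrite big_pred0// => n; apply: contraTF (ltn_ord n) => /eqP ->; rewrite -leqNgt.
rewrite E; split.
  have := integrableR_lin (c N) i1 (integrableR0 mu).
  by congr integrableR; apply/funext => n; rewrite addr0.
rewrite RintegralZl// /Rintegral integral_indic// setIT.
transitivity (c N * fine (1%E : \bar R)); last exact: mulr1.
by congr (_ * fine _); exact: counting_set1.
Qed.

Lemma Lspace_repr_counting p (p1 : (1 <= p)%E) (f : LfunType mu p1) n :
  Lspace_repr (Lspace_class f) n = f n.
Proof. by have /ae_counting/(_ n Logic.I) := Lspace_reprK f. Qed.

Lemma Lspace_repr_lin p (p1 : (1 <= p)%E) a (f g : LspaceType mu p1) n :
  Lspace_repr (a *: f + g) n = a * Lspace_repr f n + Lspace_repr g n.
Proof.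
rewrite -{1}(Lspace_classK f) -{1}(Lspace_classK g) -Lspace_class_linear.
by rewrite Lspace_repr_counting.
Qed.

Lemma L1of_counting (g : nat -> R) : integrableR mu g -> Lspace_repr (L1of mu g) =1 g.
Proof. by move=> gi n; rewrite (L1of_class gi) Lspace_repr_counting. Qed.

Definition l2_dot (f g : l2 R) : R :=
  Rintegral mu [set: nat] (fun n => Lspace_repr f n * Lspace_repr g n).

Let l2_int (f g : l2 R) : integrableR mu (fun n => Lspace_repr f n * Lspace_repr g n).
Proof. by apply/Lfun1_integrable/Lfun2_mul_Lfun1; exact: LfunP. Qed.

Lemma l2_dot_lin g a f f' : l2_dot (a *: f + f') g = a * l2_dot f g + l2_dot f' g.
Proof.
rewrite /l2_dot -RintegralZl//; last exact: l2_int.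
rewrite -RintegralD//; last 2 first.
- have := integrableR_lin a (l2_int f g) (integrableR0 mu).
  by congr integrableR; apply/funext => n; rewrite addr0.
- exact: l2_int.
by apply: eq_Rintegral => n _; rewrite Lspace_repr_lin; ring.
Qed.

Lemma l2_dotC f g : l2_dot f g = l2_dot g f.
Proof. by apply: eq_Rintegral => n _; rewrite mulrC. Qed.

Lemma l2_dot_ge0 f : 0 <= l2_dot f f.
Proof. by apply: Rintegral_ge0 => n _; rewrite -expr2 sqr_ge0. Qed.

Lemma l2_dot_norm f : l2_dot f f = `|f| ^+ 2.
Proof.
rewrite -[in RHS](Lspace_classK f) -[`|_|]/(Lspace_norm _) Lspace_norm_class.
have fin : 'N[mu]_2%:E[EFin \o Lspace_repr f]%E \is a fin_num.
  by rewrite -(finite_norm_fine (Lspace_repr f)).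
rewrite -powR_mulrn ?fine_ge0 ?Lnorm_ge0//.
have -> : fine 'N[mu]_2%:E[EFin \o Lspace_repr f]%E `^ 2 =
    fine ('N[mu]_2%:E[EFin \o Lspace_repr f] `^ 2)%E by rewrite -{2}(fineK fin).
rewrite powR_Lnorm//; congr fine; apply: eq_integral => n _.
by rewrite /= powR_mulrn// real_normK ?num_real// expr2.
Qed.

Lemma l2_dot_eq0 f : l2_dot f f = 0 -> f = 0.
Proof. by rewrite l2_dot_norm => /eqP; rewrite sqrf_eq0 normr_eq0 => /eqP. Qed.

End Counting.

(** * Gluing the factorizations of the levels *)

Section GLFin.
Context (R : realType) (Ls : nat -> level R).
Hypothesis Lfac : forall k, l1_factorable (Ls k).
Let X : completeNormedModType R := l1sum Ls.
Context (u : boundedOp X (l2 R)) (lam : R).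
Hypothesis u_summing : summing_constant u lam.

Let lam0 : 0 < lam. Proof. by case: u_summing. Qed.

Lemma summing_finType (K : finType) (x : K -> X) B :
  (forall s : K -> bool, `|\sum_k sgn R (s k) *: x k| <= B) ->
  \sum_k `|u (x k)| <= lam * B.
Proof.
move=> xB; have [_ /(_ #|K| (fun t => x (enum_val t)))] := u_summing.
have -> : \sum_k `|u (x k)| = \sum_(t < #|K|) `|u (x (enum_val t))|.
  by rewrite (reindex (@enum_val _ K))//=; exact: (onW_bij _ (@enum_val_bij K)).
move=> /le_trans; apply; rewrite ler_pM2l//; apply: weak_l1_norm_le => s.
have := xB (fun k => s (enum_rank k)).
rewrite (reindex (@enum_val _ K))//=; last exact: (onW_bij _ (@enum_val_bij K)).
by under eq_bigr do rewrite enum_valK.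
Qed.

Lemma delta_sum_le1 (p N : nat) : \sum_(i < N) ((p == i)%:R : R) <= 1.
Proof.
have [pN|Np] := ltnP p N.
  rewrite (bigD1 (Ordinal pN))//= eqxx big1 ?addr0// => i iN.
  by rewrite eq_sym -[p]/(val (Ordinal pN)) val_eqE (negbTE iN).
rewrite big1 ?ler01// => i _; case: eqP => // pi.
by have := ltn_ord i; rewrite -pi ltnNge Np.
Qed.

(** A factorization of [u] on one level through a finite l_1; the second factor is normalized, so
    the constant sits in [lfN] and the levels can be summed. *)
Record level_factor (k : nat) := LevelFactor {
  lfM : finType;
  lfa : lfM -> lidx (Ls k) -> R;
  lfb : lfM -> l2 R;
  lfb1 : forall m, `|lfb m| <= 1;
  lfE : forall z : lidx (Ls k) -> R, lsp z -> u (emb z) = \sum_m dot z (lfa m) *: lfb m;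
  lfN : forall z : lidx (Ls k) -> R, lsp z -> \sum_m `|dot z (lfa m)| <= 17 * lam * lnorm z }.

(** The images of the rows of [lproj] span the image of the level; Gram-Schmidt in l_2 gives it
    finitely many coordinates, in which [l1_factorable] applies to [u] divided by [lam]. *)
Lemma level_factor_exists k : exists _ : level_factor k, True.
Proof.
pose n := #|lidx (Ls k)|.
pose w (i : lidx (Ls k)) : l2 R := u (emb (lproj i)).
have [f [fon vE _]] := gram_schmidt (@l2_dot_lin R) (@l2_dotC R) (@l2_dot_ge0 R) (@l2_dot_eq0 R)
  (fun t : 'I_n => w (enum_val t)).
have wE i : w i = \sum_l l2_dot (w i) (f l) *: f l.
  by have := vE (enum_rank i); rewrite enum_rankK.
have uE (z : lidx (Ls k) -> R) : lsp z -> u (emb z) = \sum_i z i *: w i.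
  move=> wz; rewrite -{1}(lprojK wz) -(bop_suml u) -emb_sum//.
  exact: lsp_proj.
have dotE (z : lidx (Ls k) -> R) l : lsp z -> l2_dot (u (emb z)) (f l) = \sum_i z i * l2_dot (w i) (f l).
  move=> wz; rewrite uE//; elim: (index_enum _) => [|i s IH].
    by rewrite !big_nil (form0 (@l2_dot_lin R)).
  by rewrite !big_cons l2_dot_lin IH.
have uE2 (z : lidx (Ls k) -> R) : lsp z -> u (emb z) = \sum_l l2_dot (u (emb z)) (f l) *: f l.
  move=> wz; rewrite [RHS](eq_bigr (fun l => \sum_i (z i * l2_dot (w i) (f l)) *: f l)) => [|l _].
    2: by rewrite dotE// scaler_suml.
  rewrite [RHS]exchange_big/= [LHS]uE//; apply: eq_bigr => i _.
  rewrite {1}(wE i) scaler_sumr; apply: eq_bigr => l _; by rewrite scalerA.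
pose zeta i l := lam^-1 * l2_dot (w i) (f l).
have zetaE (z : lidx (Ls k) -> R) : lsp z -> app zeta z =1 fun l => lam^-1 * l2_dot (u (emb z)) (f l).
  move=> wz l; rewrite dotE// big_distrr/=; apply: eq_bigr => i _.
  by rewrite /zeta mulrCA.
have zetaN (z : lidx (Ls k) -> R) : lsp z -> nrm2 (app zeta z) = lam^-1 * `|u (emb z)|.
  move=> wz; rewrite (eq_nrm2 (zetaE z wz)) nrm2Z ger0_norm ?invr_ge0 ?(ltW lam0)//.
  congr (_ * _); apply/eqP; rewrite -(eqrXn2 (ltn0Sn 1)) ?nrm2_ge0// nrm2_sqr.
  rewrite -l2_dot_norm; apply/eqP; symmetry.
  exact: (form_expand_eq (@l2_dot_lin R) (@l2_dotC R) fon (uE2 z wz)).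
have zs : summing (@lsp _ (Ls k)) (@lnorm _ (Ls k)) zeta 1.
  move=> K x B wx xB; rewrite mul1r.
  rewrite (eq_bigr (fun t => lam^-1 * `|u (emb (x t))|)) => [|t _]; last exact: zetaN.
  rewrite -big_distrr/= ler_pdivrMl//; apply: summing_finType => s.
  rewrite -emb_sum//; apply: le_trans (emb_norm_le _) (xB s).
  exact: lsp_sum.
have [M [l [y [dec cst]]]] := Lfac zs.
pose b m : l2 R := (nrm2 (y m))^-1 *: \sum_t y m t *: f t.
have b1 m : `|b m| <= 1.
  have h : `|\sum_t y m t *: f t| <= nrm2 (y m).
    rewrite -(ler_pXn2r (ltn0Sn 1)) ?nnegrE ?nrm2_ge0// -l2_dot_norm nrm2_sqr.
    exact: (form_expand (@l2_dot_lin R) (@l2_dotC R)).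
  rewrite normrZ ger0_norm ?invr_ge0 ?nrm2_ge0//.
  have [->|y0] := eqVneq (nrm2 (y m)) 0; first by rewrite invr0 mul0r.
  by rewrite ler_pdivrMl ?mulr1// lt_def y0 nrm2_ge0.
pose a m i := lam * nrm2 (y m) * l m i.
have aE (z : lidx (Ls k) -> R) m : dot z (a m) = lam * nrm2 (y m) * dot z (l m).
  by rewrite /dot big_distrr/=; apply: eq_bigr => i _; rewrite mulrCA.
have bE m t c : c * y m t = c * nrm2 (y m) * ((nrm2 (y m))^-1 * y m t).
  have [h|h] := eqVneq (nrm2 (y m)) 0; last by rewrite mulrA mulfK.
  by rewrite (nrm2_eq0 t h) h !mulr0.
unshelve eexists (@LevelFactor k M a b b1 _ _) => //.
- move=> z wz; rewrite [LHS](uE2 z wz).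
  transitivity (\sum_m \sum_t (dot z (a m) * ((nrm2 (y m))^-1 * y m t)) *: f t).
    rewrite exchange_big/=; apply: eq_bigr => t _; rewrite -scaler_suml; congr (_ *: _).
    have := dec z wz t; rewrite zetaE// => /(congr1 (fun r => lam * r)).
    rewrite mulVKf ?gt_eqF// => ->; rewrite big_distrr/=; apply: eq_bigr => m _.
    by rewrite aE bE; ring.
  apply: eq_bigr => m _; rewrite /b scalerA scaler_sumr; apply: eq_bigr => t _.
  by rewrite scalerA mulrA.
- move=> z wz; rewrite mulrAC mulrC; apply: le_trans (_ : lam * cost l y z <= _).
    rewrite /cost big_distrr/=; apply: ler_sum => m _.
    by rewrite aE !normrM (gtr0_norm lam0) (ger0_norm (nrm2_ge0 _)) -mulrA [nrm2 _ * _]mulrC.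
  by rewrite ler_pM2l// cst.
Qed.

Let fct k : level_factor k := projT1 (cid (level_factor_exists k)).
Let Ix := {k : nat & lfM (fct k)}.
Let mu := @counting nat R.

(** Pairs of a level and an index there are coded by natural numbers, which realizes the l_1-sum of
    the finite l_1 spaces as L_1 of the counting measure; numbers that code nothing get 0. *)
Let vf (x : X) (n : nat) : R := if (pickle_inv n : option Ix) is Some j
  then dot (part (l1sum_fun x) (tag j)) (lfa (tagged j)) else 0.
Let be (n : nat) : l2 R := if (pickle_inv n : option Ix) is Some j then lfb (tagged j) else 0.

Let vf_le x N : \sum_(n < N) `|vf x n| <= 17 * lam * `|x|.
Proof.
pose kk (n : nat) : nat := if (pickle_inv n : option Ix) is Some j then tag j else 0%N.
(* Only levels below [K] occur among the first [N] codes, and each pair is counted at most once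
   since the coding is injective. *)
pose K := (\max_(n < N) kk n).+1.
pose g k (m : lfM (fct k)) := `|dot (part (l1sum_fun x) k) (lfa m)|.
have vE (n : 'I_N) : `|vf x n| = \sum_(k < K) \sum_(m : lfM (fct k))
    (pickle (Tagged (fun k => lfM (fct k)) m : Ix) == n)%:R * g k m.
  rewrite /vf; case E : (pickle_inv n) => [[k m]|]; last first.
    rewrite normr0 big1// => k _; rewrite big1// => m _.
    case: eqP => [mn|_]; last by rewrite mul0r.
    by move: E; rewrite -mn pickleK_inv.
  have kK : (k < K)%N.
    rewrite ltnS; apply: leq_trans (leq_bigmax n).
    by rewrite /kk E.
  have nE : pickle (Tagged (fun k => lfM (fct k)) m : Ix) = n.
    by have := @pickle_invK Ix n; rewrite E.
  rewrite (bigD1 (Ordinal kK))//= [X in _ + X]big1 ?addr0; last first.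
    move=> k' kk'; rewrite big1// => m' _; case: eqP => [mn|_]; last by rewrite mul0r.
    have /(pcan_inj pickleK_inv)/(congr1 (@projT1 _ _))/= := etrans mn (esym nE).
    by move=> h; case/eqP: kk'; exact/val_inj.
  rewrite (bigD1 m)//= nE eqxx mul1r big1 ?addr0// => m' mm.
  case: eqP => [mn|_]; last by rewrite mul0r.
  have /(pcan_inj pickleK_inv)/eqP := etrans mn (esym nE).
  by rewrite eq_Tagged/= (negbTE mm).
under eq_bigr do rewrite vE.
rewrite exchange_big/=; apply: (@le_trans _ _ (\sum_(k < K) \sum_(m : lfM (fct k)) g k m)).
  apply: ler_sum => k _; rewrite exchange_big/=; apply: ler_sum => m _.
  by rewrite -big_distrl/=; apply: ler_piMl; [exact: normr_ge0|exact: delta_sum_le1].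
apply: (@le_trans _ _ (\sum_(k < K) 17 * lam * lnorm (part (l1sum_fun x) k))).
  by apply: ler_sum => k _; apply: lfN; exact: l1sum_lsp.
rewrite -big_distrr/= ler_wpM2l ?mulr_ge0 ?(ltW lam0)//; exact: psum_le_norm.
Qed.

Let vf_int x : integrableR mu (vf x).
Proof. by case: (integrableR_counting (vf_le x)). Qed.

Let v_fun (x : X) : LspaceType1 mu := L1of mu (vf x).

Let v_norm x : `|v_fun x| <= 17 * lam * `|x|.
Proof. by rewrite /v_fun L1of_norm//; case: (integrableR_counting (vf_le x)). Qed.

Let v_subproof : v_fun \in @bounded_op R X (LspaceType1 mu).
Proof.
apply/bounded_opP; split; last by exists (17 * lam).
move=> a x y; rewrite /v_fun -L1of_lin//; congr L1of; apply/funext => n.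
rewrite /vf; case: pickle_inv => [j|]; last by rewrite mulr0 addr0.
rewrite /dot big_distrr -big_split/=; apply: eq_bigr => i _.
by rewrite mulrA -mulrDl.
Qed.

Let v : boundedOp X (LspaceType1 mu) := BoundedOp v_subproof.

Let be1 n : `|be n| <= 1.
Proof. by rewrite /be; case: pickle_inv => [j|]; [exact: lfb1|rewrite normr0]. Qed.

(** The second factor sends the n-th basis vector to [be n]. Tested against functionals, it takes
    values in the bidual directly, as [gamma1] asks. *)
Let wphi (f : LspaceType1 mu) (phi : dual (l2 R)) : R^o :=
  Rintegral mu [set: nat] (fun n => Lspace_repr f n * phi (be n)).

Let phi_be (phi : dual (l2 R)) n : `|phi (be n) : R^o| <= `|phi|.
Proof. by apply: le_trans (ler_op_norm phi _) _; apply: ler_piMr; [exact: op_norm_ge0|exact: be1]. Qed.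

Let w_int (f : LspaceType1 mu) (phi : dual (l2 R)) : integrableR mu (fun n => Lspace_repr f n * (phi (be n) : R)).
Proof.
have := integrableR_lin (`|phi|) (integrableR_abs (integrableR_repr f)) (integrableR0 mu).
apply: le_integrable => // n _ /=; rewrite lee_fin addr0 normrM mulrC.
rewrite [leRHS]ger0_norm ?mulr_ge0//.
by rewrite ler_wpM2r//; exact: phi_be.
Qed.

Let w_norm (f : LspaceType1 mu) (phi : dual (l2 R)) : `|wphi f phi| <= `|f| * `|phi|.
Proof.
apply: le_trans (le_normr_Rintegral measurableT (w_int f phi)) _.
have fi := integrableR_abs (integrableR_repr f).
have -> : `|f| * `|phi| = Rintegral mu [set: nat] (fun n => `|Lspace_repr f n| * `|phi|).
  by rewrite RintegralZr// -L1of_norm ?L1of_repr//; exact: integrableR_repr.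
apply: le_Rintegral => //.
- by have := integrableR_abs (w_int f phi).
- have := integrableR_lin (`|phi|) fi (integrableR0 mu).
  by congr integrableR; apply/funext => n; rewrite addr0 mulrC.
- by move=> n _; rewrite normrM ler_wpM2l//; exact: phi_be.
Qed.

Let wphi_subproof f : wphi f \in @bounded_op R (dual (l2 R)) R^o.
Proof.
apply/bounded_opP; split; last by exists (`|f|) => phi; exact: w_norm.
move=> a phi psi; rewrite /wphi.
rewrite -[X in _ = X + _]RintegralZl//; last exact: w_int.
rewrite -RintegralD//; last 2 first.
- have := integrableR_lin a (w_int f phi) (integrableR0 mu).
  by congr integrableR; apply/funext => n; rewrite addr0.
- exact: w_int.
apply: eq_Rintegral => n _.
by rewrite -[(a *: phi + psi) _]/(a * phi (be n) + psi (be n)); ring.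
Qed.

Let w_fun f : dual (dual (l2 R)) := BoundedOp (wphi_subproof f).

Let w_fun_norm f : `|w_fun f| <= 1 * `|f|.
Proof. by rewrite mul1r; apply: op_norm_le => // phi; exact: w_norm. Qed.

Let w_subproof : w_fun \in @bounded_op R (LspaceType1 mu) (dual (dual (l2 R))).
Proof.
apply/bounded_opP; split; last by exists 1.
move=> a f g; apply/val_inj/funext => phi.
rewrite -[LHS]/(wphi (a *: f + g) phi) -[RHS]/(a * wphi f phi + wphi g phi) /wphi.
rewrite -RintegralZl//; last exact: w_int.
rewrite -RintegralD//; last 2 first.
- have := integrableR_lin a (w_int f phi) (integrableR0 mu).
  by congr integrableR; apply/funext => n; rewrite addr0.
- exact: w_int.
by apply: eq_Rintegral => n _; rewrite Lspace_repr_lin; ring.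
Qed.

Let w : boundedOp (LspaceType1 mu) (dual (dual (l2 R))) := BoundedOp w_subproof.

Let factor_emb k (z : lidx (Ls k) -> R) (phi : dual (l2 R)) : lsp z ->
  wphi (v_fun (@emb R Ls k z)) phi = phi (u (@emb R Ls k z)).
Proof.
move=> wz; rewrite (lfE (fct k) wz) (bop_suml phi) /wphi.
pose N (m : lfM (fct k)) := pickle (Tagged (fun k => lfM (fct k)) m : Ix).
transitivity (Rintegral mu [set: nat] (fun n =>
    \sum_m dot z (lfa m) * ((n == N m)%:R * (phi (be n) : R)))).
  apply: eq_Rintegral => n _; rewrite /v_fun L1of_counting//.
  have -> : vf (@emb R Ls k z) n = \sum_m dot z (lfa m) * (n == N m)%:R.
    rewrite /vf; case E : (pickle_inv n) => [[k' m']|]; last first.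
      rewrite big1// => m _; case: eqP => [nm|_]; last by rewrite mulr0.
      by move: E; rewrite nm pickleK_inv.
    have nE : pickle (Tagged (fun k => lfM (fct k)) m' : Ix) = n.
      by have := @pickle_invK Ix n; rewrite E.
    rewrite [LHS]/=; have [kk|kk] := eqVneq k' k; last first.
      rewrite part_emb0// /dot big1 => [|i _]; last by rewrite mul0r.
      rewrite big1// => m _; case: eqP => [nm|_]; last by rewrite mulr0.
      have /(pcan_inj pickleK_inv)/(congr1 (@projT1 _ _))/= := etrans nE nm.
      by move=> h; rewrite h eqxx in kk.
    subst k'; rewrite part_emb// (bigD1 m')//= -nE eqxx mulr1 big1 ?addr0// => m mm.
    case: eqP => [nm|_]; last by rewrite mulr0.
    have /(pcan_inj pickleK_inv)/eqP := nm.
    by rewrite eq_Tagged/= eq_sym (negbTE mm).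
  by rewrite big_distrl/=; apply: eq_bigr => m _; rewrite mulrA.
rewrite Rintegral_sum => [|m]; last by case: (Rintegral_counting_delta (fun n => phi (be n) : R) (N m)).
apply: eq_bigr => m _.
have [_ ->] := Rintegral_counting_delta (fun n => phi (be n) : R) (N m).
by rewrite /be /N pickleK_inv.
Qed.

Lemma gamma1_le : (gamma1 u <= (17 * lam)%:E)%E.
Proof.
apply: ge_ereal_inf; exists (`|v| * `|w|)%:E.
  exists _, nat, mu, v, w; split=> // x; apply/val_inj/funext => phi.
  rewrite -[LHS]/(phi (u x)) -[RHS]/(wphi (v_fun x) phi).
  (* The difference of the two sides is a bounded functional of x, so by density it suffices that it
     vanish on the embedded levels. *)
  have Dsub : (fun x : X => phi (u x) - wphi (v_fun x) phi) \in @bounded_op R X R^o.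
    apply/bounded_opP; split.
      move=> a x1 x2; rewrite bop_linear (bop_linear phi).
      rewrite -[wphi (v_fun (a *: x1 + x2)) phi]/((w (v (a *: x1 + x2)) : dual (dual (l2 R))) phi).
      rewrite bop_linear bop_linear.
      rewrite -[((a *: w (v x1) + w (v x2)) : dual (dual (l2 R))) phi]/(a * wphi (v_fun x1) phi + wphi (v_fun x2) phi).
      by rewrite /GRing.scale/=; ring.
    exists (`|phi| * `|u| + 17 * lam * `|phi|) => x1.
    apply: le_trans (ler_normB _ _) _; rewrite mulrDl lerD//.
      apply: le_trans (ler_op_norm phi _) _; rewrite -mulrA ler_wpM2l ?op_norm_ge0//.
      exact: (ler_op_norm u).
    apply: le_trans (w_norm _ _) _; rewrite mulrAC ler_wpM2r//.
  have := @bop_emb_eq0 R Ls _ (BoundedOp Dsub) x => /= D0.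
  apply/eqP; rewrite -subr_eq0; apply/eqP; apply: D0 => k z wz.
  by rewrite factor_emb// subrr.
rewrite lee_fin -[leRHS]mulr1; apply: ler_pM => //.
  by apply: op_norm_le => //; rewrite mulr_ge0// ltW.
by apply: op_norm_le.
Qed.

End GLFin.

Lemma GL_fin_le (R : realType) (Ls : nat -> level R) :
  (forall k, l1_factorable (Ls k)) -> (GL_fin (l1sum Ls) <= 17%:E)%E.
Proof.
move=> Lfac; apply/ereal_supP => _ [u [u0 _ ->]].
have p0 := pi1_gt0 u0.
(* If pi_1 is infinite the quotient is 0, the inverse of +oo being 0. *)
case E : (pi1 u) p0 => [r| |]//; last by rewrite invey mule0 lee_fin.
rewrite lte_fin => r0; rewrite inver gt_eqF//.
suff h : (gamma1 u <= (17 * r)%:E)%E.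
  apply: le_trans (lee_wpmul2r _ h) _; first by rewrite lee_fin invr_ge0 ltW.
  by rewrite -EFinM lee_fin mulfK// gt_eqF.
(* The infimum defining pi_1 is only approached, hence the slack e / 17. *)
apply/lee_addgt0Pr => e e0.
have e17 : 0 < e / 17 by rewrite divr_gt0.
have pfin : pi1 u \is a fin_num by rewrite E.
have [_ [l ul <-]] := lb_ereal_inf_adherent e17 pfin.
rewrite -/(pi1 u) E -EFinD lte_fin => lr.
apply: le_trans (gamma1_le Lfac ul) _; rewrite -EFinD lee_fin.
have : 17 * l < 17 * (r + e / 17) by rewrite ltr_pM2l.
by rewrite mulrDr [17 * (e / 17)]mulrC divfK// => /ltW.
Qed.

Theorem theorem1 (R : realType) :
  exists X : completeNormedModType R, GL X = +oo%E /\ (GL_fin X < +oo)%E.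
Proof.
have /choice[Ls LsP] : forall k : nat, exists L : level R, exists (P : finType) (loc : P -> lidx L),
    [/\ (0 < #|P|)%N, l1_factorable L, dominated_coords k.+1%:R loc & tested_coords k.+1%:R loc].
  by move=> k; apply: finite_level; rewrite ler1n.
exists (l1sum Ls); split; last first.
  apply: (@le_lt_trans _ _ 17%:E); last exact: ltry.
  by apply: GL_fin_le => k; have [P [loc []]] := LsP k.
have lower k : ((k.+1%:R / 12000)%:E <= GL (l1sum Ls))%E.
  have [P [loc [P0 _ dom test]]] := LsP k.
  by apply: (GL_ge _ P0 dom test); rewrite ltr0n.
(* A level with lambda above 12000 A already forces GL to exceed A. *)
apply/eqyP => A A0; apply: le_trans (lower (Num.truncn (12000 * A))).
have c0 : 0 < 12000 :> R by rewrite ltr0n.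
by rewrite lee_fin (ler_pdivlMr _ _ c0) [A * _]mulrC; exact/ltW/truncnS_gt.
Qed.
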